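(* Let $m\ge 2$ and $c>0$. For all integers $N\ge 0$, $k\ge 0$ and $1\le i\le d_k$, the even Clifford prolate spheroidal wave function $\psi_{2N,m}^{k,c,i}$ is an eigenfunction of $QP_c$, and the corresponding eigenvalue is positive: there is a real $\lambda>0$ with $QP_c\psi_{2N,m}^{k,c,i}=\lambda\,\psi_{2N,m}^{k,c,i}$ on $B(1)$.
   Context: $\mathbb{R}_m$ (resp. $\mathbb{C}_m$) is the real (resp. complex) Clifford algebra generated by $e_1,\dots,e_m$ with $e_j^2=-1$, $e_ie_j=-e_je_i$ ($i\ne j$). A point $x\in\mathbb{R}^m$ is identified with $\sum_j e_jx_j$, so $x^2=-|x|^2$; $\langle x,y\rangle=\sum_j x_jy_j$ for vectors. Clifford conjugation $\lambda\mapsto\bar\lambda$ is the conjugate-linear anti-automorphism of $\mathbb{C}_m$ with $\overline{e_j}=-e_j$; $[\lambda]_0$ is the scalar part and $|\lambda|^2=[\bar\lambda\lambda]_0$. The Dirac operator is $\partial_x=\sum_j e_j\partial_{x_j}$ (acting from the left). $B(r)$ is the closed ball of radius $r$ centred at $0$ in $\mathbb{R}^m$. For $c\ge0$, $L_cf(x)=\partial_x\big((1-|x|^2)\partial_xf(x)\big)+4\pi^2c^2|x|^2f(x)$ on $B(1)$. $M_l^+(k)$ is the right $\mathbb{R}_m$-module of $\mathbb{R}_m$-valued polynomials on $\mathbb{R}^m$ that are homogeneous of degree $k$ and left monogenic ($\partial_xY=0$); it has rank $d_k=\frac{(m+k-2)!}{(m-2)!\,k!}$. Fix a basis $\{Y_k^i\}_{i=1}^{d_k}$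 of it with $\int_{S^{m-1}}\overline{Y_k^i(\omega)}Y_k^j(\omega)\,d\omega=\delta_{ij}$. Even CPSWFs: the real numbers $\chi$ for which there is a nonzero $P\in C^\infty([0,1],\mathbb{R})$ with $L_c[P(|x|^2)Y_k^i(x)]=\chi P(|x|^2)Y_k^i(x)$ on $B(1)$ do not depend on $i$ and form a strictly increasing sequence $\chi_{0,m}^{k,c}<\chi_{2,m}^{k,c}<\chi_{4,m}^{k,c}<\cdots$; for $\chi=\chi_{2N,m}^{k,c}$ the function $P=P_{N,m}^{k,c}$ is unique up to a real factor, and $\psi_{2N,m}^{k,c,i}(x)=P_{N,m}^{k,c}(|x|^2)Y_k^i(x)$, normalised in $L^2(B(1))$ and extended by $0$ outside $B(1)$. Operators: $\mathcal{F}f(\xi)=\int_{\mathbb{R}^m}e^{-2\pi i\langle x,\xi\rangle}f(x)\,dx$; $Qf=\chi_{B(1)}f$; $P_cf(x)=\int_{B(c)}\mathcal{F}f(\xi)e^{2\pi i\langle\xi,x\rangle}\,d\xi$ (in the exponents $i$ is the imaginary unit; $\chi_{B(1)}$ is the indicator function). *)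

(* Defs.v *)
From HB Require Import structures.
From mathcomp Require Import all_boot all_order all_algebra ring.

Set Implicit Arguments.
Unset Strict Implicit.
Unset Printing Implicit Defensive.

Import Order.TTheory GRing.Theory Num.Theory.

Local Open Scope ring_scope.

Section SymmetricDifference.
Variable m : nat.
Implicit Types A B C : {set 'I_m}.

Definition symd A B : {set 'I_m} := (A :\: B) :|: (B :\: A).

Lemma in_symd A B i : (i \in symd A B) = (i \in A) (+) (i \in B).
Proof. by rewrite !inE; case: (i \in A); case: (i \in B). Qed.

Lemma symdC A B : symd A B = symd B A.
Proof. by apply/setP => i; rewrite !in_symd addbC. Qed.

Lemma symdA A B C : symd A (symd B C) = symd (symd A B) C.
Proof. by apply/setP => i; rewrite !in_symd addbA. Qed.

Lemma sym0d A : symd set0 A = A.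
Proof. by apply/setP => i; rewrite in_symd inE. Qed.

Lemma symd0 A : symd A set0 = A.
Proof. by rewrite symdC sym0d. Qed.

Lemma symdd A : symd A A = set0.
Proof. by apply/setP => i; rewrite in_symd addbb inE. Qed.

Lemma symdK A B : symd A (symd A B) = B.
Proof. by rewrite symdA symdd sym0d. Qed.

Lemma symd_eq A B C : (symd A B == C) = (B == symd A C).
Proof. by apply/eqP/eqP => [<-|->]; rewrite symdK. Qed.

End SymmetricDifference.

(* The Clifford algebra over [K] with generators e_1, ..., e_m, e_j^2 = -1, in
   the basis e_A = e_{i_1} ... e_{i_r}, A = {i_1 < ... < i_r}: the element [a]
   is the sum over A of (a A) e_A. *)
Definition clifford (K : Type) (m : nat) : Type := {ffun {set 'I_m} -> K}.

HB.instance Definition _ (K : pzRingType) (m : nat) :=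
  GRing.Lmodule.copy (clifford K m) {ffun {set 'I_m} -> K^o}.

Section Clifford.
Variables (K : comNzRingType) (m : nat).
Implicit Types (a b c : clifford K m) (A B C : {set 'I_m}).

(* e_A e_B = cl_sign A B e_(A Δ B): sorting the juxtaposed word costs one
   transposition for each pair j < i with i in A and j in B, and each i in both
   A and B contributes e_i^2 = -1. *)
Definition cl_sign A B : K :=
  \prod_(i in A) \prod_(j in B | (j <= i)%N) -1.

Definition cl_basis A : clifford K m := [ffun B => (B == A)%:R].

Definition cl_mul a b : clifford K m :=
  [ffun C => \sum_A \sum_(B | symd A B == C) cl_sign A B * a A * b B].

Lemma cl_mulE a b C :
  cl_mul a b C = \sum_A cl_sign A (symd A C) * a A * b (symd A C).
Proof.
rewrite ffunE; apply: eq_bigr => A _.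
by rewrite (big_pred1 (symd A C)) // => B /=; rewrite symd_eq.
Qed.

Let prod_symd A B (F : 'I_m -> K) : (forall i, F i * F i = 1) ->
  \prod_(i in symd A B) F i = (\prod_(i in A) F i) * (\prod_(i in B) F i).
Proof.
move=> FF; rewrite [LHS]big_mkcond [X in X * _]big_mkcond [X in _ * X]big_mkcond.
rewrite -big_split /=; apply: eq_bigr => i _; rewrite in_symd.
by case: (i \in A); case: (i \in B); rewrite /= ?mulr1 ?mul1r ?FF.
Qed.

Let sqr_sign_prod (P : pred 'I_m) :
  (\prod_(j | P j) -1 : K) * (\prod_(j | P j) -1) = 1.
Proof. by rewrite -big_split /= big1 // => j _; rewrite mulrNN mulr1. Qed.

Lemma cl_signDl A A' B : cl_sign (symd A A') B = cl_sign A B * cl_sign A' B.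
Proof. by rewrite /cl_sign prod_symd. Qed.

Lemma cl_signE A B :
  cl_sign A B = \prod_(j in B) \prod_(i in A | (j <= i)%N) -1.
Proof.
rewrite /cl_sign (exchange_big_dep (fun j => j \in B)) /=; last first.
  by move=> i j _ /andP[].
by apply: eq_bigr => j jB; apply: eq_bigl => i; rewrite jB.
Qed.

Lemma cl_signDr A B B' : cl_sign A (symd B B') = cl_sign A B * cl_sign A B'.
Proof. by rewrite !cl_signE prod_symd. Qed.

Lemma cl_sign0l B : cl_sign set0 B = 1.
Proof. by rewrite /cl_sign big_set0. Qed.

Lemma cl_sign0r A : cl_sign A set0 = 1.
Proof. by rewrite cl_signE big_set0. Qed.

Lemma cl_sign_sqr A B : cl_sign A B * cl_sign A B = 1.
Proof. by rewrite -cl_signDl symdd cl_sign0l. Qed.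

Lemma cl_mulA : associative cl_mul.
Proof.
move=> a b c; apply/ffunP => D; rewrite !cl_mulE.
under eq_bigr => A _ do rewrite cl_mulE mulr_sumr.
under [RHS]eq_bigr => A _ do rewrite cl_mulE mulr_sumr mulr_suml.
rewrite [RHS]exchange_big /=; apply: eq_bigr => A _.
rewrite [RHS](reindex_inj (can_inj (symdK A))) /=.
apply: eq_bigr => B _; rewrite symdK -symdA.
rewrite [symd B (symd A D)]symdA [symd B A]symdC -symdA.
set E := symd A (symd B D).
have -> : symd A D = symd B E by rewrite /E symdA [symd B A]symdC -symdA symdK.
by rewrite cl_signDl cl_signDr; ring.
Qed.

Lemma cl_mul1l : left_id (cl_basis set0) cl_mul.
Proof.
move=> a; apply/ffunP => C; rewrite cl_mulE (bigD1 set0) //= big1 ?addr0.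
  by rewrite ffunE eqxx sym0d cl_sign0l !mul1r.
by move=> A /negbTE A0; rewrite ffunE A0 mulr0 mul0r.
Qed.

Lemma cl_mul1r : right_id (cl_basis set0) cl_mul.
Proof.
move=> a; apply/ffunP => C; rewrite cl_mulE (bigD1 C) //= big1 ?addr0.
  by rewrite ffunE symdd eqxx cl_sign0r mulr1 mul1r.
move=> A AC; rewrite ffunE; case: eqP => [/eqP|]; rewrite ?mulr0 //.
by rewrite symd_eq symd0 eq_sym (negbTE AC).
Qed.

Lemma cl_mulDl : left_distributive cl_mul +%R.
Proof.
move=> a b c; apply/ffunP => C; rewrite [RHS]ffunE !cl_mulE -big_split /=.
by apply: eq_bigr => A _; rewrite ffunE mulrDr mulrDl.
Qed.

Lemma cl_mulDr : right_distributive cl_mul +%R.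
Proof.
move=> a b c; apply/ffunP => C; rewrite [RHS]ffunE !cl_mulE -big_split /=.
by apply: eq_bigr => A _; rewrite ffunE mulrDr.
Qed.

Lemma cl_1_neq0 : cl_basis set0 != 0.
Proof.
by apply/eqP => /ffunP/(_ set0)/eqP; rewrite !ffunE eqxx oner_eq0.
Qed.

HB.instance Definition _ := GRing.Zmodule_isNzRing.Build (clifford K m)
  cl_mulA cl_mul1l cl_mul1r cl_mulDl cl_mulDr cl_1_neq0.

Definition cl_gen (j : 'I_m) : clifford K m := cl_basis [set j].

Lemma cl_basisM A B :
  cl_basis A * cl_basis B = cl_sign A B *: cl_basis (symd A B).
Proof.
apply/ffunP => C; rewrite [LHS]cl_mulE !ffunE (bigD1 A) //= big1 ?addr0.
  rewrite !ffunE eqxx mulr1 symd_eq.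
  by case: (eqVneq C (symd A B)) => [->|_]; rewrite ?symdK // [LHS]mulr0 [RHS]mulr0.
by move=> A' /negbTE A'A; rewrite ffunE A'A mulr0 mul0r.
Qed.

Lemma cl_gen_sqr j : cl_gen j * cl_gen j = -1.
Proof.
rewrite cl_basisM symdd /cl_sign big_set1 (big_pred1 j) ?scaleN1r // => i /=.
by rewrite inE andb_idr // => /eqP->.
Qed.

Lemma cl_gen_anticomm i j : i != j ->
  cl_gen i * cl_gen j = - (cl_gen j * cl_gen i).
Proof.
have sE k l : k != l -> cl_sign [set k] [set l] = (-1) ^+ (l < k)%N.
  move=> kl; rewrite /cl_sign big_set1; case: ltnP => lk.
    rewrite (big_pred1 l) // => o /=.
    by rewrite inE andb_idr // => /eqP->; rewrite ltnW.
  rewrite big_pred0 // => o; rewrite inE; apply/negbTE; rewrite negb_and -ltnNge.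
  case: (eqVneq o l) => //= ->; rewrite ltn_neqAle lk andbT.
  by apply: contra_neq kl => ?; apply/val_inj.
move=> ij; have ji : j != i by rewrite eq_sym.
rewrite !cl_basisM symdC !sE // -scaleNr; congr (_ *: _).
case: (ltngtP i j) => [_|_|/val_inj eij]; rewrite ?expr1 ?expr0 ?opprK //.
by rewrite eij eqxx in ij.
Qed.

(* Clifford conjugation over a ring of real scalars.  As e_A^2 = cl_sign A A,
   the inverse of e_A, i.e. its conjugate, is cl_sign A A e_A. *)
Definition cl_conj a : clifford K m := [ffun A => cl_sign A A * a A].

Lemma cl_conj_gen j : cl_conj (cl_gen j) = - cl_gen j.
Proof.
apply/ffunP => A; rewrite !ffunE; case: eqP => [->|_]; last by rewrite mulr0 oppr0.
rewrite /cl_sign big_set1 (big_pred1 j) ?mulr1 // => i /=.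
by rewrite inE andb_idr // => /eqP->.
Qed.

Lemma cl_conjM a b : cl_conj (a * b) = cl_conj b * cl_conj a.
Proof.
apply/ffunP => C; rewrite ffunE [X in _ * X]cl_mulE [RHS]cl_mulE mulr_sumr.
rewrite [RHS](reindex_inj (can_inj (@symdK _ C))) /=.
apply: eq_bigr => A _; rewrite !ffunE [symd (symd C A) C]symdC symdK [symd C A]symdC.
set B := symd A C; have {1 2}-> : C = symd A B by rewrite symdK.
move: B => B.
rewrite cl_signDl !cl_signDr.
transitivity (cl_sign A B * cl_sign A B *
  (cl_sign A A * cl_sign B B * cl_sign B A * a A * b B)); first by ring.
by rewrite cl_sign_sqr; ring.
Qed.

End Clifford.

From mathcomp Require Import complex.
From mathcomp Require Import all_classical all_reals all_analysis.
Import numFieldNormedType.Exports.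
Local Open Scope classical_set_scope.
Local Open Scope complex_scope.

(* Lebesgue measure on R^n, on the product sigma-algebra of n.-tuple R. *)
Section LebesgueTuple.
Variable R : realType.

Definition tcons n (p : R * n.-tuple R) : n.+1.-tuple R := [tuple of p.1 :: p.2].

Lemma measurable_tcons n : measurable_fun [set: R * n.-tuple R] (@tcons n).
Proof. exact: measurable_cons. Qed.

Section Step.
Variables (n : nat) (mu : {sigma_finite_measure set (n.-tuple R) -> \bar R}).

Definition lebesgue_cons : set (n.+1.-tuple R) -> \bar R :=
  pushforward (lebesgue_measure \x mu)%E (@tcons n).

Let lebesgue_cons0 : lebesgue_cons set0 = 0%E.
Proof. by rewrite /lebesgue_cons /pushforward preimage_set0 measure0. Qed.

Let lebesgue_cons_ge0 A : (0 <= lebesgue_cons A)%E.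
Proof. by rewrite /lebesgue_cons /pushforward measure_ge0. Qed.

Let lebesgue_cons_sigma_additive : semi_sigma_additive lebesgue_cons.
Proof.
move=> F mF tF mUF; rewrite /lebesgue_cons /pushforward preimage_bigcup.
apply: measure_semi_sigma_additive.
- by move=> i; rewrite -[X in measurable X]setTI; exact: measurable_tcons.
- apply/trivIsetP => /= i j _ _ ij; rewrite -preimage_setI.
  by move/trivIsetP : tF => /(_ _ _ _ _ ij) ->//; rewrite preimage_set0.
- by rewrite -preimage_bigcup -[X in measurable X]setTI; exact: measurable_tcons.
Qed.

HB.instance Definition _ := isMeasure.Build _ _ _ lebesgue_cons
  lebesgue_cons0 lebesgue_cons_ge0 lebesgue_cons_sigma_additive.

Let uncons (t : n.+1.-tuple R) : R * n.-tuple R := (thead t, [tuple of behead t]).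

Let measurable_uncons : measurable_fun [set: n.+1.-tuple R] uncons.
Proof.
apply/measurable_fun_pairP; split; last exact: measurable_behead.
exact: measurable_tnth.
Qed.

Let unconsK : cancel (@tcons n) uncons.
Proof. by move=> [x t]; congr pair; exact/val_inj. Qed.

Let lebesgue_cons_sigma_finite : sigma_finite setT lebesgue_cons.
Proof.
have /sigma_finiteP[F [TF ndF Foo]] := sigma_finiteT (@lebesgue_measure R).
have /sigma_finiteP[G [TG ndG Goo]] := sigma_finiteT mu.
exists (fun k => uncons @^-1` (F k `*` G k)).
  rewrite -preimage_bigcup -[LHS](preimage_setT uncons); congr (_ @^-1` _).
  rewrite -setXTT TF TG predeqE => -[x y]; split.
    move=> [/= [k _ Fkx] [l _ Gly]]; exists (maxn k l) => //; split.
    - by move: x Fkx; exact/subsetPset/ndF/leq_maxl.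
    - by move: y Gly; exact/subsetPset/ndG/leq_maxr.
  by move=> [k _ []/= ? ?]; split; exists k.
move=> k; have [? ?] := Foo k; have [? ?] := Goo k; split.
  rewrite -[X in measurable X]setTI; apply: measurable_uncons => //.
  exact: measurableX.
rewrite /lebesgue_cons /pushforward -comp_preimage.
rewrite (_ : uncons \o _ = id); last exact/funext.
by rewrite preimage_id product_measure1E// lte_mul_pinfty// ge0_fin_numE.
Qed.

HB.instance Definition _ := @Measure_isSigmaFinite.Build _ _ _ lebesgue_cons
  lebesgue_cons_sigma_finite.

End Step.

Fixpoint lebesgue_tuple n : {sigma_finite_measure set (n.-tuple R) -> \bar R} :=
  match n with
  | 0 => dirac ([tuple] : 0.-tuple R)
  | n'.+1 => lebesgue_cons (lebesgue_tuple n')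
  end.

End LebesgueTuple.

Section Euclidean.
Variables (R : realType) (m : nat).
Implicit Types (x y : 'rV[R]_m) (D : set 'rV[R]_m) (r : R).

Definition dot x y : R := \sum_j x 0 j * y 0 j.

(* The norm [`|x|] that the library puts on row vectors is the sup norm. *)
Definition enorm x : R := Num.sqrt (dot x x).

Definition cball r : set 'rV[R]_m := [set x | enorm x <= r].

Definition rowt (t : m.-tuple R) : 'rV[R]_m := \row_j tnth t j.

Definition vint D (f : 'rV[R]_m -> R) : R :=
  \int[lebesgue_tuple R m]_(t in rowt @^-1` D) f (rowt t).

Definition cl_int D (f : 'rV[R]_m -> clifford R m) : clifford R m :=
  [ffun A => vint D (fun x => f x A)].

Definition cl_cint D (f : 'rV[R]_m -> clifford R[i] m) : clifford R[i] m :=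
  [ffun A => vint D (fun x => complex.Re (f x A)) +i*
             vint D (fun x => complex.Im (f x A))].

(* Surface measure on the sphere: the measure of A is m times the Lebesgue
   measure of the cone {s w | 0 < s <= 1, w in A}. *)
Definition sphere_int (f : 'rV[R]_m -> clifford R m) : clifford R m :=
  m%:R *: cl_int (cball 1) (fun x => f ((enorm x)^-1 *: x)).

(* |a|^2 = [conj(a) a]_0 *)
Definition cl_normsq (a : clifford R m) : R := (cl_conj a * a) finset.set0.

Definition cl_complex (a : clifford R m) : clifford R[i] m :=
  [ffun A => (a A)%:C].

End Euclidean.

Section Dirac.
Variables (R : realType) (m : nat).
Implicit Type f : 'rV[R]_m -> clifford R m.

Definition partial (j : 'I_m) f (x : 'rV[R]_m) : clifford R m :=
  [ffun A => 'D_(delta_mx 0 j) (fun y => f y A) x].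

Definition dirac_op f (x : 'rV[R]_m) : clifford R m :=
  \sum_j cl_gen R j * partial j f x.

Definition L_op (c : R) f (x : 'rV[R]_m) : clifford R m :=
  dirac_op (fun y => (1 - enorm y ^+ 2) *: dirac_op f y) x
  + (4 * pi ^+ 2 * c ^+ 2 * enorm x ^+ 2) *: f x.

Definition homogeneous_poly (k : nat) f : Prop :=
  exists a : {ffun 'I_m -> 'I_k.+1} -> clifford R m, forall x,
    f x = \sum_(al : {ffun 'I_m -> 'I_k.+1} | (\sum_j al j)%N == k)
            (\prod_j x 0 j ^+ al j) *: a al.

Definition monogenic (k : nat) : set ('rV[R]_m -> clifford R m) :=
  [set f | homogeneous_poly k f /\ forall x, dirac_op f x = 0].

Definition monogenic_rank (k : nat) : nat :=
  ((m + k - 2)`! %/ ((m - 2)`! * k`!))%N.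

Definition monogenic_onb (k : nat)
    (Y : 'I_(monogenic_rank k) -> 'rV[R]_m -> clifford R m) : Prop :=
  [/\ forall i, monogenic k (Y i),
      forall f, monogenic k f -> exists! a : 'I_(monogenic_rank k) -> clifford R m,
        forall x, f x = \sum_i Y i x * a i
    & forall i j, sphere_int (fun w => cl_conj (Y i w) * Y j w) = (i == j)%:R].

End Dirac.

Section CPSWF.
Variables (R : realType) (m : nat).
Implicit Types (c chi : R) (P : R -> R) (Y psi : 'rV[R]_m -> clifford R m).

(* An element of C^oo([0, 1]) is represented by a smooth extension to the line;
   the conditions below only depend on its restriction to [0, 1]. *)
Definition smooth P : Prop := forall n t, derivable P^`(n) t 1.

Definition even_eigenfunction c Y chi P : Prop :=
  [/\ smooth P,
      exists2 t, 0 <= t <= 1 & P t != 0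
    & forall x, cball 1 x ->
        L_op c (fun y => P (enorm y ^+ 2) *: Y y) x
        = chi *: (P (enorm x ^+ 2) *: Y x)].

Definition even_eigenvalue c Y chi : Prop := exists P, even_eigenfunction c Y chi P.

(* [chi] has index N in the increasing enumeration chi_0 < chi_2 < chi_4 < ...
   of the eigenvalues: exactly N eigenvalues are smaller. *)
Definition nth_even_eigenvalue c Y (N : nat) chi : Prop :=
  even_eigenvalue c Y chi /\
  ([set z | even_eigenvalue c Y z /\ (z < chi)%R] #= `I_N)%card.

Definition even_cpswf c Y (N : nat) psi : Prop :=
  exists chi P,
    [/\ nth_even_eigenvalue c Y N chi,
        even_eigenfunction c Y chi P,
        forall x, psi x = if enorm x <= 1 then P (enorm x ^+ 2) *: Y x else 0
      & (\int[lebesgue_tuple R m]_(t in @rowt R m @^-1` cball 1)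
          (cl_normsq (psi (rowt t)))%:E = 1)%E].

End CPSWF.

Section TimeFrequencyLimiting.
Variables (R : realType) (m : nat).
Implicit Type f : 'rV[R]_m -> clifford R[i] m.

Definition cis (t : R) : R[i] := cos t +i* sin t.

Definition fourier f (xi : 'rV[R]_m) : clifford R[i] m :=
  cl_cint setT (fun x => cis (- (2 * pi * dot x xi)) *: f x).

Definition Q_op f (x : 'rV[R]_m) : clifford R[i] m :=
  if enorm x <= 1 then f x else 0.

Definition P_op (c : R) f (x : 'rV[R]_m) : clifford R[i] m :=
  cl_cint (cball c) (fun xi => cis (2 * pi * dot xi x) *: fourier f xi).

End TimeFrequencyLimiting.

(* Main.v *)
(* The components of Y_k^i are solid harmonics H, and on functions P(|x|^2) H(x)
   the operator L_c is, up to sign and a constant, the scalar prolate operator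
   D = div((1 - |x|^2) grad) - s^2 |x|^2 with s = 2 pi c.  For g = cos(s .) or
   sin(s .) the kernel g(<x, y>) satisfies D_x g(<x, y>) = D_y g(<x, y>), and D is
   symmetric on the ball because 1 - |x|^2 vanishes on the sphere; hence the
   transform F(x) of w = P(|y|^2) H by the kernel solves the same equation as w.
   By the Funk-Hecke formula F is again radial times H, so its radial part solves
   the same second order equation as P.  Both are smooth at the singular point
   |x| = 1, so their Wronskian vanishes and F = mu w with mu depending only on P.
   With mu and nu the factors for the cosine and the sine, rescaling B(c) to B(1)
   gives Q P_c psi = c^m (mu^2 + nu^2) psi.  If mu = nu = 0, repeated
   differentiation of the kernels shows that w is orthogonal to all polynomials on
   the ball, hence w = 0. *)

Require Import Defs.
From mathcomp Require Import all_boot all_order all_algebra complex ring lra.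
From mathcomp Require Import all_classical all_reals all_analysis.
From mathcomp Require Import measurable_realfun.

Set Implicit Arguments.
Unset Strict Implicit.
Unset Printing Implicit Defensive.

Import Order.TTheory GRing.Theory Num.Theory.
Import numFieldNormedType.Exports.
Local Open Scope ring_scope.
Local Open Scope classical_set_scope.
Local Open Scope complex_scope.

(** * Affine changes of variables *)

Section AffineSubstitution.
Variable R : realType.

(** The eigenvalue must be common to all components of [psi]. So the transforms of different
    harmonics of one degree are compared: Funk-Hecke gives them a single radial profile, read off
    one component along one ray. That profile is built with square roots and is controlled only for
    t > 0; hence the radial equation is studied away from t = 0, and the centre of the ball is
    recovered by continuity. The argument contains no integral over spheres. The weight 1 - |x|^2
    removes every boundary term, so the divergence theorem needs only translation invariance of
    Lebesgue measure. Funk-Hecke is then obtained for polynomial kernels by a recursion that raises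
    the power of the weight, and for smooth ones by Weierstrass approximation. The sign of the
    eigenvalue comes from conjugation: after rescaling, the Fourier transform multiplies w by mu - i
    nu and its inverse by mu + i nu. *)

Definition affine_fun (a b : R) : measurableTypeR R -> measurableTypeR R :=
  fun x => a * x + b.

Lemma measurable_affine_fun a b : measurable_fun setT (affine_fun a b).
Proof. by apply: measurable_funD => //; exact: measurable_funM. Qed.

(** Both sides are measures in [A], and Lebesgue measure is determined by its values on half-open
    intervals. *)
Lemma lebesgue_measure_affine (a b : R) (a0 : 0 < a) (A : set R) :
  measurable A ->
  lebesgue_measure A = (a%:E * lebesgue_measure (affine_fun a b @^-1` A))%E.
Proof.
move=> mA; pose mu : {measure set (measurableTypeR R) -> \bar R} :=
  mscale (NngNum (ltW a0)) (pushforward lebesgue_measure (affine_fun a b)).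
rewrite [RHS](_ : _ = mu (measurable_affine_fun a b) A)//.
apply: lebesgue_measure_unique => // _ [[u v]] _ <-.
rewrite /mu /= /mscale/= /pushforward.
have -> : affine_fun a b @^-1` `]u, v]%classic
    = `](u - b) / a, (v - b) / a]%classic.
  apply/seteqP; split => x /=; rewrite !in_itv/= ltr_pdivrMr// ler_pdivlMr//;
    rewrite ltrBlDr lerBrDr mulrC//.
rewrite !lebesgue_measure_itv/= !lte_fin ltr_pM2r ?invr_gt0// ltrD2r.
case: ifP => _; last by rewrite mule0.
by rewrite -!EFinD -EFinM; congr _%:E; field; rewrite gt_eqF.
Qed.

Lemma ge0_integral_affine (a b : R) (f : R -> \bar R) : 0 < a ->
  measurable_fun setT f -> (forall x, 0 <= f x)%E ->
  (\int[lebesgue_measure]_x f x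
   = a%:E * \int[lebesgue_measure]_x f (a * x + b)%R)%E.
Proof.
move=> a0 mf f0.
pose mu : {measure set (measurableTypeR R) -> \bar R} :=
  mscale (NngNum (ltW a0)) (pushforward lebesgue_measure (affine_fun a b)).
rewrite (@eq_measure_integral _ _ _ _ (mu (measurable_affine_fun a b)))/=; last first.
  by move=> A mA _; exact: lebesgue_measure_affine.
by rewrite ge0_integral_mscale//= (ge0_integral_pushforward (measurable_affine_fun a b))//.
Qed.

Definition affine_tuple n (a : R) (b : n.-tuple R) (t : n.-tuple R) : n.-tuple R :=
  [tuple a * tnth t i + tnth b i | i < n].

Lemma measurable_affine_tuple n (a : R) (b : n.-tuple R) :
  measurable_fun setT (affine_tuple a b).
Proof.
apply/measurable_fun_tnthP => i.
rewrite (_ : _ \o _ = fun t => a * tnth t i + tnth b i); last first.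
  by apply/funext => t /=; rewrite tnth_mktuple.
apply: measurable_funD => //; apply: measurable_funM => //.
exact: measurable_tnth.
Qed.

Lemma ge0_integral_lebesgue_cons n (f : n.+1.-tuple R -> \bar R) :
  measurable_fun setT f -> (forall t, 0 <= f t)%E ->
  (\int[lebesgue_tuple R n.+1]_t f t =
   \int[lebesgue_measure]_x \int[lebesgue_tuple R n]_t f (tcons (x, t)))%E.
Proof.
move=> mf f0.
rewrite [LHS](_ : _ = \int[pushforward (lebesgue_measure \x lebesgue_tuple R n)
  (@tcons R n)]_t f t)%E//.
rewrite ge0_integral_pushforward//; last exact: measurable_tcons.
rewrite preimage_setT fubini_tonelli1//.
  by apply: measurableT_comp => //; exact: measurable_tcons.
by move=> x; exact: f0.
Qed.

(** Tonelli peels off one coordinate at a time. Allowing both [a] and [b] covers the two later uses: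
    translations ([a] = 1) for the divergence theorem, dilations ([b] = 0) for the passage from B(c)
    to B(1). *)
Lemma ge0_integral_affine_tuple n (a : R) (b : n.-tuple R)
    (f : n.-tuple R -> \bar R) : 0 < a ->
  measurable_fun setT f -> (forall t, 0 <= f t)%E ->
  (\int[lebesgue_tuple R n]_t f t
   = (a ^+ n)%:E * \int[lebesgue_tuple R n]_t f (affine_tuple a b t))%E.
Proof.
move=> a0; elim: n b f => [|n IH] b f mf f0.
  rewrite expr0 mul1e; apply: eq_integral => t _; congr f.
  by rewrite [LHS]tuple0 [RHS]tuple0.
have mtc x : measurable_fun setT (fun t => f (tcons (x, t))).
  apply: measurableT_comp => //.
  exact: (measurable_cons (f := cst x) (g := id)).
have mint (g : n.+1.-tuple R -> \bar R) : measurable_fun setT g ->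
    (forall t, 0 <= g t)%E ->
    measurable_fun setT (fun x => \int[lebesgue_tuple R n]_t g (tcons (x, t)))%E.
  move=> mg g0.
  apply: (@measurable_fun_fubini_tonelli_F _ _ _ _ _ _ (g \o @tcons R n)) => //.
    by apply: measurableT_comp => //; exact: measurable_tcons.
  by move=> x; exact: g0.
pose b' := [tuple of behead b].
have E x t : affine_tuple a b (tcons (x, t)) =
    tcons (a * x + thead b, affine_tuple a b' t).
  apply: eq_from_tnth => i; rewrite tnth_mktuple.
  case: (unliftP ord0 i) => [j|] ->; last by [].
  rewrite !tnthS tnth_mktuple; congr (_ + _).
  by rewrite [RHS]tnth_behead (_ : lift ord0 j = inord j.+1)//; apply/val_inj;
    rewrite /= inordK// ltnS.
rewrite ge0_integral_lebesgue_cons//.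
rewrite (ge0_integral_affine (thead b) a0 (mint _ mf f0)); last first.
  by move=> x; exact: integral_ge0.
  rewrite ge0_integral_lebesgue_cons//; last first.
    by apply: measurableT_comp => //; exact: measurable_affine_tuple.
  under [X in (_ * X)%E = _]eq_integral => x _ do
    rewrite (IH b' (fun t => f (tcons (a * x + thead b, t))))//.
  rewrite ge0_integralZl//; first last.
  - by rewrite lee_fin exprn_ge0// ltW.
  - by move=> x _; exact: integral_ge0.
  - under eq_fun => x do under eq_integral => t _ do rewrite -E.
    apply: (mint (f \o affine_tuple a b)) => //.
      by apply: measurableT_comp => //; exact: measurable_affine_tuple.
    by move=> t; exact: f0.
  rewrite muleA -EFinM -exprS; congr (_ * _)%E.
  by apply: eq_integral => x _; apply: eq_integral => t _; rewrite E.
Qed.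

(** A positive finite factor fixes both infinities, so distributivity holds even for oo - oo. This
    frees the substitution formula from any integrability assumption. *)
Lemma gt0_muleBr (c : R) (x y : \bar R) : 0 < c ->
  (c%:E * (x - y) = c%:E * x - c%:E * y)%E.
Proof.
rewrite -lte_fin => c0.
case: x => [x| |]; case: y => [y| |]; try by rewrite muleBr.
all: by rewrite /= ?(gt0_muley c0) ?(gt0_muleNy c0)/= ?(gt0_muley c0) ?(gt0_muleNy c0).
Qed.

Lemma integral_affine_tuple n (a : R) (b : n.-tuple R)
    (f : n.-tuple R -> \bar R) : 0 < a -> measurable_fun setT f ->
  (\int[lebesgue_tuple R n]_t f t
   = (a ^+ n)%:E * \int[lebesgue_tuple R n]_t f (affine_tuple a b t))%E.
Proof.
move=> a0 mf; rewrite [in LHS]integralE [in RHS]integralE.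
rewrite (ge0_integral_affine_tuple b a0 (measurable_funepos mf))//.
rewrite (ge0_integral_affine_tuple b a0 (measurable_funeneg mf))//.
rewrite -gt0_muleBr; last exact: exprn_gt0.
by congr (_ * (_ - _))%E; apply: eq_integral => t _; rewrite ?funeposE ?funenegE.
Qed.

End AffineSubstitution.

(** * Smooth functions *)

Section DirectionalDerivatives.
Variables (R : realType) (V : normedModType R).
Implicit Types (f : V -> R) (h : R -> R).

(** The bridge to one-variable calculus: the chain rule, the mean value theorem and differentiation
    under the integral are all applied along lines. *)
Lemma is_derive_line f (x v : V) (r d : R) :
  is_derive (r *: v + x) v f d <-> is_derive r (1 : R) (fun s => f (s *: v + x)) d.
Proof.
have E : (fun h : R => h^-1 *: ((f \o shift (r *: v + x)) (h *: v) - f (r *: v + x)))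
  = (fun h : R => h^-1 *: (((fun s => f (s *: v + x)) \o shift r) (h *: (1 : R))
      - f (r *: v + x))).
  by apply/funext => h /=; rewrite [h%:A]mulr1 scalerDl addrA.
split=> -[H K]; apply: DeriveDef.
- by move: H; rewrite /derivable E.
- by move: K; rewrite /derive E.
- by move: H; rewrite /derivable -E.
- by move: K; rewrite /derive -E.
Qed.

Lemma is_derive_comp1 h f (x v : V) (dh df : R) :
  is_derive (f x) (1 : R) h dh -> is_derive x v f df ->
  is_derive x v (fun y => h (f y)) (dh * df).
Proof.
move=> Hh Hf; rewrite -[x]add0r -(scale0r v).
apply/(is_derive_line (fun y => h (f y)))/is_derive1_comp.
  by rewrite scale0r add0r.
by apply/is_derive_line; rewrite scale0r add0r.
Qed.

End DirectionalDerivatives.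

Section Smooth.
Variable R : realType.
Implicit Types h : R -> R.

(** [S] serves as an invariant: a class closed under differentiation contains all iterated
    derivatives of its members. *)
Lemma smooth_family (S : set (R -> R)) :
  (forall h, S h -> exists2 g, S g & forall t, is_derive t (1 : R) h (g t)) ->
  forall h, S h -> smooth h.
Proof.
move=> HS h Sh n.
have {Sh} : S h^`(n).
  elim: n => [|n IH]; first by rewrite derive1n0.
  have [g Sg gP] := HS _ IH; rewrite derive1nS (_ : _^`() = g)//.
  by apply/funext => t; rewrite derive1E; exact: derive_val.
by move=> /HS[g _ gP] t; have [] := gP t.
Qed.

Lemma smooth_derive h : smooth h -> smooth h^`().
Proof. by move=> sh n t; rewrite -derive1Sn; exact: sh. Qed.

Lemma smooth_is_derive h t : smooth h -> is_derive t (1 : R) h (h^`() t).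
Proof.
move=> sh; rewrite derive1E; apply: derivableP.
by have := sh 0%N t; rewrite derive1n0.
Qed.

Lemma smooth_continuous h : smooth h -> continuous h.
Proof.
move=> sh t; apply/differentiable_continuous/derivable1_diffP.
by have [] := smooth_is_derive t sh.
Qed.

Lemma smooth_horner (p : {poly R}) : smooth (horner p).
Proof.
apply: (@smooth_family [set h | exists p : {poly R}, h = horner p]); last by exists p.
by move=> _ [q ->]; exists (horner (deriv q)); [exists (deriv q)|move=> t; exact: is_derive_poly].
Qed.

Lemma continuous_bounded_itv h (r : R) : continuous h ->
  exists K : R, forall t, `|t| <= r -> `|h t| <= K.
Proof.
move=> ch.
have : compact (h @` `[- r, r]).
  by apply: continuous_compact; [exact: continuous_subspaceT|exact: segment_compact].
move=> /compact_bounded[K [_ HK]]; exists (`|K| + 1) => t tr.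
apply: HK; first by rewrite (le_lt_trans (ler_norm K))// ltrDl.
by exists t => //=; rewrite in_itv/= -ler_norml.
Qed.

End Smooth.

(** * An algebra of smooth functions of several variables *)

Section SmoothFun.
Variables (R : realType) (m : nat).
Implicit Types (f g : 'rV[R]_m -> R) (x y v : 'rV[R]_m).

(* An inductive class instead of C^oo: that derivatives stay in the class,
   second derivatives commute, and members are bounded on balls and measurable,
   is proved by induction. *)
Inductive smoothfun : ('rV[R]_m -> R) -> Prop :=
| smoothfun_cst a : smoothfun (fun _ => a)
| smoothfun_coord j : smoothfun (fun x => x 0 j)
| smoothfunD f g : smoothfun f -> smoothfun g -> smoothfun (fun x => f x + g x)
| smoothfunM f g : smoothfun f -> smoothfun g -> smoothfun (fun x => f x * g x)
| smoothfun_comp h f : smooth h -> smoothfun f -> smoothfun (fun x => h (f x)).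

Definition pderiv (j : 'I_m) f x : R := 'D_(delta_mx 0 j) f x.

Lemma pderivE j f x d : is_derive x (delta_mx 0 j) f d -> pderiv j f x = d.
Proof. by move=> fd; exact: derive_val. Qed.

(* Otherwise unification unfolds pderiv to a limit. *)
Opaque pderiv.

Lemma is_derive_coord x v j : is_derive x v (fun y : 'rV[R]_m => y 0 j) (v 0 j).
Proof.
rewrite -[x]add0r -(scale0r v); apply/(is_derive_line (fun y : 'rV[R]_m => y 0 j)).
under eq_fun do rewrite !mxE.
by apply: is_derive_eq; rewrite /GRing.scale/=; ring.
Qed.

Lemma smoothfun_diff f : smoothfun f ->
  (forall j, smoothfun (pderiv j f)) /\
  forall x v, is_derive x v f (\sum_j v 0 j * pderiv j f x).
Proof.
(* The induction runs with an arbitrary gradient [G], given by explicit formulas; only afterwards is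
   it identified with [pderiv]. *)
suff : smoothfun f -> exists2 G : 'I_m -> 'rV[R]_m -> R, forall j, smoothfun (G j) &
    forall x v, is_derive x v f (\sum_j v 0 j * G j x).
  move=> H /H[G sG GP].
  have GE j : pderiv j f = G j.
    apply/funext => x; apply: pderivE; have := GP x (delta_mx 0 j).
    rewrite (bigD1 j)//= mxE !eqxx mul1r big1 ?addr0// => i ij.
    by rewrite mxE (negbTE ij) andbF mul0r.
  by split=> [j|x v]; [rewrite GE|under eq_bigr do rewrite GE].
elim=> {f} [a|j|f g _ [G sG GP] _ [H sH HP]|f g sf [G sG GP] sg [H sH HP]|h f sh sf [G sG GP]].
- exists (fun _ _ => 0) => [j|x v]; first exact: smoothfun_cst.
  by rewrite big1 => [|j _]; [exact: is_derive_cst|rewrite mulr0].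
- exists (fun i _ => (i == j)%:R) => [i|x v]; first exact: smoothfun_cst.
  rewrite (bigD1 j)//= eqxx mulr1 big1 ?addr0 => [|i ij]; first exact: is_derive_coord.
  by rewrite (negbTE ij) mulr0.
- exists (fun j x => G j x + H j x) => [j|x v]; first exact: smoothfunD.
  by under eq_bigr do rewrite mulrDr; rewrite big_split; exact: is_deriveD.
- exists (fun j x => f x * H j x + g x * G j x) => [j|x v].
    by apply: smoothfunD; exact: smoothfunM.
  have := is_deriveM (GP x v) (HP x v); move/is_derive_eq; apply.
  rewrite /GRing.scale/= !mulr_sumr -big_split/=; apply: eq_bigr => j _; ring.
- exists (fun j x => derive1 h (f x) * G j x) => [j|x v].
    exact: (smoothfunM (smoothfun_comp (smooth_derive sh) sf) (sG j)).
  have := is_derive_comp1 (smooth_is_derive (f x) sh) (GP x v); move/is_derive_eq; apply.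
  by rewrite mulr_sumr; apply: eq_bigr => j _; rewrite mulrCA.
Qed.

Lemma smoothfun_pderiv j f : smoothfun f -> smoothfun (pderiv j f).
Proof. by move=> /smoothfun_diff[]. Qed.

Lemma smoothfun_is_derive f x v : smoothfun f ->
  is_derive x v f (\sum_j v 0 j * pderiv j f x).
Proof. by move=> /smoothfun_diff[_]. Qed.

Lemma smoothfun_is_pderiv j f x : smoothfun f ->
  is_derive x (delta_mx 0 j) f (pderiv j f x).
Proof.
by move=> sf; have [df _] := smoothfun_is_derive x (delta_mx 0 j) sf; exact: derivableP.
Qed.

Lemma pderiv_cst j a : pderiv j (fun _ => a) = fun _ => 0.
Proof. by apply/funext => x; apply: pderivE; exact: is_derive_cst. Qed.

Lemma pderiv_coord j i : pderiv j (fun x => x 0 i) = fun _ => (i == j)%:R.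
Proof.
apply/funext => x; apply: pderivE; have := is_derive_coord x (delta_mx 0 j) i.
by move/is_derive_eq; apply; rewrite mxE eqxx.
Qed.

Lemma pderivD j f g : smoothfun f -> smoothfun g ->
  pderiv j (fun x => f x + g x) = fun x => pderiv j f x + pderiv j g x.
Proof.
move=> sf sg; apply/funext => x.
by apply: pderivE; apply: is_deriveD; exact: smoothfun_is_pderiv.
Qed.

Lemma pderivM j f g : smoothfun f -> smoothfun g ->
  pderiv j (fun x => f x * g x) = fun x => pderiv j f x * g x + f x * pderiv j g x.
Proof.
move=> sf sg; apply/funext => x; apply: pderivE.
have := is_deriveM (smoothfun_is_pderiv j x sf) (smoothfun_is_pderiv j x sg).
by move/is_derive_eq; apply; rewrite /GRing.scale/=; ring.
Qed.

Lemma pderiv_comp j h f : smooth h -> smoothfun f ->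
  pderiv j (fun x => h (f x)) = fun x => derive1 h (f x) * pderiv j f x.
Proof.
move=> sh sf; apply/funext => x; apply: pderivE; apply: is_derive_comp1.
  exact: smooth_is_derive.
exact: smoothfun_is_pderiv.
Qed.

Lemma pderivC i j f : smoothfun f -> pderiv i (pderiv j f) = pderiv j (pderiv i f).
Proof.
elim=> {f} [a|l|f g sf IHf sg IHg|f g sf IHf sg IHg|h f sh sf IH].
- by rewrite !pderiv_cst.
- by rewrite !pderiv_coord !pderiv_cst.
- have pf l := smoothfun_pderiv l sf; have pg l := smoothfun_pderiv l sg.
  rewrite (pderivD i sf sg) (pderivD j sf sg) (pderivD i (pf j) (pg j)).
  by rewrite (pderivD j (pf i) (pg i)) IHf IHg.
- have pf l := smoothfun_pderiv l sf; have pg l := smoothfun_pderiv l sg.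
  have E l n : pderiv l (pderiv n (fun x => f x * g x)) = fun x =>
      pderiv l (pderiv n f) x * g x + pderiv n f x * pderiv l g x
      + (pderiv l f x * pderiv n g x + f x * pderiv l (pderiv n g) x).
    rewrite (pderivM n sf sg) (pderivD l (smoothfunM (pf n) sg) (smoothfunM sf (pg n))).
    by rewrite (pderivM l (pf n) sg) (pderivM l sf (pg n)).
  rewrite !E IHf IHg; apply/funext => x.
  move: (pderiv j _ x) (pderiv i f x) (pderiv i g x) (pderiv j f x) (pderiv j g x).
  by move: (f x) (g x) => *; ring.
- have pf l := smoothfun_pderiv l sf; have sh' := smooth_derive sh.
  have E l n : pderiv l (pderiv n (fun x => h (f x))) = fun x =>
      derive1 (derive1 h) (f x) * pderiv l f x * pderiv n f x
      + derive1 h (f x) * pderiv l (pderiv n f) x.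
    rewrite (pderiv_comp n sh sf) (pderivM l (smoothfun_comp sh' sf) (pf n)).
    by rewrite (pderiv_comp l sh' sf).
  rewrite !E IH; apply/funext => x.
  by move: (derive1 _ _) (pderiv i f x) (pderiv j f x) (derive1 h _ * _) => *; ring.
Qed.

Lemma smoothfun_opp f : smoothfun f -> smoothfun (fun x => - f x).
Proof.
move=> sf; rewrite (_ : (fun x => _) = fun x => (fun _ => -1) x * f x); last first.
  by apply/funext => x; rewrite mulN1r.
exact/smoothfunM/sf/smoothfun_cst.
Qed.

Lemma smoothfun_sum (I : Type) (r : seq I) (P : pred I) (F : I -> 'rV[R]_m -> R) :
  (forall i, smoothfun (F i)) -> smoothfun (fun x => \sum_(i <- r | P i) F i x).
Proof.
move=> sF; elim: r => [|i r IH].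
  by under eq_fun do rewrite big_nil; exact: smoothfun_cst.
under eq_fun do rewrite big_cons.
by case: (P i) => //; exact: smoothfunD.
Qed.

Lemma smoothfun_prod (I : Type) (r : seq I) (P : pred I) (F : I -> 'rV[R]_m -> R) :
  (forall i, smoothfun (F i)) -> smoothfun (fun x => \prod_(i <- r | P i) F i x).
Proof.
move=> sF; elim: r => [|i r IH].
  by under eq_fun do rewrite big_nil; exact: smoothfun_cst.
under eq_fun do rewrite big_cons.
by case: (P i) => //; exact: smoothfunM.
Qed.

Lemma smoothfunX n f : smoothfun f -> smoothfun (fun x => f x ^+ n).
Proof.
move=> sf; elim: n => [|n IH]; first exact: smoothfun_cst.
by under eq_fun do rewrite exprS; exact: smoothfunM.
Qed.

Lemma smoothfun_dot x : smoothfun (dot x).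
Proof.
by apply: smoothfun_sum => i; apply: smoothfunM;
  [exact: smoothfun_cst|exact: smoothfun_coord].
Qed.

Lemma dotC x y : dot x y = dot y x.
Proof. by apply: eq_bigr => j _; rewrite mulrC. Qed.

Lemma dotZ a x y : dot (a *: x) y = a * dot x y.
Proof. by rewrite /dot mulr_sumr; apply: eq_bigr => j _; rewrite mxE mulrA. Qed.

Lemma dot_delta j y : dot (delta_mx 0 j) y = y 0 j.
Proof.
rewrite /dot (bigD1 j)//= mxE !eqxx mul1r big1 ?addr0// => i ij.
by rewrite mxE (negbTE ij) andbF mul0r.
Qed.

Lemma dot_ge0 x : 0 <= dot x x.
Proof. by apply: sumr_ge0 => i _; rewrite -expr2 sqr_ge0. Qed.

Lemma enorm_sqr x : enorm x ^+ 2 = dot x x.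
Proof. by rewrite sqr_sqrtr// dot_ge0. Qed.

Lemma enorm_ge0 x : 0 <= enorm x.
Proof. exact: sqrtr_ge0. Qed.

Lemma smoothfun_enorm_sqr : smoothfun (fun x => enorm x ^+ 2).
Proof.
under eq_fun do rewrite enorm_sqr.
by apply: smoothfun_sum => i; apply: smoothfunM; exact: smoothfun_coord.
Qed.

Lemma normr_coord_le x j : `|x 0 j| <= enorm x.
Proof.
rewrite -sqrtr_sqr ler_wsqrtr// expr2 /dot (bigD1 j)//= lerDl.
by apply: sumr_ge0 => i _; rewrite -expr2 sqr_ge0.
Qed.

Lemma smoothfun_bounded f r : smoothfun f ->
  exists K : R, forall x, cball r x -> `|f x| <= K.
Proof.
elim=> {f} [a|j|f g _ [K KP] _ [L LP]|f g _ [K KP] _ [L LP]|h f sh _ [K KP]].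
- by exists `|a|.
- by exists r => x; exact/le_trans/normr_coord_le.
- exists (K + L) => x xr.
  by rewrite (le_trans (ler_normD _ _))// lerD// ?KP ?LP.
- by exists (K * L) => x xr; rewrite normrM ler_pM// ?KP ?LP.
- have [L LP] := continuous_bounded_itv K (smooth_continuous sh).
  by exists L => x xr; exact/LP/KP.
Qed.

Lemma smoothfun_measurable f : smoothfun f ->
  measurable_fun setT (fun t : m.-tuple R => f (rowt t)).
Proof.
elim=> {f} [a|j|f g _ IHf _ IHg|f g _ IHf _ IHg|h f sh _ IH].
- exact: measurable_cst.
- by under eq_fun do rewrite mxE; exact: measurable_tnth.
- exact: measurable_funD.
- exact: measurable_funM.
- apply: (measurableT_comp (f := h)); last by [].
  by apply: continuous_measurable_fun; exact: smooth_continuous.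
Qed.

Lemma smoothfun_line f x v r : smoothfun f ->
  is_derive r (1 : R) (fun s => f (s *: v + x)) (\sum_j v 0 j * pderiv j f (r *: v + x)).
Proof. by move=> sf; apply/(is_derive_line f); exact: smoothfun_is_derive. Qed.

End SmoothFun.

(** * Integration over balls *)

Section FiniteBall.
Variables (R : realType).

Definition tbox n (r : R) : set (n.-tuple R) := [set t | forall i, `|tnth t i| <= r].
Arguments tbox : clear implicits.

Lemma measurable_tbox n r : measurable (tbox n r).
Proof.
rewrite (_ : tbox n r = \bigcap_(i in [set: 'I_n]) [set t | `|tnth t i| <= r]).
  apply: fin_bigcap_measurable => // i _.
  have mt : measurable_fun setT (fun t : n.-tuple R => `|tnth t i|).
    by apply: measurableT_comp => //; exact: measurable_tnth.
  have := mt measurableT `]-oo, r]%classic (measurable_itv _).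
  by rewrite setTI.
by apply/seteqP; split => [t H i _|t H i]; exact: H.
Qed.

Lemma lebesgue_tbox n (r : R) : 0 <= r -> (lebesgue_tuple R n (tbox n r) < +oo)%E.
Proof.
move=> r0; elim: n => [|n IH].
  by rewrite /= diracE; case: (_ \in _); rewrite ltry.
have L : (lebesgue_measure `[(- r)%R, r%R]%classic < +oo)%E.
  by rewrite lebesgue_measure_itv/=; case: ifP => _; rewrite -?EFinB ltry.
have E : @tcons R n @^-1` tbox n.+1 r = `[(- r)%R, r%R]%classic `*` tbox n r.
  apply/seteqP; split => -[x t] /=.
    move=> H; rewrite in_itv/= -ler_norml; split; first exact: (H ord0).
    by move=> i; have := H (lift ord0 i); rewrite tnthS.
  rewrite in_itv/= -ler_norml => -[xr tr] i.
  by case: (unliftP ord0 i) => [j|] -> //; rewrite tnthS.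
rewrite [X in (X < _)%E](_ : _ = (lebesgue_measure \x lebesgue_tuple R n)
  (@tcons R n @^-1` tbox n.+1 r))%E//.
rewrite E product_measure1E//; last exact: measurable_tbox.
by rewrite lte_mul_pinfty// ge0_fin_numE.
Qed.

End FiniteBall.

Section BallIntegral.
Variables (R : realType) (m : nat).
Implicit Types (f g w : 'rV[R]_m -> R) (x y v : 'rV[R]_m).
Implicit Types (a r s : R).

Local Notation mu := (lebesgue_tuple R m).
Local Notation tball r := (@rowt R m @^-1` cball r).

Lemma smoothfun_levelset_measurable f a :
  smoothfun f -> measurable [set t : m.-tuple R | f (rowt t) <= a].
Proof.
move=> sf; have := smoothfun_measurable sf.
move=> /(_ measurableT `]-oo, a]%classic (measurable_itv _)).
by rewrite setTI.
Qed.

Lemma cball_sqr r x : 0 <= r -> cball r x <-> dot x x <= r ^+ 2.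
Proof.
by move=> r0; rewrite -enorm_sqr /cball/= ler_sqr// nnegrE ?enorm_ge0.
Qed.

Lemma measurable_tball r : 0 <= r -> measurable (tball r).
Proof.
move=> r0; rewrite (_ : tball r = [set t | dot (rowt t) (rowt t) <= r ^+ 2]).
  apply: (smoothfun_levelset_measurable (f := fun x => dot x x)).
  by under eq_fun do rewrite -enorm_sqr; exact: smoothfun_enorm_sqr.
by apply/seteqP; split => t /=; rewrite cball_sqr.
Qed.

Lemma lebesgue_tball r : 0 <= r -> (mu (tball r) < +oo)%E.
Proof.
move=> r0; apply: le_lt_trans (lebesgue_tbox m r0).
apply: le_measure; rewrite ?inE; [exact: measurable_tball|exact: measurable_tbox|].
move=> t tr i; rewrite (le_trans _ tr)//.
by rewrite (_ : tnth t i = rowt t 0 i) ?normr_coord_le// mxE.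
Qed.

Lemma smoothfun_integrable w r : 0 <= r -> smoothfun w ->
  mu.-integrable (tball r) (fun t => (w (rowt t))%:E).
Proof.
move=> r0 sw; apply: (@measurable_bounded_integrable _ _ _ mu (fun t => w (rowt t))).
- exact: measurable_tball.
- exact: lebesgue_tball.
- exact: measurable_funTS (smoothfun_measurable sw).
- have [K KP] := smoothfun_bounded r sw; exists K; split; first exact: num_real.
  by move=> L KL t tr /=; rewrite (le_trans (KP _ tr))// ltW.
Qed.

Definition ball_int w : R := vint (cball 1) w.

Lemma eq_ball_int f g : (forall y, cball 1 y -> f y = g y) -> ball_int f = ball_int g.
Proof. by move=> fg; apply: eq_Rintegral => t /set_mem; exact: fg. Qed.

Lemma ball_intD f g : smoothfun f -> smoothfun g ->
  ball_int (fun y => f y + g y) = ball_int f + ball_int g.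
Proof.
move=> sf sg; apply: RintegralD; first exact: measurable_tball.
- exact: smoothfun_integrable.
- exact: smoothfun_integrable.
Qed.

Lemma ball_intZ a f : smoothfun f -> ball_int (fun y => a * f y) = a * ball_int f.
Proof.
move=> sf; apply: RintegralZl; first exact: measurable_tball.
exact: smoothfun_integrable.
Qed.

Lemma ball_int0 : ball_int (fun _ => 0) = 0.
Proof.
by rewrite /ball_int /vint Rintegral_cst ?mul0r//; exact: measurable_tball.
Qed.

Lemma ball_int_sum (I : Type) (r : seq I) (P : pred I) (F : I -> 'rV[R]_m -> R) :
  (forall i, smoothfun (F i)) ->
  ball_int (fun y => \sum_(i <- r | P i) F i y) = \sum_(i <- r | P i) ball_int (F i).
Proof.
move=> sF; elim: r => [|i r IH].
  by rewrite big_nil; under eq_fun do rewrite big_nil; exact: ball_int0.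
rewrite big_cons; under eq_fun do rewrite big_cons.
by case: (P i) => //; rewrite ball_intD ?IH//; exact: smoothfun_sum.
Qed.

Definition ball_vol : R := fine (mu (tball 1)).

Lemma ball_int_le f K : smoothfun f -> (forall y, cball 1 y -> `|f y| <= K) ->
  `|ball_int f| <= K * ball_vol.
Proof.
move=> sf fK; rewrite -Rintegral_cst; last exact: measurable_tball.
have If := smoothfun_integrable (ler01) sf.
apply: le_trans (le_normr_Rintegral _ If) _; first exact: measurable_tball.
apply: le_Rintegral => //; first exact: measurable_tball.
- exact: integrable_norm If.
- exact: smoothfun_integrable (smoothfun_cst _ _).
- by move=> t; exact: fK.
Qed.

Lemma integral_affine_row (a : R) v (f : 'rV[R]_m -> \bar R) : 0 < a ->
  measurable_fun setT (fun t : m.-tuple R => f (rowt t)) ->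
  (\int[mu]_t f (rowt t) = (a ^+ m)%:E * \int[mu]_t f (a *: rowt t + v)%R)%E.
Proof.
move=> a0 mf; rewrite (integral_affine_tuple [tuple v 0 i | i < m] a0 mf).
congr (_ * _)%E; apply: eq_integral => t _; congr f.
by apply/rowP => j; rewrite !mxE !tnth_mktuple.
Qed.

Lemma enormZ a x : 0 <= a -> enorm (a *: x) = a * enorm x.
Proof.
move=> a0; rewrite /enorm (_ : dot _ _ = a ^+ 2 * dot x x).
  by rewrite sqrtrM ?sqr_ge0// sqrtr_sqr ger0_norm.
by rewrite dotZ dotC dotZ mulrA.
Qed.

Lemma vint_scale a f : 0 < a ->
  measurable_fun setT (fun t : m.-tuple R => f (rowt t)) ->
  vint (cball a) f = a ^+ m * ball_int (fun y => f (a *: y)).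
Proof.
move=> a0 mf; have mb := @measurable_tball a (ltW a0).
rewrite /ball_int /vint [in LHS]Rintegral_mkcond [in RHS]Rintegral_mkcond.
pose h : 'rV[R]_m -> \bar R := fun x => if enorm x <= a then (f x)%:E else 0%E.
have E : (fun t : m.-tuple R => h (rowt t)) =
    (fun t => (((fun t => f (rowt t)) \_ (tball a)) t)%:E).
  apply/funext => t; rewrite /h /patch; case: ifPn => ta.
    by rewrite mem_set.
  by rewrite memNset//= => ta'; move: ta; rewrite ta'.
have mh : measurable_fun setT (fun t : m.-tuple R => h (rowt t)).
  rewrite E; apply/measurable_EFinP.
  exact: (measurable_restrictT _ mb).1 (measurable_funTS mf).
have := integral_affine_row 0 a0 mh; rewrite {1}E => EQ.
rewrite [LHS]/Rintegral {}EQ.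
have -> : (fun t : m.-tuple R => h (a *: rowt t + 0)) =
    (fun t => (((fun t => f (a *: rowt t)) \_ (tball 1)) t)%:E).
  apply/funext => t; rewrite /h /patch addr0 enormZ ?(ltW a0)//.
  have -> : (a * enorm (rowt t) <= a) = (enorm (rowt t) <= 1).
    by rewrite -{2}(mulr1 a) ler_pM2l.
  case: ifPn => ta; first by rewrite mem_set.
  by rewrite memNset//= => ta'; move: ta; rewrite ta'.
rewrite /Rintegral; set I := (\int[_]_t _)%E.
(* [fine] sends both infinities to 0, so the formula also holds for an infinite integral. *)
case: I => [r| |]//=; by rewrite ?gt0_muley ?gt0_muleNy ?lte_fin ?exprn_gt0//= ?mulr0.
Qed.

Lemma lebesgue_tball_scale r : 0 < r -> (mu (tball r) = (r ^+ m)%:E * mu (tball 1))%E.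
Proof.
move=> r0.
have h := vint_scale r0 (f := fun _ => 1) (measurable_cst _).
have mr := @measurable_tball r (ltW r0); have m1 := @measurable_tball 1 ler01.
move: h; rewrite /ball_int /vint !Rintegral_cst//.
rewrite !mul1r => h; have := congr1 (@EFin R) h; rewrite EFinM !fineK//.
  by rewrite ge0_fin_numE//; exact: lebesgue_tball.
by rewrite ge0_fin_numE//; exact/lebesgue_tball/ltW.
Qed.

Lemma measurable_tsphere : measurable [set t : m.-tuple R | enorm (rowt t) = 1].
Proof.
rewrite (_ : [set t | _] = tball 1 `&` [set t | - enorm (rowt t) ^+ 2 <= - 1]).
  apply: measurableI; first exact: measurable_tball.
  apply: (smoothfun_levelset_measurable (f := fun x => - enorm x ^+ 2)).
  exact/smoothfun_opp/smoothfun_enorm_sqr.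
apply/seteqP; split => t /=; rewrite /cball/=.
  by move=> ->; rewrite expr1n !lexx.
move=> [t1]; rewrite lerN2 => t2; apply/le_anti; rewrite t1/=.
by rewrite -(ler_sqr (x := 1)) ?nnegrE ?enorm_ge0// expr1n.
Qed.

(** For r < 1 the sphere and B(r) are disjoint subsets of B(1), so the sphere has measure at most (1
    - r^m) vol B(1); let r tend to 1. *)
Lemma lebesgue_sphere : mu [set t | enorm (rowt t) = 1] = 0%E.
Proof.
have V0 : (0 <= ball_vol) by rewrite fine_ge0.
have E r : 0 <= r -> mu (tball r) = (fine (mu (tball r)))%:E.
  by move=> r0; rewrite fineK// ge0_fin_numE//; exact: lebesgue_tball.
have mS := measurable_tsphere.
have H r : 0 < r -> r < 1 ->
    (mu [set t | enorm (rowt t) = 1%R] <= ((1 - r ^+ m) * ball_vol)%:E)%E.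
  move=> r0 r1.
  have mr := @measurable_tball r (ltW r0).
  have : (mu [set t | enorm (rowt t) = 1%R] + mu (tball r) <= mu (tball 1))%E.
    rewrite -measureU//.
      apply: le_measure; rewrite ?inE; [exact: measurableU|exact: measurable_tball|].
      move=> t [t1|t1]; rewrite /cball/=; first by rewrite t1.
      exact: le_trans (t1 : enorm (rowt t) <= r) (ltW r1).
    apply/seteqP; split => // t [] /= t1; rewrite /cball/= t1 => h.
    by move: r1; rewrite ltNge h.
  rewrite lebesgue_tball_scale// [mu (tball 1)]E// -/ball_vol -EFinM -leeBrDr// -EFinB.
  by rewrite mulrBl mul1r.
apply/eqP; rewrite eq_le measure_ge0 andbT.
apply/lee_addgt0Pr => e e0; rewrite add0e.
have c : (1 - r ^+ m) * ball_vol @[r --> (1:R)^'-] --> (1 - 1 ^+ m) * ball_vol.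
  apply: cvg_at_left_filter; apply: cvgMr_tmp; apply: cvgB; first exact: cvg_cst.
  exact: exprn_continuous.
rewrite expr1n subrr mul0r in c.
have : \forall r \near (1 : R)^'-, (1 - r ^+ m) * ball_vol < e.
  by apply: cvgr_lt c _ e0.
move=> He; near (1:R)^'- => r.
apply: le_trans (H r _ _) _; rewrite ?lee_fin.
- by near: r; exact: nbhs_left_gt.
- by near: r; exact: nbhs_left_lt.
- by apply: ltW; near: r.
Unshelve. all: end_near.
Qed.

End BallIntegral.

(** * Divergence theorem and differentiation under the integral *)

Section DivergenceAndDerivative.
Variables (R : realType) (m : nat).
Implicit Types (f g w : 'rV[R]_m -> R) (x y v : 'rV[R]_m).
Implicit Types (a r s : R).

Local Notation mu := (lebesgue_tuple R m).
Local Notation tball r := (@rowt R m @^-1` cball r).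

Lemma smoothfun_translate f x : smoothfun f -> smoothfun (fun y => f (x + y)).
Proof.
elim=> {f} [a|j|f g _ IHf _ IHg|f g _ IHf _ IHg|h f sh _ IH].
- exact: smoothfun_cst.
- under eq_fun do rewrite mxE.
  exact: (smoothfunD (smoothfun_cst _ _) (smoothfun_coord _ _)).
- exact: (smoothfunD IHf IHg).
- exact: (smoothfunM IHf IHg).
- exact: (smoothfun_comp sh IH).
Qed.

Lemma pderiv_enorm_sqr j y :
  pderiv j (fun y : 'rV[R]_m => enorm y ^+ 2) y = 2 * y 0 j.
Proof.
apply: pderivE; under eq_fun do rewrite enorm_sqr.
have H i : is_derive y (delta_mx 0 j) (fun y : 'rV[R]_m => y 0 i * y 0 i)
    ((i == j)%:R * (2 * y 0 j)).
  have := is_deriveM (is_derive_coord y (delta_mx 0 j) i)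
    (is_derive_coord y (delta_mx 0 j) i).
  move/is_derive_eq; apply; rewrite /GRing.scale/= mxE eqxx/=.
  by case: eqP => [->|_]/=; ring.
have := @is_derive_sum _ _ _ m _ _ _ _ H.
rewrite fct_sumE => /is_derive_eq; apply.
by rewrite (bigD1 j)//= eqxx mul1r big1 ?addr0// => i /negbTE ->; rewrite mul0r.
Qed.

Lemma dot_shift y j h :
  dot (h *: delta_mx 0 j + y) (h *: delta_mx 0 j + y) = dot y y + 2 * h * y 0 j + h ^+ 2.
Proof.
rewrite /dot (bigD1 j)//= [in RHS](bigD1 j)//= !mxE !eqxx/=.
rewrite (eq_bigr (fun i => y 0 i * y 0 i)).
  by ring.
by move=> i ij; rewrite !mxE (negbTE ij) andbF mulr0 !add0r.
Qed.

Lemma cball_shift y j h : 0 <= h -> h <= 1 -> cball 2 y ->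
  cball 3 (h *: delta_mx 0 j + y).
Proof.
move=> h0 h1 y2; apply/cball_sqr; first by [].
have := y2; move/cball_sqr; rewrite dot_shift => /(_ (ler0n _ _)) yy.
have := le_trans (normr_coord_le y j) y2; rewrite ler_norml => /andP[_ yj].
nra.
Qed.

Lemma smoothfun_lip w j : smoothfun w -> exists2 K : R, 0 <= K &
  forall y h, 0 < h -> h <= 1 -> cball 2 y ->
    `|w (h *: delta_mx 0 j + y) - w y| <= K * h.
Proof.
move=> sw; have [K KP] := smoothfun_bounded 3 (smoothfun_pderiv j sw).
exists `|K| => // y h h0 h1 y2.
have D s : is_derive s (1 : R) (fun s => w (s *: delta_mx 0 j + y))
    (pderiv j w (s *: delta_mx 0 j + y)).
  by apply/(is_derive_line w); exact: smoothfun_is_pderiv.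
have C : {within `[0, h], continuous (fun s => w (s *: delta_mx 0 j + y))}.
  apply: derivable_within_continuous => s _; by have [] := D s.
have [s /andP[s0 sh]] := MVT h0 (fun s _ => D s) C.
rewrite scale0r add0r subr0 => ->; rewrite normrM (gtr0_norm h0) ler_pM2r//.
apply: le_trans (ler_norm K); apply: KP; apply: cball_shift => //.
  by rewrite bnd_simp in s0; exact: ltW.
by rewrite bnd_simp in sh; rewrite (le_trans (ltW sh)).
Qed.

(* The truncation is Lipschitz, so its difference quotients are dominated; their
   integrals vanish by translation invariance. *)
Definition hump w y : R := Num.max (1 - enorm y ^+ 2) 0 * w y.

Lemma hump_in w y : enorm y <= 1 -> hump w y = (1 - enorm y ^+ 2) * w y.
Proof.
move=> y1; congr (_ * _); apply/max_idPl.
by rewrite subr_ge0 expr_le1// enorm_ge0.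
Qed.

Lemma hump_out w y : 1 <= enorm y -> hump w y = 0.
Proof.
move=> y1; rewrite /hump (max_idPr _) ?mul0r//.
by rewrite subr_le0 exprn_ege1.
Qed.

Lemma hump_measurable w x : smoothfun w ->
  measurable_fun setT (fun t : m.-tuple R => hump w (x + rowt t)).
Proof.
move=> sw; apply: measurable_funM; last first.
  exact: (smoothfun_measurable (smoothfun_translate x sw)).
apply: measurable_maxr => //; apply: measurable_funB => //.
exact: (smoothfun_measurable (smoothfun_translate x (@smoothfun_enorm_sqr R m))).
Qed.

Lemma hump_integrable w : smoothfun w ->
  mu.-integrable setT (fun t : m.-tuple R => (hump w (rowt t))%:E).
Proof.
move=> sw.
have := hump_measurable 0 sw; under eq_fun do rewrite add0r.
move=> mh.
have m1 := @measurable_tball R m 1 ler01.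
rewrite (_ : (fun t => _) = (fun t => (hump w (rowt t))%:E) \_ (tball 1)).
  apply: (integrable_mkcond _ m1).1.
  apply: (@measurable_bounded_integrable _ _ _ mu (fun t => hump w (rowt t))) => //.
  - exact: lebesgue_tball.
  - exact: measurable_funTS.
  - have [K KP] := smoothfun_bounded 1 sw; exists K; split; first exact: num_real.
    move=> L KL t tr /=; rewrite hump_in// normrM -[L]mul1r ler_pM//; last first.
      exact: le_trans (KP _ tr) (ltW KL).
    by rewrite ger0_norm ?subr_ge0 ?expr_le1// ?enorm_ge0// gerBl sqr_ge0.
apply/funext => t; rewrite /patch; case: ifPn => // /negP tb.
rewrite hump_out//; apply: contra_notT tb; rewrite -ltNge => /ltW tb.
by rewrite inE.
Qed.

(** Beyond radius 2 a shift by h <= 1 does not reach the open unit ball, so the difference vanishes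
    there; the indicator makes the bound integrable. *)
Lemma hump_lip w j : smoothfun w -> exists K : R, forall y h, 0 < h -> h <= 1 ->
  `|hump w (h *: delta_mx 0 j + y) - hump w y| <= (K * \1_(cball 2) y) * h.
Proof.
move=> sw; have [Kd Kd0 KdP] := smoothfun_lip j sw.
have [Kv KvP] := smoothfun_bounded 2 sw.
(* [Kd] is the Lipschitz constant of [w] along the axis; 5 bounds |2 y_j + h|, the slope of |y|^2
   along the axis, for |y| <= 2 and h <= 1. *)
exists (Kd + 5 * `|Kv|) => y h h0 h1.
rewrite indicE; have [y2|/negP y2] := boolP (y \in cball 2); last first.
  rewrite mulr0 mul0r.
  have {}y2 : 2 < enorm y.
    by rewrite ltNge; apply/negP => h2; apply: y2; rewrite inE.
  rewrite !hump_out ?subrr ?normr0//.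
    by rewrite (le_trans _ (ltW y2))// ler1n.
  rewrite -(ler_sqr (x := 1)) ?nnegrE ?enorm_ge0// expr1n enorm_sqr dot_shift -enorm_sqr.
  have := normr_coord_le y j; rewrite ler_norml => /andP[yj _]; nra.
move: y2; rewrite inE => y2; rewrite mulr1.
set y' := _ + y.
rewrite (_ : hump w y' - hump w y = Num.max (1 - enorm y' ^+ 2) 0 * (w y' - w y)
   + (Num.max (1 - enorm y' ^+ 2) 0 - Num.max (1 - enorm y ^+ 2) 0) * w y); last first.
  by rewrite /hump; ring.
rewrite [leRHS]mulrDl (le_trans (ler_normD _ _))// lerD//.
  rewrite normrM -[leRHS]mul1r ler_pM// ?KdP//.
  by rewrite ger0_norm ?le_max ?lexx ?orbT// ge_max ler01 gerBl sqr_ge0.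
have -> : 5 * `|Kv| * h = (5 * h) * `|Kv| by ring.
rewrite normrM ler_pM//; last exact: le_trans (KvP _ y2) (ler_norm _).
have -> : enorm y' ^+ 2 = enorm y ^+ 2 + (2 * y 0 j + h) * h.
  by rewrite !enorm_sqr dot_shift; ring.
have : `|(2 * y 0 j + h) * h| <= 5 * h.
  rewrite normrM (gtr0_norm h0) ler_pM2r// ler_norml.
  have := le_trans (normr_coord_le y j) y2; rewrite ler_norml => /andP[? ?]; apply/andP; split; lra.
move: ((2 * y 0 j + h) * h) (enorm y ^+ 2) => a b.
rewrite !ler_norml => /andP[a1 a2].
by rewrite /Num.max; case: ltP => ?; case: ltP => ?; apply/andP; split; lra.
Qed.

Lemma harmonic_shift_cvg y j :
  enorm (n.+1%:R^-1 *: delta_mx 0 j + y) ^+ 2 @[n --> \oo] --> enorm y ^+ 2.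
Proof.
rewrite (_ : enorm y ^+ 2 = dot y y + 2 * 0 * y 0 j + 0 ^+ 2); last first.
  by rewrite enorm_sqr; ring.
under eq_fun do rewrite enorm_sqr dot_shift.
have h0 : n.+1%:R^-1 @[n --> \oo] --> (0 : R) by exact: cvg_harmonic.
apply: cvgD.
  apply: cvgD; first exact: cvg_cst.
  by apply: cvgMr_tmp; exact: cvgMl_tmp.
by under eq_fun do rewrite expr2; rewrite expr2; exact: cvgM.
Qed.

(** The truncation has a kink on the sphere. Away from it the shifted points eventually lie on the
    same side as [y], where the truncation is smooth or zero. *)
Lemma hump_cvg w j y : smoothfun w -> enorm y <> 1 ->
  n.+1%:R * (hump w (n.+1%:R^-1 *: delta_mx 0 j + y) - hump w y) @[n --> \oo] -->
  (if enorm y <= 1 then pderiv j (fun y => (1 - enorm y ^+ 2) * w y) y else 0).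
Proof.
move=> sw /eqP y1; have hc := @harmonic_shift_cvg y j.
pose U y := (1 - enorm y ^+ 2) * w y.
have sU : smoothfun U.
  apply: smoothfunM => //; apply: smoothfunD; first exact: smoothfun_cst.
  exact/smoothfun_opp/smoothfun_enorm_sqr.
have [ylt|ygt|ye] := ltgtP (enorm y) 1; last by rewrite ye eqxx in y1.
- have near_in : \forall n \near \oo, enorm (n.+1%:R^-1 *: delta_mx 0 j + y) ^+ 2 < 1.
    by apply: cvgr_lt hc _ _; rewrite expr_lt1// enorm_ge0.
  have [dU dUE] := smoothfun_is_pderiv j y sU.
  have {}dU : h^-1 * (U (h *: delta_mx 0 j + y) - U y) @[h --> 0^'] --> pderiv j U y.
    by rewrite -dUE; exact: dU.
  have hn : (forall n, (n.+1%:R^-1 : R) != 0) /\ n.+1%:R^-1 @[n --> \oo] --> (0 : R).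
    by split; [move=> n; rewrite invr_eq0|exact: cvg_harmonic].
  have {}dU := (cvgr_dnbhsP _ _ _).1 dU _ hn.
  apply: cvg_trans dU; apply: near_eq_cvg; near=> n; rewrite invrK.
  rewrite !hump_in// ?(ltW ylt)//.
  rewrite -(ler_sqr (y := 1)) ?nnegrE ?enorm_ge0// expr1n; apply: ltW.
  by near: n.
- have near_out : \forall n \near \oo, 1 < enorm (n.+1%:R^-1 *: delta_mx 0 j + y) ^+ 2.
    by apply: cvgr_gt hc _ _; rewrite exprn_egt1.
  apply: cvg_near_cst; near=> n.
  rewrite !hump_out ?subrr ?mulr0// ?(ltW ygt)//.
  rewrite -(ler_sqr (x := 1)) ?nnegrE ?enorm_ge0// expr1n; apply: ltW.
  by near: n.
Unshelve. all: end_near.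
Qed.

(** The divergence theorem for a field whose flux through the sphere vanishes: dominated convergence
    along the difference quotients of the truncation, the sphere being the null set where they may
    fail to converge. *)
Lemma ball_int_pderiv0 w j : smoothfun w ->
  ball_int (pderiv j (fun y => (1 - enorm y ^+ 2) * w y)) = 0.
Proof.
move=> sw; set DU := pderiv j _.
pose e : 'rV[R]_m := delta_mx 0 j.
pose q n y := n.+1%:R * (hump w (n.+1%:R^-1 *: e + y) - hump w y).
pose L y := if enorm y <= 1 then DU y else 0.
have mh x := hump_measurable x sw.
have mh0 : measurable_fun setT (fun t : m.-tuple R => hump w (rowt t)).
  by have := mh 0; under eq_fun do rewrite add0r.
have Ih := hump_integrable sw.
have Ihs h : mu.-integrable setT (fun t => (hump w (h *: e + rowt t))%:E).
  apply/integrableP; split; first exact/measurable_EFinP.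
  have /integrableP[_] := Ih.
  rewrite (@integral_affine_row _ _ 1 (h *: e) (fun x => `|(hump w x)%:E|%E))//; last first.
    exact/measurable_EFinP/measurableT_comp.
  rewrite expr1n mul1e; under eq_integral do rewrite scale1r addrC.
  by [].
have mq n : measurable_fun setT (fun t : m.-tuple R => (q n (rowt t))%:E).
  by apply/measurable_EFinP; apply: measurable_funM => //; exact: measurable_funB.
have q0 n : (\int[mu]_t (q n (rowt t))%:E = 0)%E.
  rewrite /q; under eq_integral do rewrite EFinM EFinB.
  rewrite integralZl//; last exact: integrableB.
  rewrite integralB//.
  rewrite (@integral_affine_row _ _ 1 (n.+1%:R^-1 *: e) (fun x => (hump w x)%:E))//; last first.
    exact/measurable_EFinP.
  rewrite expr1n mul1e; under [X in (_ - X)%E]eq_integral do rewrite scale1r addrC.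
  rewrite subee ?mule0//; exact: integrable_fin_num.
have sDU : smoothfun DU.
  apply: smoothfun_pderiv; apply: smoothfunM => //; apply: smoothfunD.
    exact: smoothfun_cst.
  exact/smoothfun_opp/smoothfun_enorm_sqr.
have m1 := @measurable_tball R m 1 ler01.
have EL : (fun t => (L (rowt t))%:E) = (fun t => (DU (rowt t))%:E) \_ (tball 1).
  apply/funext => t; rewrite /L /patch; case: ifPn => ta.
    by rewrite mem_set.
  by rewrite memNset//= => ta'; move: ta; rewrite ta'.
have mL : measurable_fun setT (fun t : m.-tuple R => (L (rowt t))%:E).
  rewrite EL; apply: (measurable_restrictT _ m1).1; apply: measurable_funTS.
  by apply/measurable_EFinP; exact: smoothfun_measurable.
have [K KP] := hump_lip j sw.
have m2 := @measurable_tball R m 2 (ler0n _ _).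
pose G := (fun t : m.-tuple R => `|K|%:E) \_ (tball 2).
have ig : mu.-integrable setT G.
  apply: (integrable_mkcond _ m2).1.
  exact: (smoothfun_integrable (ler0n _ _) (smoothfun_cst _ _)).
have dom t n : (`|(q n (rowt t))%:E| <= G t)%E.
  have n1 : (n.+1%:R^-1 : R) <= 1 by rewrite invf_le1// ler1n.
  have := KP (rowt t) n.+1%:R^-1 (ltac:(by rewrite invr_gt0)) n1.
  rewrite -(ler_pM2l (ltr0Sn R n)) mulrCA divff// mulr1.
  rewrite /G /q /patch abse_EFin normrM gtr0_norm//.
  rewrite indicE (_ : (rowt t \in cball 2) = (t \in tball 2))//.
  case: ifP => _; last by rewrite mulr0 lee_fin.
  by rewrite mulr1 lee_fin => /le_trans; apply; exact: ler_norm.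
have ae_cv : {ae mu, forall t, setT t ->
    (q n (rowt t))%:E @[n --> \oo] --> (L (rowt t))%:E}.
  exists [set t | enorm (rowt t) = 1]; split; [exact: measurable_tsphere|exact: lebesgue_sphere|].
  move=> t /=; apply: contra_notP => t1 _.
  by apply: cvg_EFin; [exact: nearW|exact: hump_cvg].
have [_ _] := dominated_convergence measurableT mq mL ae_cv ig (aeW _ (fun t n _ => dom t n)).
rewrite (_ : [sequence _]_n = fun=> 0%E); last by apply/funext => n; exact: q0.
move/(cvg_unique _)/(_ (cvg_cst _)).
rewrite EL -integral_mkcond => E0; rewrite /ball_int /vint /Rintegral.
by rewrite E0.
Qed.

Lemma is_derive_ball_int (h : R -> R) w x v : smooth h -> smoothfun w ->
  is_derive x v (fun x => ball_int (fun y => h (dot x y) * w y))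
    (ball_int (fun y => dot v y * (derive1 h (dot x y) * w y))).
Proof.
move=> sh sw; rewrite -[x in is_derive x]add0r -(scale0r v).
apply/(is_derive_line (fun x => ball_int (fun y => h (dot x y) * w y))).
have dotE s y : dot (s *: v + x) y = s * dot v y + dot x y.
  by rewrite /dot mulr_sumr -big_split; apply: eq_bigr => i _; rewrite !mxE/=; ring.
have sdot (z : 'rV[R]_m) : smoothfun (dot z) by exact: smoothfun_dot.
have m1 := @measurable_tball R m 1 ler01.
pose f s (t : m.-tuple R) := h (s * dot v (rowt t) + dot x (rowt t)) * w (rowt t).
have D s t : is_derive s (1 : R) (f ^~ t)
    (dot v (rowt t) * (derive1 h (s * dot v (rowt t) + dot x (rowt t)) * w (rowt t))).
  have := smooth_is_derive (s * dot v (rowt t) + dot x (rowt t)) sh.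
  move=> Dh; rewrite /f; apply: is_derive_eq.
  by rewrite /GRing.scale/=; ring.
have [Kx KxP] := smoothfun_bounded 1 (sdot x).
have [Kv KvP] := smoothfun_bounded 1 (sdot v).
have [Kw KwP] := smoothfun_bounded 1 sw.
(* For |s| < 1 and y in the ball, s <v, y> + <x, y> has modulus at most [Kv + Kx], so the derivative
   in s is dominated by a constant. *)
have [K KP] := continuous_bounded_itv (Kv + Kx) (smooth_continuous (smooth_derive sh)).
have K0 a (P : 'rV[R]_m -> R) : (forall y, cball 1 y -> `|P y| <= a) -> 0 <= a.
  move=> /(_ 0); rewrite /cball/= /enorm /dot big1 ?sqrtr0; last by move=> i _; rewrite mxE mul0r.
  by move=> /(_ ler01); exact: le_trans.
have Kv0 := K0 _ _ KvP; have Kx0 := K0 _ _ KxP; have Kw0 := K0 _ _ KwP.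
have K'0 : 0 <= K by apply: le_trans (KP 0 _) => //; rewrite normr0 addr_ge0.
pose G (t : m.-tuple R) := Kv * (K * Kw).
have intG : mu.-integrable (tball 1) (EFin \o G).
  exact: (smoothfun_integrable ler01 (smoothfun_cst _ _)).
have intf s : `]-1, 1[%classic s -> mu.-integrable (tball 1) (EFin \o f s).
  move=> _; apply: (smoothfun_integrable (w := fun y => h (s * dot v y + dot x y) * w y)) => //.
  apply: smoothfunM => //; apply: (smoothfun_comp sh); apply: smoothfunD => //.
  by apply: smoothfunM => //; exact: smoothfun_cst.
have ub s t : `]-1, 1[%classic s -> tball 1 t -> `|partial1of2 f s t| <= G t.
  rewrite /= in_itv/= => /andP[s1 s2] t1; rewrite partial1of2E.
  have -> := @derive_val _ _ _ _ _ _ _ (D s t).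
  rewrite normrM ler_pM ?KvP// normrM ler_pM ?KwP//; apply: KP.
  rewrite (le_trans (ler_normD _ _))// lerD ?KxP// normrM -[leRHS]mul1r.
  by rewrite ler_pM ?KvP// ler_norml; apply/andP; split; lra.
have I0 : `]-1, 1[%classic (0 : R) by rewrite /= in_itv/= ltrN10 ltr01.
have C := cvg_differentiation_under_integral m1 I0 intf
  (fun s t _ _ => @ex_derive _ _ _ _ _ _ _ (D s t))
  (fun _ => mulr_ge0 Kv0 (mulr_ge0 K'0 Kw0)) intG ub.
have E : (fun s => ball_int (fun y => h (dot (s *: v + x) y) * w y)) =
    (fun s => \int[mu]_(t in tball 1) f s t).
  by apply/funext => s; apply: eq_Rintegral => t _; rewrite dotE.
rewrite E.
have EL : ball_int (fun y => dot v y * (derive1 h (dot x y) * w y)) =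
    \int[mu]_(t in tball 1) partial1of2 f 0 t.
  apply: eq_Rintegral => t _; rewrite partial1of2E.
  by have -> := @derive_val _ _ _ _ _ _ _ (D 0 t); rewrite mul0r add0r.
rewrite EL.
have C' : r^-1 *: ((fun s => \int[mu]_(t in tball 1) f s t) (r *: 1 + 0) -
    \int[mu]_(t in tball 1) f 0 t) @[r --> 0^'] --> \int[mu]_(t in tball 1) partial1of2 f 0 t.
  by under eq_fun do rewrite [_%:A]mulr1.
apply: DeriveDef; first by apply/cvg_ex; eexists; exact: C'.
by apply/cvg_lim; [exact: Rhausdorff|exact: C'].
Qed.

End DivergenceAndDerivative.

(** * Weierstrass approximation *)

Section PolynomialApproximation.
Variable R : realType.
Implicit Types (f : R -> R) (g h : nat -> R) (x : R).

(* The Bernstein polynomial of the samples g 0, ..., g n, by de Casteljau's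
   recursion. *)
Fixpoint bernstein n g : {poly R} :=
  if n is n'.+1 then (1 - 'X) * bernstein n' g + 'X * bernstein n' (fun k => g k.+1)
  else (g 0)%:P.

Lemma bernsteinS n g x : (bernstein n.+1 g).[x]
  = (1 - x) * (bernstein n g).[x] + x * (bernstein n (fun k => g k.+1)).[x].
Proof. by rewrite /= !hornerE. Qed.

Lemma bernstein_le n g h x : 0 <= x -> x <= 1 ->
  (forall k, (k <= n)%N -> g k <= h k) -> (bernstein n g).[x] <= (bernstein n h).[x].
Proof.
move=> x0 x1; elim: n g h => [|n IH] g h gh; first by rewrite !hornerC gh.
rewrite !bernsteinS lerD// ler_wpM2l ?subr_ge0 ?IH// => k kn; apply: gh => //.
exact: leqW.
Qed.

(** The shift [a] makes the induction close, since the recursion replaces k by k + 1. With [a] = - n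
    x the value is the variance n x (1 - x) of the binomial law. *)
Lemma bernstein_quadratic n (a b c : R) x :
  (bernstein n (fun k => c + b * (k%:R + a) ^+ 2)).[x]
  = c + b * (n%:R * x * (1 - x) + (n%:R * x + a) ^+ 2).
Proof.
elim: n a => [|n IH] a; first by rewrite hornerC; ring.
rewrite bernsteinS IH.
rewrite (_ : (fun k : nat => _) = fun k : nat => c + b * (k%:R + (1 + a)) ^+ 2).
  by rewrite IH -(natr1 n); ring.
by apply/funext => k; rewrite -(natr1 k); ring.
Qed.

Lemma lipschitz_bernstein f (L e : R) : 0 <= L -> 0 < e ->
  (forall s t, 0 <= s <= 1 -> 0 <= t <= 1 -> `|f s - f t| <= L * `|s - t|) ->
  exists p : {poly R}, forall t, 0 <= t <= 1 -> `|f t - p.[t]| <= e.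
Proof.
move=> L0 e0 fL.
(* This [d] gives L d <= e / 2, and [n] is then chosen so that the variance term is at most e / 2.
   The summand 1 keeps the denominator positive when L = 0. *)
pose d := e / (2 * (L + 1)).
have d0 : 0 < d by apply: divr_gt0 => //; apply: mulr_gt0 => //; lra.
have Ld : L * d <= e / 2.
  rewrite /d mulrA ler_pdivrMr; last by lra.
  by nra.
have [n nP] : exists n : nat, L / (d * n.+1%:R) <= e / 2.
  have x0 : 0 <= 2 * L / (d * e) by apply: divr_ge0; apply: mulr_ge0 => //; exact: ltW.
  pose n := Num.bound (2 * L / (d * e)).
  have /ltW nP : 2 * L / (d * e) < n%:R by exact: archi_boundP.
  exists n; rewrite ler_pdivrMr; last by apply: mulr_gt0 => //; exact: ltr0n.
  move: nP; rewrite ler_pdivrMr; last exact: mulr_gt0.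
  by rewrite -(natr1 n) => nP; have := mulr_gt0 d0 e0; nra.
exists (bernstein n.+1 (fun k => f (k%:R / n.+1%:R))) => t /andP[t0 t1].
set N : R := n.+1%:R; have N0 : 0 < N by rewrite ltr0n.
pose b := L / (d * N ^+ 2).
have b0 : 0 <= b by apply: divr_ge0 => //; apply: mulr_ge0; apply: ltW => //; exact: exprn_gt0.
(* The inequality |u| <= d + u^2 / d traps the samples of [f] between two quadratic polynomials in
   k; Bernstein polynomials are monotone in the samples and explicit for quadratics. *)
have H k : (k <= n.+1)%N ->
    `|f (k%:R / N) - f t| <= L * d + b * (k%:R + - (N * t)) ^+ 2.
  move=> kn; apply: le_trans (fL _ _ _ _) _; [|by rewrite t0|].
    by rewrite divr_ge0 ?ler0n//= ler_pdivrMr// mul1r ler_nat.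
  have -> : L * d + b * (k%:R + - (N * t)) ^+ 2 = L * (d + (k%:R / N - t) ^+ 2 / d).
    by rewrite /b; field; rewrite !gt_eqF.
  rewrite ler_wpM2l// -(real_normK (num_real (_ - t))).
  set y := `|_|; have y0 : 0 <= y by exact: normr_ge0.
  rewrite -(ler_pM2r d0) mulrDl divfK ?gt_eqF//; nra.
have Q c b' := bernstein_quadratic n.+1 (- (N * t)) b' c t.
have B : L * d + b * (N * t * (1 - t) + (N * t + - (N * t)) ^+ 2) <= e.
  rewrite subrr expr0n addr0 (_ : b * _ = L / (d * N) * (t * (1 - t))); last first.
    by rewrite /b; field; rewrite !gt_eqF.
  have : t * (1 - t) <= 1 by nra.
  have : 0 <= t * (1 - t) by nra.
  have : 0 <= L / (d * N) by apply: divr_ge0 => //; apply: mulr_ge0; exact: ltW.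
  move: nP; rewrite -/N; move: (L / (d * N)) (t * (1 - t)) => u v; nra.
rewrite distrC ler_norml; apply/andP; split.
  have := @bernstein_le n.+1 (fun k => (f t - L * d) + (- b) * (k%:R + - (N * t)) ^+ 2)
    (fun k => f (k%:R / N)) t t0 t1.
  rewrite Q => bl; suff /bl : forall k, (k <= n.+1)%N ->
      (f t - L * d) + (- b) * (k%:R + - (N * t)) ^+ 2 <= f (k%:R / N) by lra.
  by move=> k /H; rewrite ler_norml => /andP[? ?]; lra.
have := @bernstein_le n.+1 (fun k => f (k%:R / N))
  (fun k => (f t + L * d) + b * (k%:R + - (N * t)) ^+ 2) t t0 t1.
rewrite Q => bl; suff /bl : forall k, (k <= n.+1)%N ->
    f (k%:R / N) <= (f t + L * d) + b * (k%:R + - (N * t)) ^+ 2 by lra.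
by move=> k /H; rewrite ler_norml => /andP[_ ?]; lra.
Qed.

(** By the mean value theorem [f] is Lipschitz on [-r, r], onto which [u] maps [0, 1] affinely. *)
Lemma smooth_poly_approx f (r e : R) : smooth f -> 0 < r -> 0 < e ->
  exists p : {poly R}, forall t, `|t| <= r -> `|f t - p.[t]| <= e.
Proof.
move=> sf r0 e0.
have [K KP] := continuous_bounded_itv r (smooth_continuous (smooth_derive sf)).
have K0 : 0 <= K by apply: le_trans (KP 0 _) => //; rewrite normr0 ltW.
have lip s t : `|s| <= r -> `|t| <= r -> s < t -> `|f s - f t| <= K * `|s - t|.
  move=> sr tr st; rewrite distrC [X in _ * X]distrC.
  have cf : {within `[s, t], continuous f}.
    exact/continuous_subspaceT/smooth_continuous.
  have [z /andP[z0 z1] ->] := MVT st (fun z _ => smooth_is_derive z sf) cf.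
  rewrite normrM ler_wpM2r//; apply: KP.
  move: sr tr z0 z1; rewrite !ler_norml !bnd_simp => /andP[? ?] /andP[? ?] ? ?.
  by apply/andP; split; lra.
pose u s := r * (2 * s - 1).
have u1 s : 0 <= s <= 1 -> `|u s| <= r.
  by move=> /andP[s0 s1]; rewrite /u ler_norml; apply/andP; split; nra.
have rK : 0 <= 2 * r * K by apply: mulr_ge0 => //; lra.
have [s t s01 t01|p pP] := lipschitz_bernstein (f := f \o u) rK e0.
  have -> : 2 * r * K * `|s - t| = K * `|u s - u t|.
    rewrite (_ : u s - u t = (2 * r) * (s - t)); last by rewrite /u; ring.
    by rewrite normrM gtr0_norm ?mulr_gt0//; ring.
  have [st|st|st] := ltgtP (u s) (u t).
  - by apply: lip => //; exact: u1.
  - by rewrite distrC [X in _ * X]distrC; apply: lip => //; exact: u1.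
  - by rewrite /= st !subrr normr0 mulr0.
exists (p \Po ((2 * r)^-1 *: 'X + 2^-1%:P)) => t tr.
rewrite horner_comp !hornerE.
have := pP ((2 * r)^-1 * t + 2^-1).
rewrite /= (_ : u _ = t); last by rewrite /u; field; rewrite gt_eqF.
apply; move: tr; rewrite ler_norml => /andP[? ?].
have -> : (2 * r)^-1 * t + 2^-1 = (t + r) / (2 * r) by field; rewrite gt_eqF.
have r2 : 0 < 2 * r by lra.
by rewrite ler_pdivlMr// ler_pdivrMr// mul0r mul1r; apply/andP; split; lra.
Qed.

End PolynomialApproximation.

(** * Funk-Hecke formula *)

Ltac smooth_tac := cbv beta; repeat lazymatch goal with
  | |- smoothfun (fun y => _) =>
    lazymatch goal with
    | |- smoothfun (fun _ => ?a) => exact: smoothfun_cst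
    | |- smoothfun (fun y => @?f y + @?g y) => apply: (@smoothfunD _ _ f g)
    | |- smoothfun (fun y => @?f y * @?g y) => apply: (@smoothfunM _ _ f g)
    | |- smoothfun (fun y => - @?f y) => apply: (@smoothfun_opp _ _ f)
    | |- smoothfun (fun y => enorm y ^+ 2) => exact: smoothfun_enorm_sqr
    | |- smoothfun (fun y => @?f y ^+ ?n) => apply: (@smoothfunX _ _ n f)
    | |- smoothfun (fun y => dot ?x y) => exact: smoothfun_dot
    | |- smoothfun (fun y => fun_of_matrix y _ ?j) => exact: smoothfun_coord
    | |- smoothfun (fun y => pderiv ?j ?f y) => apply: smoothfun_pderiv
    | |- smoothfun (fun y => ?f y) => change (smoothfun f)
    | |- smoothfun (fun y => ?h (@?f y)) => first
        [apply: (@smoothfun_comp _ _ h f);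
         [lazymatch goal with
          | |- smooth (horner ?p) => exact: (@smooth_horner _ p)
          | |- _ => assumption
          end|]
        |apply: smoothfun_sum => ?]
    | |- _ => apply: smoothfun_sum => ?
    end
  | |- smoothfun (pderiv _ _) => apply: smoothfun_pderiv
  | |- smoothfun (dot _) => exact: smoothfun_dot
  | |- smoothfun _ => assumption
  end.

Section FunkHecke.
Variables (R : realType) (m : nat).
Implicit Types (f g H : 'rV[R]_m -> R) (x y v : 'rV[R]_m).

Definition laplacian f y : R := \sum_j pderiv j (pderiv j f) y.

Definition dirder x f y : R := \sum_j x 0 j * pderiv j f y.

(* Solid harmonics of degree k, homogeneity being expressed by Euler's identity. *)
Definition harmonic k H :=
  [/\ smoothfun H, forall y, dirder y H y = k%:R * H y & forall y, laplacian H y = 0].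

Definition rho y : R := 1 - enorm y ^+ 2.

Lemma smoothfun_rho : smoothfun rho.
Proof. by rewrite /rho; smooth_tac. Qed.

Lemma smoothfun_dirder x f : smoothfun f -> smoothfun (dirder x f).
Proof. by move=> sf; rewrite /dirder; smooth_tac. Qed.

Lemma pderivZ j a f : smoothfun f ->
  pderiv j (fun y => a * f y) = fun y => a * pderiv j f y.
Proof.
move=> sf; rewrite (pderivM j (smoothfun_cst _ a) sf) pderiv_cst.
by apply/funext => y; rewrite mul0r add0r.
Qed.

Lemma pderiv_sum (I : Type) (r : seq I) (P : pred I) (F : I -> 'rV[R]_m -> R) j :
  (forall i, smoothfun (F i)) ->
  pderiv j (fun y => \sum_(i <- r | P i) F i y)
  = fun y => \sum_(i <- r | P i) pderiv j (F i) y.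
Proof.
move=> sF; elim: r => [|i r IH].
  under eq_fun do rewrite big_nil.
  by rewrite pderiv_cst; apply/funext => y; rewrite big_nil.
under eq_fun do rewrite big_cons; under [RHS]eq_fun do rewrite big_cons.
by case: (P i); rewrite // pderivD// ?IH//; exact: smoothfun_sum.
Qed.

Lemma pderiv_dot j x : pderiv j (dot x) = fun _ => x 0 j.
Proof.
rewrite /dot pderiv_sum => [|i]; last by smooth_tac.
apply/funext => y; rewrite (bigD1 j)//= big1 => [|i ij];
  rewrite pderivZ ?pderiv_coord; try exact: smoothfun_coord.
  by rewrite eqxx mulr1 addr0.
by rewrite (negbTE ij) mulr0.
Qed.

Lemma pderiv_expr j f n : smoothfun f ->
  pderiv j (fun y => f y ^+ n) = fun y => n%:R * f y ^+ n.-1 * pderiv j f y.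
Proof.
move=> sf; apply/funext => y; apply: pderivE.
by have := is_deriveX n (smoothfun_is_pderiv j y sf); rewrite fctE.
Qed.

Lemma pderiv_rho j : pderiv j rho = fun y => - (2 * y 0 j).
Proof.
rewrite /rho (pderivD j (smoothfun_cst _ 1)); last by smooth_tac.
rewrite pderiv_cst; apply/funext => y; rewrite add0r.
rewrite (_ : (fun y => _) = fun y => (- 1) * enorm y ^+ 2).
  by rewrite pderivZ; [rewrite pderiv_enorm_sqr mulN1r|smooth_tac].
by apply/funext => z; rewrite mulN1r.
Qed.

(** The integrand is minus the divergence of rho^(p+1) f, with rho^p factored out. *)
Lemma ball_int_div p (f : 'I_m -> 'rV[R]_m -> R) : (forall j, smoothfun (f j)) ->
  ball_int (fun y => rho y ^+ p *
    \sum_j (2 * p.+1%:R * (y 0 j * f j y) - rho y * pderiv j (f j) y)) = 0.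
Proof.
move=> sf; have sr := smoothfun_rho.
transitivity (ball_int (fun y => \sum_j
    (- 1) * pderiv j (fun y => (1 - enorm y ^+ 2) * (rho y ^+ p * f j y)) y)).
  apply: eq_ball_int => y _; rewrite mulr_sumr; apply: eq_bigr => j _.
  rewrite (_ : (fun y => _) = fun y => rho y ^+ p.+1 * f j y); last first.
    by apply/funext => z; rewrite [in RHS]exprS -mulrA.
  rewrite pderivM//; last by smooth_tac.
  by rewrite pderiv_expr// pderiv_rho/= exprS; ring.
rewrite ball_int_sum => [|j]; last first.
  by smooth_tac; exact: sf.
rewrite big1// => j _; rewrite ball_intZ; last by smooth_tac; exact: sf.
by rewrite ball_int_pderiv0 ?mulr0//; smooth_tac; exact: sf.
Qed.

(** A derivative with constant coefficients commutes with the Laplacian; differentiating Euler's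
    identity yields one extra copy of the derivative, which lowers the degree by one. *)
Lemma harmonic_dirder k H x : harmonic k.+1 H -> harmonic k (dirder x H).
Proof.
move=> [sH eH lH].
have sp j : smoothfun (pderiv j H) by exact: smoothfun_pderiv.
have pd i : pderiv i (dirder x H) = fun y => \sum_j x 0 j * pderiv i (pderiv j H) y.
  rewrite /dirder pderiv_sum => [|j]; last by smooth_tac.
  by apply/funext => y; apply: eq_bigr => j _; rewrite pderivZ.
have eH' j y : dirder y (pderiv j H) y = k%:R * pderiv j H y.
  have : pderiv j (fun y => dirder y H y) = pderiv j (fun y => k.+1%:R * H y).
    by congr pderiv; apply/funext => z; exact: eH.
  rewrite pderivZ// /dirder pderiv_sum => [|i]; last by smooth_tac.
  move=> /(congr1 (fun f => f y)) E.
  apply: (@addIr _ (pderiv j H y)).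
  rewrite (_ : k%:R * _ + _ = k.+1%:R * pderiv j H y); last first.
    by rewrite -natr1 mulrDl mul1r.
  rewrite -E.
  rewrite [RHS](eq_bigr (fun i => y 0 i * pderiv i (pderiv j H) y + (i == j)%:R * pderiv i H y)).
    rewrite big_split/= [X in _ = _ + X](bigD1 j)//= eqxx mul1r.
    rewrite [X in _ = _ + (_ + X)]big1 ?addr0// => i ij.
    by rewrite (negbTE ij) mul0r.
  move=> i _; rewrite pderivM//; last exact: smoothfun_coord.
  by rewrite pderiv_coord addrC (pderivC j i).
split; first exact: smoothfun_dirder.
- move=> y; rewrite /dirder mulr_sumr.
  under eq_bigr do rewrite -/(dirder x H) pd mulr_sumr.
  rewrite exchange_big/=; apply: eq_bigr => j _.
  rewrite mulrCA -eH' /dirder mulr_sumr; apply: eq_bigr => i _.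
  by rewrite mulrCA.
- move=> y; have E i : pderiv i (pderiv i (dirder x H)) y
      = \sum_j x 0 j * pderiv j (pderiv i (pderiv i H)) y.
    rewrite pd pderiv_sum => [|j]; last by smooth_tac.
    apply: eq_bigr => j _; rewrite pderivZ; last by smooth_tac.
    by rewrite (pderivC i j sH) (pderivC i j (sp i)).
  rewrite /laplacian (eq_bigr _ (fun i _ => E i)) exchange_big/= big1// => j _.
  rewrite -mulr_sumr.
  have := @pderiv_sum _ (index_enum 'I_m) xpredT (fun i => pderiv i (pderiv i H)) j.
  move=> /(_ (fun i => smoothfun_pderiv i (sp i))) /(congr1 (fun f => f y)) <-.
  rewrite (_ : (fun y => _) = fun _ => 0) ?pderiv_cst ?mulr0//.
  by apply/funext => z; exact: lH.
Qed.

(** The mean value theorem on the segment from 0 to x: at an interior point s x, Euler's identity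
    says that s times the derivative along x is 0. *)
Lemma harmonic0_cst H x : harmonic 0 H -> H x = H 0.
Proof.
move=> [sH eH _].
have D s : is_derive s (1 : R) (fun s => H (s *: x + 0)) (dirder x H (s *: x + 0)).
  exact: smoothfun_line.
have C : {within `[0, 1], continuous (fun s : R => H (s *: x + 0))}.
  by apply: derivable_within_continuous => s _; have [] := D s.
have [s /andP[s0 s1]] := MVT ltr01 (fun s _ => D s) C.
rewrite !addr0 scale1r scale0r subr0 mulr1 => /eqP; rewrite subr_eq => /eqP ->.
rewrite bnd_simp in s0.
have : s * dirder x H (s *: x) = 0.
  have := eH (s *: x); rewrite mul0r => <-.
  by rewrite /dirder mulr_sumr; apply: eq_bigr => j _; rewrite mxE mulrA.
by move=> /eqP; rewrite mulf_eq0 gt_eqF//= => /eqP ->; rewrite add0r.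
Qed.

Lemma harmonic0_dirder H x y : harmonic 0 H -> dirder x H y = 0.
Proof.
move=> h0; rewrite /dirder (_ : H = fun _ => H 0).
  by rewrite big1// => j _; rewrite pderiv_cst mulr0.
by apply/funext => z; exact: harmonic0_cst.
Qed.

(* The divergence theorem for the field (1 - |y|^2)^(p+1) <x, y>^n H(y) x gives a
   recursion on the exponent of <x, y>; for exponent 0 the field is
   (1 - |y|^2)^(p+1) grad H. *)
Lemma funk_hecke_monomial n p k : exists gam : R, forall H x, harmonic k H ->
  dot x x = 1 ->
  ball_int (fun y => rho y ^+ p * (dot x y ^+ n * H y)) = gam * H x.
Proof.
have sr := smoothfun_rho.
have [l ln] := ubnP n.
(* Strong induction on the exponent: the recursion lowers n + 1 to n and n - 1, but raises [p] and
   may lower the degree of the harmonic, so [p] and [k] stay general. *)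
elim: l n ln p k => // l IH [_ p [|k]|n].
- exists (ball_int (fun y => rho y ^+ p)) => H x H0 _.
  rewrite mulrC -ball_intZ; last by smooth_tac.
  apply: eq_ball_int => y _.
  by rewrite expr0 mul1r mulrC (harmonic0_cst y H0) (harmonic0_cst x H0).
- exists 0 => H x [sH eH lH] _; rewrite mul0r.
  have := @ball_int_div p (fun j => pderiv j H) (fun j => smoothfun_pderiv j sH).
  rewrite (_ : (fun y => _) = fun y => (2 * p.+1%:R * k.+1%:R) *
      (rho y ^+ p * (dot x y ^+ 0 * H y))).
    rewrite ball_intZ; last by smooth_tac.
    by move=> /eqP; rewrite !mulf_eq0 !pnatr_eq0 => /eqP.
  apply/funext => y; rewrite sumrB -!mulr_sumr -/(laplacian H y) lH -/(dirder y H y) eH.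
  by ring.
rewrite ltnS => nl p k.
have [g1 g1P] := IH n nl p.+1 k.-1.
(* The factor n removes the term when n = 0, where [n.-1] is no true predecessor. *)
have [g2 g2P] : exists gam : R, forall H x, harmonic k H -> dot x x = 1 ->
    n%:R * ball_int (fun y => rho y ^+ p.+1 * (dot x y ^+ n.-1 * H y)) = gam * H x.
  case: n nl {g1 g1P} => [|n] nl; first by exists 0 => *; rewrite !mul0r.
  have [g gP] := IH n (ltnW nl) p.+1 k.
  by exists (n.+1%:R * g) => H x hH xx; rewrite gP// mulrA.
exists ((g2 + k%:R * g1) / (2 * p.+1%:R)) => H x hH xx.
(* The directional derivative of [H] along x is evaluated at x itself, where Euler's identity turns
   it back into k H(x). For k = 0 both sides are 0. *)
have {}g1P : ball_int (fun y => rho y ^+ p.+1 * (dot x y ^+ n * dirder x H y))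
    = k%:R * g1 * H x.
  case: k hH g1P {g2P} => [|k] hH g1P.
    rewrite !mul0r -[RHS](ball_int0 R m); apply: eq_ball_int => y _.
    by rewrite harmonic0_dirder// !mulr0.
  have [_ eH _] := hH.
  by rewrite (g1P _ _ (harmonic_dirder x hH) xx) eH mulrCA mulrA.
have [sH _ _] := hH; have sxH := smoothfun_dirder x sH.
have sf j : smoothfun (fun y => x 0 j * (dot x y ^+ n * H y)) by smooth_tac.
have := ball_int_div p sf.
rewrite (_ : (fun y => _) = fun y =>
    2 * p.+1%:R * (rho y ^+ p * (dot x y ^+ n.+1 * H y))
    + (- 1 * (n%:R * (rho y ^+ p.+1 * (dot x y ^+ n.-1 * H y)))
       + - 1 * (rho y ^+ p.+1 * (dot x y ^+ n * dirder x H y)))).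
  rewrite !ball_intD; try by smooth_tac.
  rewrite !ball_intZ; try by smooth_tac.
  rewrite g1P g2P// => E.
  have p0 : (2 * p.+1%:R : R) != 0 by rewrite mulf_neq0 ?pnatr_eq0.
  move: p0 E; move: (2 * _) (ball_int _) (H x) (k%:R) => c I h k' c0 E.
  by apply: (mulfI c0); apply/eqP; rewrite -subr_eq0 -E; apply/eqP; field.
apply/funext => y.
under eq_bigr => j _.
  rewrite pderivZ; last by smooth_tac.
  rewrite pderivM; [|by smooth_tac|by smooth_tac].
  rewrite pderiv_expr; last by smooth_tac.
  rewrite pderiv_dot.
  over.
rewrite /=.
transitivity (rho y ^+ p * (2 * p.+1%:R * (dot x y * (dot x y ^+ n * H y))
   - rho y * (n%:R * dot x y ^+ n.-1 * dot x x * H y + dot x y ^+ n * dirder x H y))).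
  congr (_ * _); rewrite sumrB -!mulr_sumr; congr (_ * _ - _ * _).
    by rewrite /dot mulr_suml; apply: eq_bigr => j _; ring.
  rewrite /dirder [X in X * H y]mulr_sumr mulr_suml mulr_sumr -big_split/=.
  by apply: eq_bigr => j _; ring.
by rewrite xx !exprS; ring.
Qed.

End FunkHecke.

(** * Funk-Hecke for polynomial and smooth kernels *)

Section FunkHeckeSmooth.
Variables (R : realType) (m : nat).
Implicit Types (f g H : 'rV[R]_m -> R) (x y v : 'rV[R]_m).

Lemma funk_hecke_poly (g q : {poly R}) k : exists gam : R, forall H x, harmonic k H ->
  dot x x = 1 ->
  ball_int (fun y => g.[dot x y] * q.[enorm y ^+ 2] * H y) = gam * H x.
Proof.
have sr := @smoothfun_rho R m.
(* The radial factor is expanded in powers of [rho] = 1 - |y|^2, for which the monomial formula is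
   available. *)
pose q' := q \Po (1 - 'X).
pose gam n p := projT1 (cid (@funk_hecke_monomial R m n p k)).
have gamP n p := projT2 (cid (@funk_hecke_monomial R m n p k)).
exists (\sum_(i < size g) \sum_(j < size q') g`_i * q'`_j * gam i j) => H x hH xx.
have [sH _ _] := hH.
rewrite mulr_suml (eq_bigr (fun i : 'I_(size g) => ball_int (fun y =>
    \sum_(j < size q') g`_i * q'`_j * (rho y ^+ j * (dot x y ^+ i * H y))))); last first.
  move=> i _; rewrite mulr_suml ball_int_sum => [|j]; last by smooth_tac.
  apply: eq_bigr => j _; rewrite ball_intZ; last by smooth_tac.
  by rewrite gamP// mulrA.
rewrite -ball_int_sum => [|i]; last by smooth_tac.
apply: eq_ball_int => y _.
have -> : q.[enorm y ^+ 2] = q'.[rho y].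
  by rewrite /q' horner_comp !hornerE /rho opprB addrCA subrr addr0.
rewrite !horner_coef !mulr_suml; apply: eq_bigr => i _.
by rewrite mulr_sumr mulr_suml; apply: eq_bigr => j _; ring.
Qed.

Lemma le_all_eps_eq0 (a C : R) : (forall e, 0 < e -> e <= 1 -> `|a| <= C * e) -> a = 0.
Proof.
move=> H; apply/eqP; rewrite -normr_le0; apply/ler_addgt0Pr => e e0; rewrite add0r.
have C0 : 0 <= C.
  by have := le_trans (normr_ge0 _) (H 1 ltr01 (lexx _)); rewrite mulr1.
have d0 : 0 < C + e + 1 by lra.
have := H (e / (C + e + 1)) (divr_gt0 e0 d0).
rewrite ler_pdivrMr// => /(_ _)/le_trans; apply; first by lra.
by rewrite mulrA ler_pdivrMr//; nra.
Qed.

Lemma normr_dot_le1 z y : dot z z = 1 -> cball 1 y -> `|dot z y| <= 1.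
Proof.
move=> zz /cball_sqr; rewrite expr1n => /(_ ler01) yy.
have : 0 <= dot (y - dot z y *: z) (y - dot z y *: z) by exact: dot_ge0.
have -> t : dot (y - t *: z) (y - t *: z)
    = dot y y - 2 * t * dot z y + t ^+ 2 * dot z z.
  rewrite /dot !mulr_sumr -sumrB -big_split/=.
  by apply: eq_bigr => j _; rewrite !mxE; ring.
rewrite zz mulr1 => h; rewrite -(ler_sqr (y := 1)) ?nnegrE// expr1n real_normK ?num_real//.
nra.
Qed.

(* The unknown factor is eliminated: this form survives uniform approximation of
   g and P by polynomials. *)
Lemma funk_hecke (g P : R -> R) k H H' x x' : smooth g -> smooth P ->
  harmonic k H -> harmonic k H' -> dot x x = 1 -> dot x' x' = 1 ->
  ball_int (fun y => g (dot x y) * P (enorm y ^+ 2) * H y) * H' x' =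
  ball_int (fun y => g (dot x' y) * P (enorm y ^+ 2) * H' y) * H x.
Proof.
move=> sg sP hH hH' xx xx'.
have [sH _ _] := hH; have [sH' _ _] := hH'.
have app z G : smoothfun G -> dot z z = 1 -> exists C : R, forall e : R, 0 < e -> e <= 1 ->
    forall gp pp : {poly R},
      (forall t, `|t| <= 1 -> `|g t - gp.[t]| <= e) ->
      (forall t, `|t| <= 1 -> `|P t - pp.[t]| <= e) ->
      `|ball_int (fun y => g (dot z y) * P (enorm y ^+ 2) * G y) -
        ball_int (fun y => gp.[dot z y] * pp.[enorm y ^+ 2] * G y)| <= C * e.
  move=> sG zz.
  have [Kg KgP] := continuous_bounded_itv 1 (smooth_continuous sg).
  have [KP KPP] := continuous_bounded_itv 1 (smooth_continuous sP).
  have [KG KGP] := smoothfun_bounded 1 sG.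
  (* From g P - gp pp = g (P - pp) + (g - gp) pp, where |pp| <= KP + 1 because e <= 1. *)
  exists ((Kg + (KP + 1)) * KG * ball_vol R m) => e e0 e1 gp pp gpP ppP.
  rewrite -mulN1r -ball_intZ; last by smooth_tac.
  rewrite -ball_intD; [|by smooth_tac..].
  rewrite mulrAC; apply: ball_int_le; first by smooth_tac.
  move=> y y1.
  have dz : `|dot z y| <= 1 by exact: normr_dot_le1.
  have ez : `|enorm y ^+ 2| <= 1 by rewrite ger0_norm ?sqr_ge0// expr_le1 ?enorm_ge0.
  have := gpP _ dz; have := ppP _ ez; have := KgP _ dz; have := KPP _ ez; have := KGP _ y1.
  move: (g _) (P _) (gp.[_]) (pp.[_]) (G y) => a b c d h kh kb ka bd ac.
  have -> : a * b * h + -1 * (c * d * h) = (a * (b - d) + (a - c) * d) * h by ring.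
  rewrite normrM mulrAC ler_pM//.
  rewrite [leRHS]mulrDl (le_trans (ler_normD _ _))// lerD// normrM; first exact: ler_pM.
  rewrite mulrC ler_pM//.
  rewrite (_ : d = b + - (b - d)); last by ring.
  rewrite (le_trans (ler_normD _ _))// lerD// normrN; exact: le_trans bd e1.
have [C CP] := app x H sH xx; have [C' CP'] := app x' H' sH' xx'.
apply/eqP; rewrite -subr_eq0; apply/eqP.
apply: (@le_all_eps_eq0 _ (C * `|H' x'| + C' * `|H x|)) => e e0 e1.
have [gp gpP] := smooth_poly_approx sg ltr01 e0.
have [pp ppP] := smooth_poly_approx sP ltr01 e0.
have [gam gamP] := funk_hecke_poly gp pp k.
have := CP e e0 e1 gp pp gpP ppP; have := CP' e e0 e1 gp pp gpP ppP.
rewrite (gamP H x hH xx) (gamP H' x' hH' xx').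
move: (ball_int (fun y => g (dot x y) * _ * _))
  (ball_int (fun y => g (dot x' y) * _ * _)) (H x) (H' x') => B A h h' Ah Bh.
(* The Funk-Hecke factor [gam] of the polynomial kernels, common to [H] and [H'], cancels here. *)
rewrite (_ : B * h' - A * h = (B - gam * h) * h' - (A - gam * h') * h); last by ring.
rewrite [leRHS]mulrDl (le_trans (ler_normB _ _))// lerD//.
  by rewrite normrM mulrAC ler_wpM2r.
by rewrite normrM mulrAC ler_wpM2r.
Qed.

End FunkHeckeSmooth.

(** * Dirac operator on monogenic polynomials *)

Section CliffordCalculus.
Variables (R : realType) (m : nat).
Implicit Types (f : 'rV[R]_m -> clifford R m) (x y : 'rV[R]_m) (i j : 'I_m).

Local Notation e := (cl_gen R).

Definition csmooth f := forall A, smoothfun (fun y => f y A).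

Lemma clDE (a b : clifford R m) A : (a + b) A = a A + b A.
Proof. by rewrite ffunE. Qed.

Lemma clZE (r : R) (a : clifford R m) A : (r *: a) A = r * a A.
Proof. by rewrite ffunE. Qed.

Lemma cl_sumE (I : Type) (s : seq I) (P : pred I) (F : I -> clifford R m) A :
  (\sum_(i <- s | P i) F i) A = \sum_(i <- s | P i) F i A.
Proof. by elim/big_rec2: _ => [|l x y _ <-]; rewrite ffunE. Qed.

Lemma clME (a b : clifford R m) C : (a * b) C
  = \sum_A cl_sign R A (symd A C) * a A * b (symd A C).
Proof. exact: cl_mulE. Qed.

Lemma clZr (r : R) (a b : clifford R m) : a * (r *: b) = r *: (a * b).
Proof.
apply/ffunP => C; rewrite clZE !clME mulr_sumr.
by apply: eq_bigr => A _; rewrite clZE; ring.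
Qed.

Lemma cl_gen_anticommE i j (a : clifford R m) :
  e i * (e j * a) + e j * (e i * a) = (- (2 * (i == j)%:R)) *: a.
Proof.
rewrite !mulrA -mulrDl; case: eqVneq => [->|ij].
  rewrite cl_gen_sqr mulr1; apply/ffunP => C; rewrite mulrDl mulN1r clDE clZE ffunE.
  by ring.
by rewrite (cl_gen_anticomm _ ij) addNr mul0r mulr0 oppr0 scale0r.
Qed.

(** Adding the double sum to its transpose leaves only anticommutators. Applied to second
    derivatives, this says that the square of the Dirac operator is minus the Laplacian. *)
Lemma cl_gen_quadratic (K : 'I_m -> 'I_m -> clifford R m) :
  (forall i j, K i j = K j i) ->
  \sum_i e i * (\sum_j e j * K i j) = - \sum_i K i i.
Proof.
move=> Ks; set S := LHS.
have SE : S = \sum_i \sum_j e i * (e j * K i j).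
  by apply: eq_bigr => i _; rewrite mulr_sumr.
have : S + S = \sum_i (- 2) *: K i i.
  rewrite {1}SE SE [X in _ + X]exchange_big -big_split/=.
  apply: eq_bigr => i _; rewrite -big_split/= (bigD1 i)//= big1 => [|j ji].
    by rewrite cl_gen_anticommE eqxx mulr1 addr0.
  by rewrite (Ks j i) cl_gen_anticommE eq_sym (negbTE ji) mulr0 oppr0 scale0r.
rewrite -scaler_sumr => /ffunP E; apply/ffunP => C.
have := E C; rewrite clDE clZE => EC; rewrite [RHS]ffunE; lra.
Qed.

Lemma partialE i f x A : partial i f x A = pderiv i (fun y => f y A) x.
Proof. by rewrite ffunE. Qed.

Opaque partial.

Lemma csmooth_partial i f : csmooth f -> csmooth (partial i f).
Proof.
by move=> sf A; under eq_fun do rewrite partialE; exact: smoothfun_pderiv.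
Qed.

Lemma csmoothZ (h : 'rV[R]_m -> R) f :
  smoothfun h -> csmooth f -> csmooth (fun y => h y *: f y).
Proof. by move=> sh sf A; under eq_fun do rewrite clZE; exact: smoothfunM. Qed.

Lemma csmoothM (a : clifford R m) f : csmooth f -> csmooth (fun y => a * f y).
Proof.
move=> sf C; under eq_fun do rewrite clME.
by apply: smoothfun_sum => A; apply: smoothfunM => //; exact: smoothfun_cst.
Qed.

Lemma partialZ i (h : 'rV[R]_m -> R) f x : smoothfun h -> csmooth f ->
  partial i (fun y => h y *: f y) x = pderiv i h x *: f x + h x *: partial i f x.
Proof.
move=> sh sf; apply/ffunP => A; rewrite partialE clDE !clZE partialE.
under eq_fun do rewrite clZE.
by rewrite pderivM.
Qed.

Lemma partialM i (a : clifford R m) f x : csmooth f ->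
  partial i (fun y => a * f y) x = a * partial i f x.
Proof.
move=> sf; apply/ffunP => C; rewrite partialE clME.
under eq_fun do rewrite clME.
rewrite pderiv_sum => [|A]; last by apply: smoothfunM => //; exact: smoothfun_cst.
by apply: eq_bigr => A _; rewrite pderivZ// partialE.
Qed.

Lemma partial_sum i (I : Type) (s : seq I) (P : pred I)
    (F : I -> 'rV[R]_m -> clifford R m) x : (forall l, csmooth (F l)) ->
  partial i (fun y => \sum_(l <- s | P l) F l y) x
  = \sum_(l <- s | P l) partial i (F l) x.
Proof.
move=> sF; apply/ffunP => A; rewrite partialE cl_sumE.
under eq_fun do rewrite cl_sumE.
by rewrite pderiv_sum => [|l]; [apply: eq_bigr => l _; rewrite partialE|exact: sF].
Qed.

Lemma partial_comp j f A : (fun y => partial j f y A) = pderiv j (fun y => f y A).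
Proof. by apply/funext => y; exact: partialE. Qed.

Lemma partial_partialE i j f x A :
  partial i (partial j f) x A = pderiv i (pderiv j (fun y => f y A)) x.
Proof. by rewrite partialE partial_comp. Qed.

Lemma partialC i j f x : csmooth f -> partial i (partial j f) x = partial j (partial i f) x.
Proof.
move=> sf; apply/ffunP => A.
apply: etrans (partial_partialE i j f x A) _.
apply: etrans _ (esym (partial_partialE j i f x A)).
exact: (congr1 (fun h : 'rV[R]_m -> R => h x) (pderivC i j (sf A))).
Qed.

Lemma homogeneous_poly_csmooth k f : homogeneous_poly k f -> csmooth f.
Proof.
move=> [a fE] A; under eq_fun do rewrite fE cl_sumE.
apply: smoothfun_sum => al; under eq_fun do rewrite clZE.
apply: smoothfunM; last exact: smoothfun_cst.
by apply: smoothfun_prod => j; apply: smoothfunX; exact: smoothfun_coord.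
Qed.

Lemma homogeneous_polyZ k f (r : R) x : homogeneous_poly k f ->
  f (r *: x) = r ^+ k *: f x.
Proof.
move=> [a fE]; rewrite !fE scaler_sumr; apply: eq_bigr => al /eqP alk.
rewrite scalerA; congr (_ *: _).
under eq_bigr do rewrite mxE exprMn.
by rewrite big_split/= prodrXr alk.
Qed.

(** Both sides are the derivative at r = 1 of f(r x) = r^k f(x). *)
Lemma homogeneous_euler k f x : homogeneous_poly k f ->
  \sum_j x 0 j *: partial j f x = k%:R *: f x.
Proof.
move=> hf; have sf := homogeneous_poly_csmooth hf.
apply/ffunP => A; rewrite cl_sumE clZE.
under eq_bigr do rewrite clZE partialE.
have := smoothfun_line 0 x 1 (sf A).
rewrite scale1r addr0.
under eq_fun do rewrite addr0 (homogeneous_polyZ _ _ hf) clZE.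
move=> D.
have D' : is_derive (1 : R) (1 : R) (fun s : R => s ^+ k * f x A) (k%:R * f x A).
  have := is_deriveM (is_deriveX k (is_derive_id (1 : R) (1 : R)))
    (is_derive_cst (f x A) (1 : R) (1 : R)).
  rewrite !fctE => /is_derive_eq; apply; rewrite /GRing.scale/=.
  by rewrite !expr1n; ring.
by rewrite -(@derive_val _ _ _ _ _ _ _ D) -(@derive_val _ _ _ _ _ _ _ D').
Qed.

Lemma monogenic_harmonic k f A : monogenic k f -> harmonic k (fun y => f y A).
Proof.
move=> [hf df]; have sf := homogeneous_poly_csmooth hf.
split; first exact: sf.
  move=> x; have /ffunP/(_ A) := homogeneous_euler x hf.
  rewrite cl_sumE clZE => <-.
  by apply: eq_bigr => j _; rewrite clZE partialE.
move=> x.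
have : \sum_i e i * (\sum_j e j * partial i (partial j f) x) = 0.
  rewrite big1// => i _.
  have := @partial_sum i _ (index_enum 'I_m) xpredT (fun j y => e j * partial j f y) x.
  move=> /(_ (fun j => csmoothM (e j) (csmooth_partial j sf))).
  rewrite (_ : (fun y => _) = fun _ => 0); last by apply/funext => y; exact: df.
  rewrite (eq_bigr (fun j => e j * partial i (partial j f) x)); last first.
    by move=> j _; rewrite partialM//; exact: csmooth_partial.
  move=> <-; rewrite (_ : partial _ _ _ = 0) ?mulr0//.
  apply/ffunP => B; rewrite partialE (_ : (fun y => _) = fun _ => 0).
    by rewrite pderiv_cst ffunE.
  by apply/funext => y; rewrite ffunE.
rewrite cl_gen_quadratic; last by move=> i j; rewrite partialC.
move=> /ffunP/(_ A)/eqP; rewrite !ffunE oppr_eq0 cl_sumE => /eqP <-.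
by apply: eq_bigr => i _; rewrite partial_partialE.
Qed.

Lemma dirac_radial (P : R -> R) k f x : smooth P -> monogenic k f ->
  dirac_op (fun y => P (enorm y ^+ 2) *: f y) x
  = \sum_j (2 * derive1 P (enorm x ^+ 2) * x 0 j) *: (e j * f x).
Proof.
move=> sP [hf df]; have sf := homogeneous_poly_csmooth hf.
have sPx : smoothfun (fun y : 'rV[R]_m => P (enorm y ^+ 2)) by smooth_tac.
rewrite /dirac_op.
transitivity (\sum_j (2 * derive1 P (enorm x ^+ 2) * x 0 j) *: (e j * f x)
    + P (enorm x ^+ 2) *: dirac_op f x).
  rewrite scaler_sumr -big_split; apply: eq_bigr => j _ /=.
  rewrite partialZ// mulrDr !clZr; congr (_ *: _ + _).
  rewrite pderiv_comp//; last exact: smoothfun_enorm_sqr.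
  by rewrite pderiv_enorm_sqr; ring.
by rewrite df scaler0 addr0.
Qed.

(** Since [f] is monogenic, the inner Dirac operator leaves 2 P' x f. Multiplied by 1 - t this is h
    x f, whose Dirac derivative is -(2 t h' + (m + 2k) h) f: m comes from the squares of the
    generators, 2k from anticommutation and Euler's identity. *)
Lemma L_op_radial (c : R) (P : R -> R) k f x : smooth P -> monogenic k f ->
  L_op c (fun y => P (enorm y ^+ 2) *: f y) x
  = (let t := enorm x ^+ 2 in
     - (4 * t * (1 - t) * derive1 (derive1 P) t
        + ((2 * m%:R + 4 * k%:R) * (1 - t) - 4 * t) * derive1 P t)
     + (2 * pi * c) ^+ 2 * t * P t) *: f x.
Proof.
move=> sP mf; have [hf df] := mf; have sf := homogeneous_poly_csmooth hf.
rewrite /L_op.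
pose h y := (1 - enorm y ^+ 2) * (2 * derive1 P (enorm y ^+ 2)).
have sP' := smooth_derive sP.
have sh : smoothfun h by rewrite /h; smooth_tac.
have shj j : smoothfun (fun y => h y * y 0 j) by smooth_tac.
rewrite (_ : (fun y => _) = fun y => \sum_j (h y * y 0 j) *: (e j * f y)); last first.
  apply/funext => y; rewrite (dirac_radial y sP mf) scaler_sumr.
  by apply: eq_bigr => j _; rewrite scalerA /h mulrA.
set t := enorm x ^+ 2.
(* The derivative in t of (1 - t) 2 P'(t), that is, of [h] as a function of t = |x|^2. *)
pose eta := (1 - t) * (2 * derive1 (derive1 P) t) - 2 * derive1 P t.
have dh i : pderiv i h x = 2 * x 0 i * eta.
  have s1 : smoothfun (fun y : 'rV[R]_m => derive1 P (enorm y ^+ 2)) by smooth_tac.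
  have s2 : smoothfun (fun y : 'rV[R]_m => 2 * derive1 P (enorm y ^+ 2)) by smooth_tac.
  rewrite -[h]/(fun y => rho y * _) (pderivM i (@smoothfun_rho R m) s2) pderiv_rho.
  rewrite (pderivZ i 2 s1) (pderiv_comp i sP' (@smoothfun_enorm_sqr R m)).
  by rewrite pderiv_enorm_sqr /rho /eta /t; ring.
have etaE : eta = (1 - t) * (2 * derive1 (derive1 P) t) - 2 * derive1 P t by [].
clearbody eta.
have sef j : csmooth (fun y => e j * f y) by exact: csmoothM.
have Dhj i j : partial i (fun y => (h y * y 0 j) *: (e j * f y)) x =
    e j * ((2 * eta * x 0 i * x 0 j) *: f x) + ((i == j)%:R * h x) *: (e j * f x)
    + (h x * x 0 j) *: (e j * partial i f x).
  rewrite partialZ// partialM// pderivM//; last exact: smoothfun_coord.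
  rewrite pderiv_coord dh clZr -scalerDl; congr (_ *: _ + _).
  by rewrite eq_sym; ring.
rewrite /dirac_op.
under eq_bigr => i _.
  rewrite partial_sum; last by move=> j; exact: csmoothZ.
  under eq_bigr do rewrite Dhj.
  rewrite !big_split/= !mulrDr.
  over.
rewrite !big_split/=.
rewrite cl_gen_quadratic; last by move=> i j; congr (_ *: _); ring.
have -> : \sum_i e i * (\sum_j ((i == j)%:R * h x) *: (e j * f x))
    = (- (m%:R * h x)) *: f x.
  rewrite (eq_bigr (fun _ => (- h x) *: f x)).
    by rewrite sumr_const card_ord -scaler_nat scalerA mulrN.
  move=> i _; rewrite (bigD1 i)//= big1 => [|j ji]; last first.
    by rewrite eq_sym (negbTE ji) mul0r scale0r.
  by rewrite eqxx mul1r addr0 clZr mulrA cl_gen_sqr mulN1r scalerN scaleNr.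
have -> : \sum_i e i * (\sum_j (h x * x 0 j) *: (e j * partial i f x))
    = (- (2 * k%:R * h x)) *: f x.
  (* Moving e_i to the right of e_j produces the Dirac operator of [f], which is 0, and a diagonal
     term to which Euler's identity applies. *)
  transitivity (\sum_i \sum_j (h x * x 0 j) *: (- (e j * (e i * partial i f x))
     + (- (2 * (i == j)%:R)) *: partial i f x)).
    apply: eq_bigr => i _; rewrite mulr_sumr; apply: eq_bigr => j _.
    by rewrite clZr -cl_gen_anticommE addrCA addNr addr0.
  under eq_bigr do under eq_bigr do rewrite scalerDr.
  under eq_bigr do rewrite big_split/=.
  rewrite big_split/= [X in X + _]exchange_big/= big1 => [|j _]; last first.
    under eq_bigr do rewrite scalerN.
    rewrite sumrN -scaler_sumr -mulr_sumr.
    have -> : \sum_i e i * partial i f x = 0 by exact: df.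
    by rewrite mulr0 scaler0 oppr0.
  rewrite add0r (_ : - (2 * k%:R * h x) = - (2 * h x) * k%:R); last by ring.
  rewrite -scalerA -(homogeneous_euler x hf) scaler_sumr; apply: eq_bigr => i _.
  rewrite (bigD1 i)//= big1 => [|j ji]; last first.
    by rewrite eq_sym (negbTE ji) mulr0 oppr0 scale0r scaler0.
  by rewrite addr0 eqxx mulr1 !scalerA; congr (_ *: _); ring.
rewrite -scaler_suml -scaleNr scalerA -!scalerDl; congr (_ *: _).
rewrite (eq_bigr (fun i => (2 * eta) * (x 0 i * x 0 i))) => [|i _]; last by ring.
rewrite -mulr_sumr -/(dot x x) -enorm_sqr -/t /h etaE -/t.
by ring.
Qed.

End CliffordCalculus.

(** * The scalar prolate operator *)

Section ProlateOperator.
Variables (R : realType) (m : nat).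
Implicit Types (f g u w H : 'rV[R]_m -> R) (x y v : 'rV[R]_m).

(* div((1 - |x|^2) grad f): up to the shift by 2k and the potential, the scalar
   form of L_c on the components of P(|x|^2) Y. *)
Definition weighted_laplacian f x : R :=
  (1 - enorm x ^+ 2) * laplacian f x - 2 * dirder x f x.

Lemma weighted_laplacianE f x : weighted_laplacian f x =
  \sum_j ((1 - enorm x ^+ 2) * pderiv j (pderiv j f) x - 2 * (x 0 j * pderiv j f x)).
Proof. by rewrite sumrB -!mulr_sumr. Qed.

(** Radial formulas for first derivatives hold only where |y|^2 lies in an open set; locality allows
    differentiating them again. *)
Lemma near_line_is_derive f g x v (d : R) :
  (\forall s \near (0 : R), f (s *: v + x) = g (s *: v + x)) ->
  is_derive x v g d -> is_derive x v f d.
Proof.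
move=> fg gd; rewrite -[x]add0r -(scale0r v); apply/(is_derive_line f).
apply: (@near_eq_is_derive _ _ _ (fun s : R => g (s *: v + x)) (fun s : R => f (s *: v + x))).
- by move: fg; apply: filterS => r /esym.
- by apply/(is_derive_line g); rewrite scale0r add0r.
Qed.

Lemma near_line_enorm (D : set R) v x : open D -> D (enorm x ^+ 2) ->
  \forall s \near (0 : R), D (enorm (s *: v + x) ^+ 2).
Proof.
move=> oD Dx; have c : enorm (s *: v + x) ^+ 2 @[s --> (0 : R)] --> enorm x ^+ 2.
  have [ds _] := smoothfun_line x v 0 (@smoothfun_enorm_sqr R m).
  have := differentiable_continuous ((derivable1_diffP _ _).1 ds).
  by rewrite /prop_for /continuous_at /= scale0r add0r.
exact: c D (open_nbhs_nbhs (conj oD Dx)).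
Qed.

Lemma radial_is_derive (D : set R) (phi phi1 : R -> R) f H j x :
  open D -> (forall t, D t -> is_derive t (1 : R) phi (phi1 t)) ->
  smoothfun H -> (forall y, D (enorm y ^+ 2) -> f y = phi (enorm y ^+ 2) * H y) ->
  D (enorm x ^+ 2) ->
  is_derive x (delta_mx 0 j) f
    (phi1 (enorm x ^+ 2) * (2 * x 0 j * H x) + phi (enorm x ^+ 2) * pderiv j H x).
Proof.
move=> oD Dphi sH fE Dx.
have dn : is_derive x (delta_mx 0 j) (fun y : 'rV[R]_m => enorm y ^+ 2) (2 * x 0 j).
  rewrite -(pderiv_enorm_sqr j x).
  exact/smoothfun_is_pderiv/smoothfun_enorm_sqr.
apply: (@near_line_is_derive _ (fun y => phi (enorm y ^+ 2) * H y)).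
  by apply: filterS (near_line_enorm _ oD Dx) => s; exact: fE.
have := is_deriveM (@is_derive_comp1 _ _ phi (fun y : 'rV[R]_m => enorm y ^+ 2)
  _ _ _ _ (Dphi _ Dx) dn) (smoothfun_is_pderiv j x sH).
by move/is_derive_eq; apply; rewrite /GRing.scale/=; ring.
Qed.

(** The set [D] is the whole line for [P] and the half-line t > 0 for the profile of a transform.
    The term -2k phi, absent from the formula for L_c, is Euler's identity inside the first order
    part. *)
Lemma weighted_laplacian_radial (D : set R) (phi phi1 phi2 : R -> R) k f H x :
  open D -> (forall t, D t -> is_derive t (1 : R) phi (phi1 t)) ->
  (forall t, D t -> is_derive t (1 : R) phi1 (phi2 t)) -> harmonic k H ->
  (forall y, D (enorm y ^+ 2) -> f y = phi (enorm y ^+ 2) * H y) ->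
  D (enorm x ^+ 2) ->
  weighted_laplacian f x = (let t := enorm x ^+ 2 in
     4 * t * (1 - t) * phi2 t + ((2 * m%:R + 4 * k%:R) * (1 - t) - 4 * t) * phi1 t
     - 2 * k%:R * phi t) * H x.
Proof.
move=> oD D1 D2 [sH eH lH] fE Dx.
have pE j y : D (enorm y ^+ 2) -> pderiv j f y =
    phi1 (enorm y ^+ 2) * (2 * y 0 j * H y) + phi (enorm y ^+ 2) * pderiv j H y.
  by move=> Dy; apply: pderivE; exact: (radial_is_derive j oD D1 sH fE Dy).
set t := enorm x ^+ 2.
have ppE j : pderiv j (pderiv j f) x =
    (4 * phi2 t * H x) * (x 0 j * x 0 j) + 2 * phi1 t * H x
    + 4 * phi1 t * (x 0 j * pderiv j H x) + phi t * pderiv j (pderiv j H) x.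
  have s2 : smoothfun (fun y : 'rV[R]_m => 2 * y 0 j) by smooth_tac.
  have sg1 : smoothfun (fun y => 2 * y 0 j * H y) by smooth_tac.
  have sg2 := smoothfun_pderiv j sH.
  have d1 := radial_is_derive j oD D2 sg1 (fun y _ => erefl) Dx.
  have d2 := radial_is_derive j oD D1 sg2 (fun y _ => erefl) Dx.
  apply: pderivE.
  apply: (@near_line_is_derive _ (fun y => phi1 (enorm y ^+ 2) * (2 * y 0 j * H y)
      + phi (enorm y ^+ 2) * pderiv j H y)).
    by apply: filterS (near_line_enorm _ oD Dx) => s; exact: pE.
  have := is_deriveD d1 d2; move/is_derive_eq; apply.
  rewrite (pderivM j s2 sH) (pderivZ j _ (smoothfun_coord _ j)) pderiv_coord eqxx -/t.
  by rewrite mulr1; ring.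
rewrite /weighted_laplacian /laplacian (eq_bigr _ (fun j _ => ppE j)) !big_split/=.
rewrite -!mulr_sumr -/(dot x x) -enorm_sqr -/(laplacian H x) lH -/(dirder x H x) eH.
rewrite sumr_const card_ord -mulr_natr -/t.
have -> : dirder x f x = 2 * phi1 t * H x * t + phi t * (k%:R * H x).
  rewrite /dirder (eq_bigr (fun j => 2 * phi1 t * H x * (x 0 j * x 0 j)
      + phi t * (x 0 j * pderiv j H x))).
    by rewrite big_split/= -!mulr_sumr -/(dot x x) -enorm_sqr -/(dirder x H x) eH.
  by move=> j _; rewrite pE// -/t; ring.
by ring.
Qed.

Lemma ball_int_lin (a b : R) u w : smoothfun u -> smoothfun w ->
  ball_int (fun y => a * u y + b * w y) = a * ball_int u + b * ball_int w.
Proof.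
move=> su sw; rewrite ball_intD ?ball_intZ//.
  exact: smoothfunM (smoothfun_cst _ _) su.
exact: smoothfunM (smoothfun_cst _ _) sw.
Qed.

(** Green's identity: the difference of the integrands is the divergence of rho (u grad w - w grad
    u), which integrates to 0. *)
Lemma ball_int_weighted_laplacian_sym u w : smoothfun u -> smoothfun w ->
  ball_int (fun y => u y * weighted_laplacian w y)
  = ball_int (fun y => w y * weighted_laplacian u y).
Proof.
move=> su sw; apply/eqP; rewrite -subr_eq0; apply/eqP.
have sL g : smoothfun g -> smoothfun (weighted_laplacian g).
  by move=> sg; rewrite /weighted_laplacian /laplacian /dirder; smooth_tac.
rewrite -mulN1r -ball_intZ; last by apply: smoothfunM => //; exact: sL.
rewrite -ball_intD; [|by apply: smoothfunM => //; exact: sL|]; last first.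
  by apply: smoothfunM; [exact: smoothfun_cst|apply: smoothfunM => //; exact: sL].
pose W j y := u y * pderiv j w y + (- 1) * (w y * pderiv j u y).
have sW j : smoothfun (W j) by rewrite /W; smooth_tac.
transitivity (ball_int (fun y => \sum_j pderiv j (fun y => (1 - enorm y ^+ 2) * W j y) y)).
  apply: eq_ball_int => y _.
  rewrite !weighted_laplacianE !mulr_sumr -big_split/=; apply: eq_bigr => j _.
  have s1 := smoothfun_pderiv j sw; have s2 := smoothfun_pderiv j su.
  rewrite (pderivM j (@smoothfun_rho R m) (sW j)) pderiv_rho /W.
  rewrite (pderivD j (smoothfunM su s1) (smoothfunM (smoothfun_cst _ _) (smoothfunM sw s2))).
  rewrite (pderivZ j _ (smoothfunM sw s2)) (pderivM j su s1) (pderivM j sw s2) /rho.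
  move: (pderiv j _ _) (pderiv j _ _) (pderiv j w y) (pderiv j u y) (u y) (w y) (y 0 j).
  by move: (enorm y ^+ 2) => *; ring.
rewrite ball_int_sum => [|j]; last first.
  by apply: smoothfun_pderiv; exact: (smoothfunM (@smoothfun_rho R m) (sW j)).
by rewrite big1// => j _; exact: ball_int_pderiv0.
Qed.

(** * Transforms by kernels g(<x, y>) and the prolate equation *)

Section KernelTransform.
Variables (g : R -> R) (s : R) (w : 'rV[R]_m -> R).
Hypotheses (sg : smooth g) (g2 : forall t, derive1 (derive1 g) t = - s ^+ 2 * g t).
Hypothesis sw : smoothfun w.

Let F x := ball_int (fun y => g (dot x y) * w y).

Lemma pderiv_ball_int (h : R -> R) u j : smooth h -> smoothfun u ->
  pderiv j (fun x => ball_int (fun y => h (dot x y) * u y))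
  = fun x => ball_int (fun y => derive1 h (dot x y) * (y 0 j * u y)).
Proof.
move=> sh su; apply/funext => x; apply: pderivE.
have := is_derive_ball_int x (delta_mx 0 j) sh su.
move/is_derive_eq; apply; apply: eq_ball_int => y _.
by rewrite dot_delta mulrCA.
Qed.

(* The right-hand side is symmetric in x and y. *)
Lemma weighted_laplacian_kernel_sym x y :
  weighted_laplacian (fun y => g (dot x y)) y - s ^+ 2 * enorm y ^+ 2 * g (dot x y)
  = - s ^+ 2 * (enorm x ^+ 2 + enorm y ^+ 2 - enorm x ^+ 2 * enorm y ^+ 2) * g (dot x y)
    - 2 * dot x y * derive1 g (dot x y).
Proof.
have sd := smoothfun_dot x; have sg' := smooth_derive sg.
have p1 j : pderiv j (fun y => g (dot x y)) = fun y => x 0 j * derive1 g (dot x y).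
  rewrite (pderiv_comp j sg sd) pderiv_dot.
  by apply/funext => z; rewrite mulrC.
have p2 j : pderiv j (pderiv j (fun y => g (dot x y))) y
    = x 0 j * x 0 j * (- s ^+ 2 * g (dot x y)).
  rewrite p1 (pderivZ j _ (smoothfun_comp sg' sd)) (pderiv_comp j sg' sd) pderiv_dot g2.
  by ring.
rewrite /weighted_laplacian /laplacian (eq_bigr _ (fun j _ => p2 j)) -mulr_suml.
rewrite -/(dot x x) -enorm_sqr /dirder.
rewrite (eq_bigr (fun j => (x 0 j * y 0 j) * derive1 g (dot x y))) => [|j _].
  rewrite -mulr_suml -/(dot x y).
  by move: (enorm x ^+ 2) (enorm y ^+ 2) (g _) (derive1 g _) => *; ring.
by rewrite p1 mulrCA mulrA.
Qed.

Lemma weighted_laplacian_ball_int kap x :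
  (forall y, cball 1 y -> weighted_laplacian w y - s ^+ 2 * enorm y ^+ 2 * w y = kap * w y) ->
  weighted_laplacian F x - s ^+ 2 * enorm x ^+ 2 * F x = kap * F x.
Proof.
move=> wE; have sd := smoothfun_dot x; have sg' := smooth_derive sg.
have sg'' := smooth_derive sg'.
have sgx : smoothfun (fun y => g (dot x y)) by smooth_tac.
have sL u : smoothfun u -> smoothfun (weighted_laplacian u).
  by move=> su; rewrite /weighted_laplacian /laplacian /dirder; smooth_tac.
have sj j : smoothfun (fun y => y 0 j * w y) by smooth_tac.
(* The operator in x is taken under the integral and exchanged for the operator in y by the symmetry
   of the kernel. *)
transitivity (ball_int (fun y => w y * weighted_laplacian (fun y => g (dot x y)) y
    + (- s ^+ 2) * (enorm y ^+ 2 * (g (dot x y) * w y)))).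
  have p1 j : pderiv j F = fun x => ball_int (fun y => derive1 g (dot x y) * (y 0 j * w y)).
    exact: pderiv_ball_int.
  have p2 j : pderiv j (pderiv j F) x
      = ball_int (fun y => (- s ^+ 2) * (g (dot x y) * (y 0 j * (y 0 j * w y)))).
    rewrite p1 (pderiv_ball_int j sg' (sj j)); apply: eq_ball_int => y _.
    by rewrite g2 -mulrA.
  pose A j y := - s ^+ 2 * (g (dot x y) * (y 0 j * (y 0 j * w y))).
  pose B j y := derive1 g (dot x y) * (y 0 j * w y).
  have sA j : smoothfun (A j) by rewrite /A; smooth_tac.
  have sB j : smoothfun (B j) by rewrite /B; smooth_tac.
  have sC : smoothfun (fun y => g (dot x y) * w y) by smooth_tac.
  pose T j y := (1 - enorm x ^+ 2) * A j y + (- (2 * x 0 j)) * B j y.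
  have sT j : smoothfun (T j) by rewrite /T; smooth_tac.
  have tE j : (1 - enorm x ^+ 2) * pderiv j (pderiv j F) x - 2 * (x 0 j * pderiv j F x)
      = ball_int (T j).
    by rewrite p2 p1 (ball_int_lin _ _ (sA j) (sB j)) mulNr mulrA.
  rewrite weighted_laplacianE (eq_bigr _ (fun j _ => tE j)) -(ball_int_sum _ _ sT).
  have sS : smoothfun (fun y => \sum_j T j y) by exact: smoothfun_sum.
  rewrite -[X in X - _]mul1r -mulNr -(ball_int_lin _ _ sS sC); apply: eq_ball_int => y _.
  have -> : \sum_j T j y = (- (1 - enorm x ^+ 2) * s ^+ 2 * g (dot x y) * enorm y ^+ 2
      - 2 * dot x y * derive1 g (dot x y)) * w y.
    transitivity (\sum_j ((- (1 - enorm x ^+ 2) * s ^+ 2 * g (dot x y) * w y) * (y 0 j * y 0 j)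
       + (- 2 * derive1 g (dot x y) * w y) * (x 0 j * y 0 j))).
      by apply: eq_bigr => j _; rewrite /T /A /B; ring.
    rewrite big_split/= -!mulr_sumr -/(dot y y) -/(dot x y) -enorm_sqr; ring.
  have := weighted_laplacian_kernel_sym x y.
  move=> /eqP; rewrite subr_eq => /eqP ->.
  by move: (enorm x ^+ 2) (enorm y ^+ 2) (g _) (derive1 g _) (w y) => *; ring.
rewrite ball_intD; [| |by smooth_tac]; last by apply: smoothfunM => //; exact: sL.
(* Green's identity moves the operator from the kernel to [w], where the equation applies. *)
rewrite ball_int_weighted_laplacian_sym// -ball_intD; [| |by smooth_tac]; last first.
  by apply: smoothfunM => //; exact: sL.
rewrite /F -ball_intZ; last by smooth_tac.
apply: eq_ball_int => y /wE; move: (weighted_laplacian w y) (g _) => a b /eqP.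
by rewrite subr_eq => /eqP ->; ring.
Qed.

End KernelTransform.
End ProlateOperator.

(** * The radial equation *)

Section SturmLiouville.
Variable R : realType.
Implicit Types (t u : R).

Lemma mvt_derive (f f' : R -> R) (a b : R) : a < b ->
  (forall u, a <= u <= b -> is_derive u (1 : R) f (f' u)) ->
  exists2 u, a < u < b & f b - f a = f' u * (b - a).
Proof.
move=> ab fD.
have C : {within `[a, b], continuous f}.
  apply: derivable_within_continuous => u; rewrite in_itv/= => uab.
  by have [] := fD u uab.
have D u : u \in `]a, b[%R -> is_derive u (1 : R) f (f' u).
  by rewrite in_itv/= => /andP[/ltW au /ltW ub]; apply: fD; rewrite au.
by have [u uab E] := MVT ab D C; exists u => //; move: uab; rewrite in_itv.
Qed.

(** The product of E with exp(-C u) is nonincreasing and that with exp(C u) nondecreasing; so a zero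
    of E >= 0 propagates forwards by the first and backwards by the second. *)
Lemma gronwall_zero (E E' : R -> R) (a b C : R) : a < b ->
  (forall u, a <= u <= b -> is_derive u (1 : R) E (E' u)) ->
  (forall u, a <= u <= b -> 0 <= E u /\ `|E' u| <= C * E u) ->
  (E a = 0 -> E b = 0) /\ (E b = 0 -> E a = 0).
Proof.
move=> ab ED EC.
have D (c : R) u : a <= u <= b ->
    is_derive u (1 : R) (fun u => E u * expR (c * u)) ((E' u + c * E u) * expR (c * u)).
  move=> uab; have := ED u uab => Eu; apply: is_derive_eq.
  by rewrite /GRing.scale/=; ring.
have abb : a <= b <= b by rewrite lexx ltW.
have aab : a <= a <= b by rewrite lexx ltW.
have [Eb _] := EC b abb; have [Ea _] := EC a aab.
split=> E0; apply/eqP; rewrite eq_le ?Eb ?Ea andbT.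
  have [u /andP[au ub]] := mvt_derive ab (D (- C)).
  rewrite E0 mul0r subr0 => EbE.
  rewrite -(pmulr_lle0 _ (expR_gt0 (- C * b))) EbE.
  have [_] := EC u (introT andP (conj (ltW au) (ltW ub))); rewrite ler_norml => /andP[_ h].
  rewrite mulr_le0_ge0 ?subr_ge0 ?(ltW ab)// mulr_le0_ge0 ?expR_ge0//; lra.
have [u /andP[au ub]] := mvt_derive ab (D C).
rewrite E0 mul0r sub0r => EaE.
rewrite -(pmulr_lle0 _ (expR_gt0 (C * a))) -oppr_ge0 EaE.
have [_] := EC u (introT andP (conj (ltW au) (ltW ub))); rewrite ler_norml => /andP[h _].
rewrite mulr_ge0 ?subr_ge0 ?(ltW ab)// mulr_ge0 ?expR_ge0//; lra.
Qed.

Variables (n : nat) (q : R -> R) (Q : R).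
Hypothesis qQ : forall t, 0 < t < 1 -> `|q t| <= Q.

(* The equation (t^(n/2) (1-t) f')' = t^(n/2-1) q f / 4 on ]0, 1[, f being
   smooth up to the singular point 1. *)
Definition radial_solution (f f1 f2 : R -> R) : Prop :=
  [/\ forall t, 0 < t -> is_derive t (1 : R) f (f1 t),
      forall t, 0 < t -> is_derive t (1 : R) f1 (f2 t)
    & forall t, 0 < t < 1 ->
        4 * t * (1 - t) * f2 t + (2 * n%:R * (1 - t) - 4 * t) * f1 t = q t * f t].

(* With W the Wronskian, t^n ((1 - t) W)^2 is constant on ]0, 1] and vanishes at 1. *)
Lemma radial_wronskian0 f f1 f2 g g1 g2 t :
  radial_solution f f1 f2 -> radial_solution g g1 g2 -> 0 < t < 1 ->
  f t * g1 t = f1 t * g t.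
Proof.
move=> [fD fD1 fE] [gD gD1 gE] /andP[t0 t1].
pose W u := f u * g1 u - f1 u * g u.
pose Z u := u ^+ n * ((1 - u) * W u) ^+ 2.
pose Z' u := n%:R * u ^+ n.-1 * ((1 - u) * W u) ^+ 2 +
  u ^+ n * (2 * ((1 - u) * W u) * (- W u + (1 - u) * (f u * g2 u - f2 u * g u))).
have ZD u : t <= u <= 1 -> is_derive u (1 : R) Z (Z' u).
  move=> /andP[tu _]; have u0 := lt_le_trans t0 tu.
  have ? := fD u u0; have ? := fD1 u u0; have ? := gD u u0; have ? := gD1 u u0.
  have DW : is_derive u (1 : R) W (f u * g2 u - f2 u * g u).
    by rewrite /W; apply: is_derive_eq; rewrite /GRing.scale/=; ring.
  have DV : is_derive u (1 : R) (fun u => (1 - u) * W u)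
      (- W u + (1 - u) * (f u * g2 u - f2 u * g u)).
    by apply: is_derive_eq; rewrite /GRing.scale/=; ring.
  have := is_deriveM (is_deriveX n (is_derive_id u (1 : R))) (is_deriveX 2 DV).
  by rewrite !fctE => /is_derive_eq; apply; rewrite /Z' /GRing.scale/=; ring.
have [u /andP[tu u1] ZE] := mvt_derive t1 ZD.
have u0 := lt_trans t0 tu.
(* Multiplying by 2u completes the coefficient of the second derivatives, so that the equations of
   [f] and [g] can be inserted. *)
have Z'0 : Z' u = 0.
  have c : 2 * u != 0 by rewrite mulf_neq0 ?pnatr_eq0 ?gt_eqF.
  apply: (mulfI c); rewrite mulr0.
  have := fE u; have := gE u; rewrite u0 u1 => /(_ isT) ge /(_ isT) fe.
  have we : 4 * u * (1 - u) * (f u * g2 u - f2 u * g u)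
      = - (2 * n%:R * (1 - u) - 4 * u) * W u.
    rewrite /W; transitivity (f u * (4 * u * (1 - u) * g2 u)
      - g u * (4 * u * (1 - u) * f2 u)); first by ring.
    have -> : 4 * u * (1 - u) * g2 u = q u * g u - (2 * n%:R * (1 - u) - 4 * u) * g1 u.
      by rewrite -ge addrK.
    have -> : 4 * u * (1 - u) * f2 u = q u * f u - (2 * n%:R * (1 - u) - 4 * u) * f1 u.
      by rewrite -fe addrK.
    by ring.
  have un : n%:R * u ^+ n.-1 * u = n%:R * u ^+ n.
    by case: (n) => [|k]; rewrite ?mul0r// exprSr mulrA.
  transitivity (2 * (n%:R * u ^+ n.-1 * u) * ((1 - u) * W u) ^+ 2
    + u ^+ n * ((1 - u) * W u) * (- 4 * u * W u + 4 * u * (1 - u) * (f u * g2 u - f2 u * g u))).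
    by rewrite /Z'; ring.
  by rewrite un we; ring.
have Zt : Z t = 0.
  (* The factor 1 - u makes [Z] vanish at 1; the mean value theorem could be applied up to there
     because the solutions are differentiable at the singular point. *)
  move: ZE; rewrite Z'0 mul0r => /eqP; rewrite subr_eq0 => /eqP <-.
  by rewrite /Z subrr mul0r expr0n/= mulr0.
move: Zt => /eqP; rewrite /Z mulf_eq0 expf_eq0 (gt_eqF t0) andbF/= expf_eq0/=.
by rewrite mulf_eq0 subr_eq0 (gt_eqF t1)/= subr_eq0 => /eqP.
Qed.

(** Uniqueness for the Cauchy problem at a regular point. On [a, b] inside ]0, 1[ the leading
    coefficient is at least d = 4 a (1 - b), so f'' is controlled by f and f', and Gronwall applies
    to f^2 + f'^2. *)
Lemma radial_solution_unique f f1 f2 t0 t : radial_solution f f1 f2 ->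
  0 < t0 < 1 -> f t0 = 0 -> f1 t0 = 0 -> 0 < t < 1 -> f t = 0.
Proof.
move=> [fD fD1 fE] t01 f0 f10 t1.
pose E u := f u ^+ 2 + f1 u ^+ 2.
pose E' u := 2 * f u * f1 u + 2 * f1 u * f2 u.
have Q0 : 0 <= Q by apply: le_trans (qQ t01).
have key a b : 0 < a -> a < b -> b < 1 -> (E a = 0 -> E b = 0) /\ (E b = 0 -> E a = 0).
  move=> a0 ab b1; pose d := 4 * a * (1 - b).
  have d0 : 0 < d by rewrite /d !mulr_gt0// subr_gt0.
  pose K := (2 * n%:R + 4 + Q) / d.
  (* With |f''| <= K (|f| + |f'|), |E'| is at most 2|f f'| + 2K |f'| (|f| + |f'|), and 2|f f'| <=
     f^2 + f'^2 gives the constant 1 + 3K. *)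
  apply: (@gronwall_zero E E' a b (1 + 3 * K)) => // u /andP[au ub].
    have u0 := lt_le_trans a0 au.
    have ? := fD u u0; have ? := fD1 u u0.
    rewrite /E; apply: is_derive_eq; rewrite /E' /GRing.scale/=; ring.
  have u0 := lt_le_trans a0 au; have u1 := le_lt_trans ub b1.
  split; first by rewrite addr_ge0// sqr_ge0.
  have du : d <= 4 * u * (1 - u) by rewrite /d; nra.
  have n0 : 0 <= n%:R :> R by exact: ler0n.
  have K0 : 0 <= K by rewrite divr_ge0 ?(ltW d0)//; lra.
  have Kd : K * d = 2 * n%:R + 4 + Q by rewrite divfK ?gt_eqF.
  have := fE u; rewrite u0 u1 => /(_ isT) fu.
  have f2b : `|f2 u| <= K * (`|f u| + `|f1 u|).
    rewrite -(ler_pM2l d0) (mulrA d K) (mulrC d K) Kd.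
    have : (4 * u * (1 - u)) * f2 u = q u * f u - (2 * n%:R * (1 - u) - 4 * u) * f1 u ->
        d * `|f2 u| <= (2 * n%:R + 4 + Q) * (`|f u| + `|f1 u|).
      move=> E2.
      have : d * `|f2 u| <= `|4 * u * (1 - u) * f2 u|.
        by rewrite normrM ler_wpM2r// (le_trans du)// ler_norm.
      move/le_trans; apply; rewrite E2 (le_trans (ler_normB _ _))// !normrM.
      have c1 : `|2 * n%:R * (1 - u) - 4 * u| <= 2 * n%:R + 4.
        by rewrite ler_norml; apply/andP; split; nra.
      have c2 : `|q u| <= Q by apply: qQ; rewrite u0.
      have := ler_pM (normr_ge0 _) (normr_ge0 _) c1 (lexx `|f1 u|).
      have := ler_pM (normr_ge0 _) (normr_ge0 _) c2 (lexx `|f u|).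
      have := normr_ge0 (f u); have := normr_ge0 (f1 u); nra.
    by apply; rewrite -fu addrK.
  rewrite /E' /E (le_trans (ler_normD _ _))// !normrM (ger0_norm (ler0n _ 2)).
  rewrite -(real_normK (num_real (f u))) -(real_normK (num_real (f1 u))).
  move: f2b (normr_ge0 (f u)) (normr_ge0 (f1 u)) K0.
  move: `|f u| `|f1 u| `|f2 u| (K) => x y z k f2b x0 y0 k0.
  have : y * z <= y * (k * (x + y)) by exact: ler_wpM2l.
  have : 0 <= k * (x - y) ^+ 2 by rewrite mulr_ge0// sqr_ge0.
  have : 0 <= (x - y) ^+ 2 by exact: sqr_ge0.
  have : 0 <= k * x ^+ 2 by rewrite mulr_ge0// sqr_ge0.
  have : 0 <= k * y ^+ 2 by rewrite mulr_ge0// sqr_ge0.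
  nra.
have E0 : E t0 = 0 by rewrite /E f0 f10 expr0n addr0.
suff : E t = 0.
  move=> /eqP; rewrite /E paddr_eq0 ?sqr_ge0// => /andP[].
  by rewrite sqrf_eq0 => /eqP.
move: t01 t1 => /andP[a0 a1] /andP[b0 b1].
have [tt|tt|<-//] := ltgtP t0 t.
  exact: (key _ _ a0 tt b1).1.
exact: (key _ _ b0 tt a1).2.
Qed.

(** The difference g - mu f vanishes at t0 by the choice of mu, and so does its derivative because
    the Wronskian vanishes. *)
Lemma radial_solution_proportional f f1 f2 g g1 g2 t0 t :
  radial_solution f f1 f2 -> radial_solution g g1 g2 ->
  0 < t0 < 1 -> f t0 != 0 -> 0 < t < 1 -> g t = g t0 / f t0 * f t.
Proof.
move=> Sf Sg t01 f0 t1; set mu := g t0 / f t0.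
have W0 := radial_wronskian0 Sf Sg t01.
move: Sf Sg => [fD fD1 fE] [gD gD1 gE].
apply/eqP; rewrite -subr_eq0; apply/eqP.
apply: (@radial_solution_unique (fun u => g u - mu * f u) (fun u => g1 u - mu * f1 u)
  (fun u => g2 u - mu * f2 u) t0 t) => //.
- split=> [u u0|u u0|u u01].
  + have ? := fD u u0; have ? := gD u u0.
    by apply: is_derive_eq; rewrite /GRing.scale/=; ring.
  + have ? := fD1 u u0; have ? := gD1 u u0.
    by apply: is_derive_eq; rewrite /GRing.scale/=; ring.
  + by rewrite [RHS]mulrBr (mulrCA (q u) mu) -(gE u u01) -(fE u u01); ring.
- by rewrite /mu divfK// subrr.
- apply: (mulfI f0); rewrite mulr0 mulrBr W0 /mu.
  by field.
Qed.

End SturmLiouville.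

(** * Twice differentiable functions of one variable *)

Section TwiceDerivable.
Variable R : realType.
Implicit Types (D : set R) (f g h : R -> R).

Definition twice_derivable D f := exists f1 f2 : R -> R,
  forall t, D t -> is_derive t (1 : R) f (f1 t) /\ is_derive t (1 : R) f1 (f2 t).

Lemma twice_derivableM D f g : twice_derivable D f -> twice_derivable D g ->
  twice_derivable D (fun t => f t * g t).
Proof.
move=> [f1 [f2 fD]] [g1 [g2 gD]].
exists (fun t => f1 t * g t + f t * g1 t).
exists (fun t => f2 t * g t + 2 * f1 t * g1 t + f t * g2 t) => t Dt.
have [f1D f2D] := fD t Dt; have [g1D g2D] := gD t Dt.
split; first by have := is_deriveM f1D g1D; move/is_derive_eq; apply;
  rewrite /GRing.scale/=; ring.
have := is_deriveD (is_deriveM f2D g1D) (is_deriveM f1D g2D).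
by move/is_derive_eq; apply; rewrite /GRing.scale/=; ring.
Qed.

Lemma twice_derivable_comp D h f : twice_derivable setT h -> twice_derivable D f ->
  twice_derivable D (fun t => h (f t)).
Proof.
move=> [h1 [h2 hD]] [f1 [f2 fD]].
exists (fun t => h1 (f t) * f1 t).
exists (fun t => h2 (f t) * f1 t * f1 t + h1 (f t) * f2 t) => t Dt.
have [f1D f2D] := fD t Dt; have [h1D h2D] := hD (f t) I.
split; first exact: (is_derive_comp1 h1D f1D).
have := is_deriveM (is_derive_comp1 h2D f1D) f2D.
by move/is_derive_eq; apply; rewrite /GRing.scale/=; ring.
Qed.

Lemma twice_derivable_cst D (a : R) : twice_derivable D (fun=> a).
Proof.
by exists (fun=> 0), (fun=> 0) => t _; split; exact: is_derive_cst.
Qed.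

Lemma twice_derivable_id D : twice_derivable D (fun t => t).
Proof.
exists (fun=> 1), (fun=> 0) => t _.
by split; [exact: is_derive_id|exact: is_derive_cst].
Qed.

Lemma twice_derivableX D f n : twice_derivable D f -> twice_derivable D (fun t => f t ^+ n).
Proof.
move=> fD; elim: n => [|n IH]; first exact: twice_derivable_cst.
by under eq_fun do rewrite exprS; exact: twice_derivableM.
Qed.

Lemma twice_derivable_inv : twice_derivable [set t : R | 0 < t] (fun t => t^-1).
Proof.
exists (fun t => - t ^- 2), (fun t => 2 * t ^- 3) => t /= t0.
have tn : t != 0 by rewrite gt_eqF.
split.
  have := is_deriveV tn (is_derive_id t (1 : R)).
  by move/is_derive_eq; apply; rewrite /GRing.scale/= mulr1.
have t2 : t ^+ 2 != 0 by rewrite expf_neq0.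
have := is_deriveN (is_deriveV (f := fun t => t ^+ 2) t2 (is_deriveX 2 (is_derive_id t (1 : R)))).
by move/is_derive_eq; apply; rewrite /GRing.scale/=; field.
Qed.

Lemma twice_derivable_sqrt : twice_derivable [set t : R | 0 < t] Num.sqrt.
Proof.
exists (fun t => (2 * Num.sqrt t)^-1).
exists (fun t => - (2 * Num.sqrt t) ^- 2 * (2 * (2 * Num.sqrt t)^-1)) => t /= t0.
have D := is_derive1_sqrt t0; split => //.
have s0 : 2 * Num.sqrt t != 0 by rewrite mulf_neq0 ?pnatr_eq0// gt_eqF// sqrtr_gt0.
have D2 : is_derive t (1 : R) (fun t => 2 * Num.sqrt t) (2 * (2 * Num.sqrt t)^-1).
  by apply: is_derive_eq; rewrite /GRing.scale/=; ring.
by have := is_deriveV (f := fun t => 2 * Num.sqrt t) s0 D2; move/is_derive_eq; apply.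
Qed.

Lemma smooth_rescale (r : R) f : smooth f -> smooth (fun t => f (r * t)).
Proof.
move=> sf; apply: (@smooth_family _ [set h | exists c (f : R -> R),
  smooth f /\ h = fun t => c * f (r * t)]); last first.
  by exists 1, f; split => //; apply/funext => t; rewrite mul1r.
move=> _ [c [h [sh ->]]]; exists (fun t => (c * r) * derive1 h (r * t)).
  exists (c * r), (derive1 h); split; [exact: smooth_derive|reflexivity].
move=> t; have Dh := smooth_is_derive (r * t) sh.
have Dr : is_derive t (1 : R) (fun t => r * t) r.
  by apply: is_derive_eq; rewrite /GRing.scale/=; ring.
have := is_deriveZ c (is_derive_comp1 Dh Dr).
by move/is_derive_eq; apply; rewrite /GRing.scale/=; ring.
Qed.

Lemma eq0_right_limit f : {for 0, continuous f} ->
  (forall t, 0 < t < 1 -> f t = 0) -> f 0 = 0.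
Proof.
move=> fc f0; have c1 : f t @[t --> 0^'+] --> f 0 by exact: cvg_at_right_filter.
have c2 : f t @[t --> 0^'+] --> (0 : R).
  apply: cvg_near_cst; near=> t; apply: f0; apply/andP; split.
    by near: t; exact: nbhs_right_gt.
  by near: t; exact: nbhs_right_lt.
exact: cvg_unique c1 c2.
Unshelve. all: end_near.
Qed.

End TwiceDerivable.

(** * Eigenfunctions of kernel transforms *)

Section KernelEigenfunction.
Variables (R : realType) (m k : nat).
Implicit Types (H : 'rV[R]_m -> R) (x y : 'rV[R]_m).

(** Exact scaling accompanies Euler's identity because the profile is found by comparing H(r x')
    with H(x') on the unit sphere. *)
Definition homogeneous_harmonic H :=
  harmonic k H /\ forall (a : R) x, H (a *: x) = a ^+ k * H x.

Variables (g P : R -> R) (s kap : R) (H0 : 'rV[R]_m -> R) (om : 'rV[R]_m).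
Hypotheses (sg : smooth g) (g2 : forall t, derive1 (derive1 g) t = - s ^+ 2 * g t).
Hypotheses (sP : smooth P) (hH0 : homogeneous_harmonic H0).
Hypotheses (om1 : dot om om = 1) (H0om : H0 om != 0).

Let ode (t : R) : R := 4 * t * (1 - t) * derive1 (derive1 P) t
  + ((2 * m%:R + 4 * k%:R) * (1 - t) - 4 * t) * derive1 P t - 2 * k%:R * P t
  - s ^+ 2 * t * P t.
Hypothesis odeP : forall x, cball 1 x ->
  ode (enorm x ^+ 2) * H0 x = kap * P (enorm x ^+ 2) * H0 x.

Definition transform H x := ball_int (fun y => g (dot x y) * (P (enorm y ^+ 2) * H y)).

Lemma smoothfun_radial H : homogeneous_harmonic H ->
  smoothfun (fun y => P (enorm y ^+ 2) * H y).
Proof. by move=> [[sH _ _] _]; smooth_tac. Qed.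

Lemma transform_eigen x :
  weighted_laplacian (transform H0) x - s ^+ 2 * enorm x ^+ 2 * transform H0 x
  = kap * transform H0 x.
Proof.
have sW := smoothfun_radial hH0; have sP' := smooth_derive sP.
apply: (weighted_laplacian_ball_int sg g2 sW) => y /odeP E.
have [hh _] := hH0.
have wlE := @weighted_laplacian_radial _ _ setT P (derive1 P) (derive1 (derive1 P)) k
  (fun y => P (enorm y ^+ 2) * H0 y) H0 y openT (fun t _ => smooth_is_derive t sP)
  (fun t _ => smooth_is_derive t sP') hh (fun y _ => erefl) I.
by rewrite wlE (mulrA kap) -E /ode; ring.
Qed.

Lemma transform_is_derive H v x : homogeneous_harmonic H ->
  is_derive x v (transform H)
    (ball_int (fun y => dot v y * (derive1 g (dot x y) * (P (enorm y ^+ 2) * H y)))).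
Proof. by move=> /smoothfun_radial sW; exact: is_derive_ball_int. Qed.

Lemma ball_int_ray (h : R -> R) w r : smooth h -> smoothfun w ->
  is_derive r (1 : R) (fun r => ball_int (fun y => h (dot (r *: om) y) * w y))
    (ball_int (fun y => dot om y * (derive1 h (dot (r *: om) y) * w y))).
Proof.
move=> sh sw; have := is_derive_ball_int (r *: om + 0) om sh sw.
move/(is_derive_line (fun x => ball_int (fun y => h (dot x y) * w y))).
rewrite addr0 (_ : (fun r => _) = fun r => ball_int (fun y => h (dot (r *: om) y) * w y))//.
by apply/funext => u; rewrite addr0.
Qed.

Lemma transform_ray : twice_derivable setT (fun r => transform H0 (r *: om)).
Proof.
have sW := smoothfun_radial hH0; have sg' := smooth_derive sg.
have sV : smoothfun (fun y => dot om y * (P (enorm y ^+ 2) * H0 y)).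
  exact: smoothfunM (smoothfun_dot om) sW.
exists (fun r => ball_int (fun y => derive1 g (dot (r *: om) y) *
  (dot om y * (P (enorm y ^+ 2) * H0 y)))).
exists (fun r => ball_int (fun y => dot om y * (derive1 (derive1 g) (dot (r *: om) y) *
  (dot om y * (P (enorm y ^+ 2) * H0 y))))) => r _.
split; last exact: ball_int_ray.
have := ball_int_ray r sg sW; move/is_derive_eq; apply; apply: eq_ball_int => y _.
by rewrite mulrCA.
Qed.

(* The first and last factors amount to t^(-k/2). *)
Let profile (t : R) : R :=
  Num.sqrt t ^+ k * transform H0 (Num.sqrt t *: om) * (H0 om)^-1 * t^-1 ^+ k.

(** The radius |x| is absorbed into the kernel, and Funk-Hecke compares the pair [H], x/|x| with the
    reference pair [H0], [om]. The profile does not depend on [H], which is why all components end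
    up with one eigenvalue. *)
Lemma transform_profile H x : homogeneous_harmonic H -> 0 < enorm x ^+ 2 ->
  transform H x = profile (enorm x ^+ 2) * H x.
Proof.
move=> [hh hH] x0; have [hh0 hHH0] := hH0.
have {}x0 : 0 < enorm x by rewrite lt_neqAle enorm_ge0 andbT eq_sym -sqrf_eq0 gt_eqF.
have xn : enorm x != 0 by rewrite gt_eqF.
set r := enorm x in x0 xn *; pose x' := r^-1 *: x.
have xE : x = r *: x' by rewrite scalerA divff// scale1r.
have x'1 : dot x' x' = 1.
  by rewrite -enorm_sqr enormZ ?invr_ge0 ?ltW// mulVf// expr1n.
have sgr := @smooth_rescale R r g sg.
have := funk_hecke sgr sP hh hh0 x'1 om1.
have E G z : ball_int (fun y => g (r * dot z y) * P (enorm y ^+ 2) * G y) = transform G (r *: z).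
  by apply: eq_ball_int => y _; rewrite dotZ mulrA.
rewrite !E -xE => FE.
rewrite /profile sqrtr_sqr (gtr0_norm x0).
rewrite {2}xE hH; apply: (mulIf H0om); rewrite FE.
have rk : r ^+ k * (r ^+ 2)^-1 ^+ k * r ^+ k = 1.
  by rewrite -!exprMn (_ : r * _ * r = 1) ?expr1n//; field.
transitivity ((r ^+ k * (r ^+ 2)^-1 ^+ k * r ^+ k) * (transform H0 (r *: om) * H x')).
  by rewrite rk mul1r.
by move: (_^-1 ^+ k) (r ^+ k) (transform _ _) (H x') => *; field.
Qed.

Lemma profile_twice_derivable : twice_derivable [set t : R | 0 < t] profile.
Proof.
apply: twice_derivableM; last exact/twice_derivableX/twice_derivable_inv.
apply: (twice_derivable_comp (h := fun r => r ^+ k * transform H0 (r *: om) * (H0 om)^-1)).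
  apply: twice_derivableM; last exact: twice_derivable_cst.
  apply: twice_derivableM; last exact: transform_ray.
  exact/twice_derivableX/twice_derivable_id.
exact: twice_derivable_sqrt.
Qed.

Let Hsqrt t : 0 < t -> H0 (Num.sqrt t *: om) != 0 /\ enorm (Num.sqrt t *: om) ^+ 2 = t.
Proof.
move=> t0; have [_ hHH0] := hH0; split.
  by rewrite hHH0 mulf_neq0// expf_neq0// gt_eqF// sqrtr_gt0.
by rewrite enormZ ?sqrtr_ge0// exprMn sqr_sqrtr ?ltW// enorm_sqr om1 mulr1.
Qed.

Let q (t : R) : R := s ^+ 2 * t + kap + 2 * k%:R.

Let q_bounded t : 0 < t < 1 -> `|q t| <= s ^+ 2 + `|kap| + 2 * k%:R.
Proof.
move=> /andP[t0 t1]; rewrite /q.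
apply: le_trans (ler_normD _ _) _; apply: lerD; last by rewrite ger0_norm ?mulr_ge0.
apply: le_trans (ler_normD _ _) _; apply: lerD => //.
by rewrite normrM (ger0_norm (sqr_ge0 s)) (gtr0_norm t0) ler_piMr ?sqr_ge0 ?ltW.
Qed.

(** A solid harmonic of degree k acts like 2k additional dimensions: 2m + 4k = 2 (m + 2k).
    Evaluation at sqrt(t) [om] allows cancelling [H0]. *)
Lemma P_solution : radial_solution (m + 2 * k) q P (derive1 P) (derive1 (derive1 P)).
Proof.
have sP' := smooth_derive sP.
split=> [t _|t _|t /andP[t0 t1]]; [exact: smooth_is_derive|exact: smooth_is_derive|].
have [Hn Ht] := Hsqrt t0.
have x1 : cball 1 (Num.sqrt t *: om).
  by apply/cball_sqr; rewrite // -enorm_sqr Ht expr1n ltW.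
have := odeP x1; rewrite Ht => /(mulIf Hn).
rewrite /ode /q natrD natrM; lra.
Qed.

Lemma profile_solution : exists f1 f2, radial_solution (m + 2 * k) q profile f1 f2.
Proof.
have [f1 [f2 fD]] := profile_twice_derivable; exists f1, f2.
split=> [t /fD[]//|t /fD[]//|t /andP[t0 t1]].
have [Hn Ht] := Hsqrt t0; have [hh _] := hH0.
have := transform_eigen (Num.sqrt t *: om).
have E : transform H0 (Num.sqrt t *: om) = profile t * H0 (Num.sqrt t *: om).
  by rewrite (transform_profile hH0) ?Ht.
have Dx : [set t : R | 0 < t] (enorm (Num.sqrt t *: om) ^+ 2) by rewrite /= Ht.
have TP y : [set t : R | 0 < t] (enorm y ^+ 2) ->
    transform H0 y = profile (enorm y ^+ 2) * H0 y by exact: transform_profile.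
have wlE := @weighted_laplacian_radial _ _ [set t : R | 0 < t] profile f1 f2 k _ H0
  (Num.sqrt t *: om) (@open_gt R 0) (fun u u0 => (fD u u0).1) (fun u u0 => (fD u u0).2)
  hh TP Dx.
rewrite wlE E Ht => EQ; apply: (mulIf Hn); rewrite /q natrD natrM; cbv zeta in EQ.
move: EQ; move: (profile t) (H0 _) (f1 t) (f2 t) => a b c d EQ; lra.
Qed.

Lemma transform_eigenfunction : (exists2 t, 0 <= t <= 1 & P t != 0) ->
  exists mu : R, forall H x, homogeneous_harmonic H -> cball 1 x ->
    transform H x = mu * (P (enorm x ^+ 2) * H x).
Proof.
move=> [t1 t1P Pt1].
(* The given point may be an endpoint; by continuity [P] is then nonzero inside as well. *)
have [t0 t01 Pt0] : exists2 t0, 0 < t0 < 1 & P t0 != 0.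
  apply: contrapT => h.
  have P0 t : 0 < t < 1 -> P t = 0.
    by move=> t01; apply/eqP; apply: contrapT => /negP Pt; apply: h; exists t.
  have cP := smooth_continuous sP.
  have [t1lo|t1gt] := leP t1 0.
    have t10 : t1 = 0 by apply/eqP; rewrite eq_le t1lo; case/andP: t1P.
    by move: Pt1; rewrite t10 (eq0_right_limit (cP 0) P0) eqxx.
  have [t1hi|t1lt] := leP 1 t1; last by move: Pt1; rewrite P0 ?eqxx// t1gt.
  have t11 : t1 = 1 by apply/eqP; rewrite eq_le t1hi andbT; case/andP: t1P.
  move: Pt1; rewrite t11.
  have := @eq0_right_limit _ (fun t => P (1 - t)); rewrite subr0 => -> //.
  - by rewrite eqxx.
  - apply: continuous_comp; last exact: cP.
    by apply: cvgB; [exact: cvg_cst|exact: cvg_id].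
  - by move=> t /andP[? ?]; apply: P0; apply/andP; split; lra.
have [f1 [f2 fS]] := profile_solution.
exists (profile t0 / P t0) => H x hH x1.
set mu := _ / _.
have inner y : 0 < enorm y < 1 -> transform H y = mu * (P (enorm y ^+ 2) * H y).
  move=> /andP[y0 y1]; have yy : 0 < enorm y ^+ 2 by rewrite exprn_gt0.
  rewrite (transform_profile hH yy) mulrA.
  rewrite (radial_solution_proportional q_bounded P_solution fS t01 Pt0)//.
  by rewrite yy expr_lt1// enorm_ge0.
(* The segment from x in direction [v] starts inside the punctured open ball: along [om] from the
   centre, towards the centre otherwise. Continuity along it covers the centre and the sphere. *)
pose v := if enorm x == 0 then om else - x.
have vx r : 0 < r < 1 -> 0 < enorm (r *: v + x) < 1.
  move=> /andP[r0 r1]; rewrite /v; case: eqVneq => [x0|xn].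
    have -> : x = 0.
      apply/rowP => j; rewrite mxE; apply/eqP; rewrite -normr_le0 -x0.
      exact: normr_coord_le.
    by rewrite addr0 enormZ ?ltW// /enorm om1 sqrtr1 mulr1 r0.
  have -> : r *: - x + x = (1 - r) *: x by rewrite scalerN scalerBl scale1r addrC.
  have xp : 0 < enorm x by rewrite lt_neqAle eq_sym xn enorm_ge0.
  have x1' : enorm x <= 1 := x1.
  rewrite enormZ ?subr_ge0 ?ltW// mulr_gt0 ?subr_gt0//=; nra.
pose D y := transform H y - mu * (P (enorm y ^+ 2) * H y).
have := @eq0_right_limit R (fun r => D (r *: v + x)).
rewrite scale0r add0r => D0; apply/eqP; rewrite -subr_eq0; apply/eqP; apply: D0.
  have sW := smoothfun_radial hH.
  have d1 := (is_derive_line _ _ _ _ _).1 (transform_is_derive v (0 *: v + x) hH).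
  have d2 := smoothfun_line x v 0 sW.
  have [dD _] := is_deriveB d1 (is_deriveZ mu d2).
  exact: differentiable_continuous ((derivable1_diffP _ _).1 dD).
by move=> r /vx r1; rewrite /D inner// subrr.
Qed.

End KernelEigenfunction.

(** * Injectivity of the transforms *)

Section TransformInjective.
Variables (R : realType) (m : nat) (s : R).
Hypothesis s0 : s != 0.
Implicit Types (f u w H : 'rV[R]_m -> R) (x y : 'rV[R]_m) (a b : R).

(** The solution space of g'' = - s^2 g. It is closed under differentiation, so the cosine and sine
    kernels are handled together. *)
Definition trig a b (t : R) : R := a * cos (s * t) + b * sin (s * t).

Lemma smooth_trig a b : smooth (trig a b).
Proof.
have D c d t : is_derive t (1 : R) (trig c d) (trig (d * s) (- (c * s)) t).
  by rewrite /trig; apply: is_derive_eq; rewrite /GRing.scale/=; ring.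
apply: (@smooth_family _ [set h | exists a b : R, h = trig a b]); last by exists a, b.
move=> _ [c [d ->]]; exists (trig (d * s) (- (c * s))); last exact: D.
by exists (d * s), (- (c * s)).
Qed.

Lemma derive1_trig a b : derive1 (trig a b) = trig (b * s) (- (a * s)).
Proof.
apply/funext => t; rewrite derive1E; apply: derive_val.
by rewrite /trig; apply: is_derive_eq; rewrite /GRing.scale/=; ring.
Qed.

Lemma derive1_trig2 a b t : derive1 (derive1 (trig a b)) t = - s ^+ 2 * trig a b t.
Proof. by rewrite !derive1_trig /trig; ring. Qed.

(** The open ball is used so that the vanishing can be differentiated in x; all [a] and [b] occur at
    once because differentiation mixes the two kernels. *)
Definition transform_null w := smoothfun w /\
  forall a b x, enorm x ^+ 2 < 1 -> ball_int (fun y => trig a b (dot x y) * w y) = 0.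

(* Differentiating the kernel exchanges cosine and sine and produces the factor
   y_j. *)
Lemma transform_null_coord j w : transform_null w -> transform_null (fun y => y 0 j * w y).
Proof.
move=> [sw wN]; split; first by apply: smoothfunM => //; exact: smoothfun_coord.
move=> a b x x1.
have N : \forall r \near (0 : R), enorm (r *: delta_mx 0 j + x) ^+ 2 < 1.
  exact: (@near_line_enorm R m [set t | t < 1] (delta_mx 0 j) x (@open_lt R 1) x1).
(* These coefficients give an antiderivative of [trig a b]; here s must be nonzero. *)
have z : is_derive x (delta_mx 0 j)
    (fun x => ball_int (fun y => trig (- b / s) (a / s) (dot x y) * w y)) (0 : R).
  apply: (@near_line_is_derive _ _ _ (fun=> 0)).
    by apply: filterS N => r; exact: wN.
have /pderivE := z; rewrite pderiv_ball_int//; last exact: smooth_trig.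
rewrite derive1_trig.
by rewrite !divfK// opprK.
Qed.

(** Multipliers form an algebra containing the coordinates, hence all polynomials. *)
Definition multiplier f := smoothfun f /\
  forall w, transform_null w -> transform_null (fun y => f y * w y).

Lemma multiplier_coord j : multiplier (fun y => y 0 j).
Proof. by split; [exact: smoothfun_coord|exact: transform_null_coord]. Qed.

Lemma multiplier_cst a : multiplier (fun=> a).
Proof.
split=> [|w [sw wN]]; first exact: smoothfun_cst.
split; first exact: smoothfunM (smoothfun_cst _ a) sw.
move=> c d x x1; have st : smooth (trig c d) by exact: smooth_trig.
transitivity (a * ball_int (fun y => trig c d (dot x y) * w y)).
  rewrite -ball_intZ; last by smooth_tac.
  by apply: eq_ball_int => y _; rewrite mulrCA.
by rewrite wN ?mulr0.
Qed.

Lemma multiplierD f g : multiplier f -> multiplier g -> multiplier (fun y => f y + g y).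
Proof.
move=> [sf fM] [sg gM]; split=> [|w wN]; first exact: smoothfunD.
have [sfw fN] := fM w wN; have [sgw gN] := gM w wN.
split; first exact: smoothfunM (smoothfunD sf sg) wN.1.
move=> a b x x1; have st : smoothfun (fun y => trig a b (dot x y)).
  by apply: (smoothfun_comp _ (smoothfun_dot x)); exact: smooth_trig.
transitivity (ball_int (fun y => trig a b (dot x y) * (f y * w y))
   + ball_int (fun y => trig a b (dot x y) * (g y * w y))).
  rewrite -ball_intD; [|exact: smoothfunM|exact: smoothfunM].
  by apply: eq_ball_int => y _; ring.
by rewrite fN// gN// addr0.
Qed.

Lemma multiplierM f g : multiplier f -> multiplier g -> multiplier (fun y => f y * g y).
Proof.
move=> [sf fM] [sg gM]; split=> [|w wN]; first exact: smoothfunM.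
by under eq_fun do rewrite -mulrA; exact/fM/gM.
Qed.

Lemma multiplier_sum (I : Type) (r : seq I) (P : pred I) (F : I -> 'rV[R]_m -> R) :
  (forall i, multiplier (F i)) -> multiplier (fun y => \sum_(i <- r | P i) F i y).
Proof.
move=> FM; elim: r => [|i r IH].
  by under eq_fun do rewrite big_nil; exact: multiplier_cst.
under eq_fun do rewrite big_cons.
by case: (P i) => //; exact: multiplierD.
Qed.

Lemma multiplier_prod (I : Type) (r : seq I) (P : pred I) (F : I -> 'rV[R]_m -> R) :
  (forall i, multiplier (F i)) -> multiplier (fun y => \prod_(i <- r | P i) F i y).
Proof.
move=> FM; elim: r => [|i r IH].
  by under eq_fun do rewrite big_nil; exact: multiplier_cst.
under eq_fun do rewrite big_cons.
by case: (P i) => //; exact: multiplierM.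
Qed.

Lemma multiplierX f n : multiplier f -> multiplier (fun y => f y ^+ n).
Proof.
move=> fM; elim: n => [|n IH]; first exact: multiplier_cst.
by under eq_fun do rewrite exprS; exact: multiplierM.
Qed.

Lemma multiplier_homogeneous_poly k (f : 'rV[R]_m -> clifford R m) A :
  homogeneous_poly k f -> multiplier (fun y => f y A).
Proof.
move=> [a fE]; under eq_fun do rewrite fE cl_sumE.
apply: multiplier_sum => al; under eq_fun do rewrite clZE.
apply: multiplierM; last exact: multiplier_cst.
by apply: multiplier_prod => j; apply: multiplierX; exact: multiplier_coord.
Qed.

Lemma multiplier_radial_poly (p : {poly R}) :
  multiplier (fun y => p.[enorm y ^+ 2]).
Proof.
under eq_fun do rewrite horner_coef.
apply: multiplier_sum => i; apply: multiplierM; first exact: multiplier_cst.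
apply: multiplierX; under eq_fun do rewrite enorm_sqr.
by apply: multiplier_sum => j; apply: multiplierM; exact: multiplier_coord.
Qed.

(** At x = 0 the cosine kernel is the constant 1. *)
Lemma transform_null_ball_int w : transform_null w -> ball_int w = 0.
Proof.
move=> [sw wN]; have := wN 1 0 0.
have d0 y : dot 0 y = 0 :> R by rewrite /dot big1// => j _; rewrite mxE mul0r.
rewrite enorm_sqr d0 ltr01 => /(_ isT) <-.
by apply: eq_ball_int => y _; rewrite d0 /trig mulr0 cos0 mul0r addr0 !mul1r.
Qed.

(** With w = P H, w^2 = P (H w), while p H w integrates to 0 for every polynomial p in |y|^2; such p
    approximate [P] uniformly. *)
Lemma transform_null_radial_sqr (P : R -> R) H : smooth P -> multiplier H ->
  transform_null (fun y => P (enorm y ^+ 2) * H y) ->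
  ball_int (fun y => (P (enorm y ^+ 2) * H y) ^+ 2) = 0.
Proof.
move=> sP HM wN; have [sH _] := HM; have [sw _] := wN.
set w := (fun y => _) in wN sw.
have sHw : smoothfun (fun y => H y * w y) by exact: smoothfunM.
have [K KP] := smoothfun_bounded 1 sHw.
apply: (@le_all_eps_eq0 _ _ (K * ball_vol R m)) => e e0 _.
have [p pP] := smooth_poly_approx sP ltr01 e0.
have pN := transform_null_ball_int ((multiplier_radial_poly p).2 _ (HM.2 _ wN)).
have sp := (multiplier_radial_poly p).1.
rewrite -[X in `|X|]subr0 -pN -[X in _ - X]mul1r -mulNr -ball_intZ; last exact: smoothfunM.
rewrite -ball_intD; [|exact: smoothfunX|]; last first.
  exact: smoothfunM (smoothfun_cst _ _) (smoothfunM sp sHw).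
rewrite mulrAC; apply: ball_int_le.
  apply: smoothfunD; first exact: smoothfunX.
  exact: smoothfunM (smoothfun_cst _ _) (smoothfunM sp sHw).
move=> y y1; have y1' : enorm y <= 1 by exact: y1.
have ez : `|enorm y ^+ 2| <= 1 by rewrite ger0_norm ?sqr_ge0// expr_le1 ?enorm_ge0.
have -> : (P (enorm y ^+ 2) * H y) ^+ 2 + - 1 * (p.[enorm y ^+ 2] * (H y * w y))
    = (H y * w y) * (P (enorm y ^+ 2) - p.[enorm y ^+ 2]).
  by rewrite /w; ring.
by rewrite normrM ler_pM// ?KP ?pP.
Qed.

End TransformInjective.

(** * Time-band limiting *)

Section TimeBandLimiting.
Variables (R : realType) (m : nat).
Implicit Types (x y xi : 'rV[R]_m) (f : 'rV[R]_m -> clifford R m).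

Lemma cl_normsqE (a : clifford R m) : cl_normsq a = \sum_A a A ^+ 2.
Proof.
rewrite /cl_normsq clME; apply: eq_bigr => A _.
by rewrite symd0 ffunE mulrA cl_sign_sqr; ring.
Qed.

Lemma smoothfun_rescale (a : R) (f : 'rV[R]_m -> R) :
  smoothfun f -> smoothfun (fun y => f (a *: y)).
Proof.
elim=> {f} [b|j|f g _ IHf _ IHg|f g _ IHf _ IHg|h f sh _ IH].
- exact: smoothfun_cst.
- under eq_fun do rewrite mxE.
  exact: (smoothfunM (smoothfun_cst _ _) (smoothfun_coord _ _)).
- exact: (smoothfunD IHf IHg).
- exact: (smoothfunM IHf IHg).
- exact: (smoothfun_comp sh IH).
Qed.

Lemma vint_support (f g : 'rV[R]_m -> R) :
  (forall x, cball 1 x -> f x = g x) -> (forall x, ~ cball 1 x -> f x = 0) ->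
  vint setT f = ball_int g.
Proof.
move=> fg f0; rewrite /ball_int /vint preimage_setT [in RHS]Rintegral_mkcond.
apply: eq_Rintegral => t _; rewrite /patch; case: ifPn => tb.
  by apply: fg; move: tb; rewrite inE.
by apply: f0 => h; case/negP: tb; rewrite inE.
Qed.

Lemma eq_vint (D : set 'rV[R]_m) (f g : 'rV[R]_m -> R) :
  (forall x, D x -> f x = g x) -> vint D f = vint D g.
Proof. by move=> fg; apply: eq_Rintegral => t /set_mem; exact: fg. Qed.

Lemma clZ_complexE (z : R[i]) (a : clifford R[i] m) A : (z *: a) A = z * a A.
Proof. by rewrite ffunE. Qed.

Variables (c : R) (mu nu : R) (f : 'rV[R]_m -> clifford R m) (w : 'rV[R]_m -> clifford R m).
Hypothesis c0 : 0 < c.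
Hypothesis sw : forall A, smoothfun (fun y => w y A).
Hypothesis f_in : forall x, cball 1 x -> f x = w x.
Hypothesis f_out : forall x, ~ cball 1 x -> f x = 0.
Hypothesis w_cos : forall A x, cball 1 x ->
  ball_int (fun y => trig (2 * pi * c) 1 0 (dot x y) * w y A) = mu * w x A.
Hypothesis w_sin : forall A x, cball 1 x ->
  ball_int (fun y => trig (2 * pi * c) 0 1 (dot x y) * w y A) = nu * w x A.

Let trig_cos t : trig (2 * pi * c) 1 0 t = cos (2 * pi * c * t).
Proof. by rewrite /trig mul1r mul0r addr0. Qed.

Let trig_sin t : trig (2 * pi * c) 0 1 t = sin (2 * pi * c * t).
Proof. by rewrite /trig mul1r mul0r add0r. Qed.

Lemma fourier_ball xi A : cball 1 xi ->
  fourier (fun y => cl_complex (f y)) (c *: xi) A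
  = (mu * w xi A) +i* (- (nu * w xi A)).
Proof.
move=> xi1; rewrite /fourier ffunE; congr (_ +i* _).
  rewrite -(w_cos A xi1); apply: vint_support => x xb.
    rewrite clZ_complexE ffunE f_in//= trig_cos mulr0 subr0 cosN; congr (cos _ * _).
    by rewrite dotC dotZ; ring.
  by rewrite clZ_complexE ffunE f_out// ffunE /= !mulr0 subr0.
rewrite -(w_sin A xi1) -mulN1r -ball_intZ; last first.
  apply: smoothfunM => //; apply: (smoothfun_comp _ (smoothfun_dot xi)).
  exact: smooth_trig.
apply: vint_support => x xb.
  rewrite clZ_complexE ffunE f_in//= trig_sin mulr0 add0r sinN mulN1r mulNr; congr (- (sin _ * _)).
  by rewrite dotC dotZ; ring.
by rewrite clZ_complexE ffunE f_out// ffunE /= !mulr0 addr0.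
Qed.

(** At c xi the Fourier transform equals (mu - i nu) w(xi). Rescaling B(c) costs c^m, and the
    conjugate kernel contributes mu + i nu, so the imaginary part cancels. *)
Lemma P_op_ball x A : cball 1 x ->
  P_op c (fun y => cl_complex (f y)) x A = (c ^+ m * (mu ^+ 2 + nu ^+ 2) * w x A)%:C.
Proof.
move=> x1; rewrite /P_op ffunE.
have cn : c != 0 by rewrite gt_eqF.
have st a b : smoothfun (fun y => trig (2 * pi * c) a b (dot x y)).
  by apply: (smoothfun_comp _ (smoothfun_dot x)); exact: smooth_trig.
have F a b : smoothfun (fun y => (a * trig (2 * pi * c) 1 0 (dot x y)
     + b * trig (2 * pi * c) 0 1 (dot x y)) * w y A).
  apply: smoothfunM => //.
  exact: (smoothfunD (smoothfunM (smoothfun_cst _ a) (st 1 0))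
    (smoothfunM (smoothfun_cst _ b) (st 0 1))).
(* Stated for free coefficients because the real part needs (mu, nu) and the imaginary part (-nu,
   mu). *)
have V a b (U : 'rV[R]_m -> R) :
    (forall xi, cball c xi -> U xi = (a * trig (2 * pi * c) 1 0 (dot x (c^-1 *: xi))
       + b * trig (2 * pi * c) 0 1 (dot x (c^-1 *: xi))) * w (c^-1 *: xi) A) ->
    vint (cball c) U = c ^+ m * ((a * mu + b * nu) * w x A).
  move=> UE; rewrite (eq_vint UE) vint_scale//; last first.
    exact: smoothfun_measurable (smoothfun_rescale c^-1 (F a b)).
  congr (_ * _).
  under eq_ball_int => y _ do rewrite scalerA mulVf// scale1r.
  transitivity (ball_int (fun y => a * (trig (2 * pi * c) 1 0 (dot x y) * w y A)
     + b * (trig (2 * pi * c) 0 1 (dot x y) * w y A))).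
    by apply: eq_ball_int => y _; ring.
  rewrite ball_int_lin; [|exact: smoothfunM|exact: smoothfunM].
  by rewrite w_cos// w_sin//; ring.
have G xi : cball c xi ->
    (cis (2 * pi * dot xi x) *: fourier (fun y => cl_complex (f y)) xi) A
    = ((mu * trig (2 * pi * c) 1 0 (dot x (c^-1 *: xi))
       + nu * trig (2 * pi * c) 0 1 (dot x (c^-1 *: xi))) * w (c^-1 *: xi) A)
    +i* (((- nu) * trig (2 * pi * c) 1 0 (dot x (c^-1 *: xi))
       + mu * trig (2 * pi * c) 0 1 (dot x (c^-1 *: xi))) * w (c^-1 *: xi) A).
  move=> xic; set eta := c^-1 *: xi.
  have xiE : xi = c *: eta by rewrite scalerA divff// scale1r.
  have eta1 : cball 1 eta.
    by rewrite /cball/= /eta enormZ ?invr_ge0 ?(ltW c0)// mulrC -[1](mulfV cn) ler_pM2r ?invr_gt0.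
  rewrite clZ_complexE xiE fourier_ball// /cis trig_cos trig_sin dotZ dotC.
  rewrite (_ : 2 * pi * (c * dot x eta) = 2 * pi * c * dot x eta); last by ring.
  apply/eqP; rewrite eq_complex/=; apply/andP; split; apply/eqP; ring.
rewrite (V mu nu); last by move=> xi /G ->.
rewrite (V (- nu) mu); last by move=> xi /G ->.
by apply/eqP; rewrite eq_complex/=; apply/andP; split; apply/eqP; ring.
Qed.

End TimeBandLimiting.

Theorem theorem5p7 (R : realType) (m : nat) (c : R) (hm : (2 <= m)%N)
    (hc : 0 < c) (N k : nat)
    (Y : 'I_(monogenic_rank m k) -> 'rV[R]_m -> clifford R m)
    (hY : monogenic_onb Y) (i : 'I_(monogenic_rank m k))
    (psi : 'rV[R]_m -> clifford R m) (hpsi : even_cpswf c (Y i) N psi) :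
  exists2 lambda : R, 0 < lambda &
    forall x : 'rV[R]_m, cball 1 x ->
      Q_op (P_op c (fun y => cl_complex (psi y))) x
      = lambda%:C *: cl_complex (psi x).
Proof.
have [chi [P [[_ _] [sP Pn0 LE] psiE nrm]]] := hpsi.
have [/(_ i) mY _ _] := hY; have [hom _] := mY.
pose H A y := Y i y A.
pose s := 2 * pi * c.
have s0 : s != 0 by rewrite !mulf_neq0 ?gt_eqF// pi_gt0.
have hH A : homogeneous_harmonic k (H A).
  split; first exact: monogenic_harmonic.
  by move=> a x; rewrite /H (homogeneous_polyZ _ _ hom) clZE.
pose w y := P (enorm y ^+ 2) *: Y i y.
have wE A : (fun y => w y A) = fun y => P (enorm y ^+ 2) * H A y.
  by apply/funext => y; rewrite clZE.
have sw A : smoothfun (fun y => w y A) by rewrite wE; exact: smoothfun_radial.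
have psi_in x : cball 1 x -> psi x = w x by move=> x1; rewrite psiE ifT.
have psi_out x : ~ cball 1 x -> psi x = 0.
  by move=> x1; rewrite psiE ifF//; apply/negP.
have nrmE : ball_int (fun y => \sum_A (w y A) ^+ 2) = 1.
  rewrite -[RHS]/(fine 1%E) -nrm /ball_int /vint; congr fine.
  by apply: eq_integral => t /set_mem tb; rewrite psi_in// cl_normsqE.
(* If every component vanished on the unit sphere, homogeneity would give Y = 0, against the
   normalisation of [psi]. *)
have [om [A0 [om1 Hom]]] : exists om A, dot om om = 1 /\ H A om != 0.
  apply: contrapT => nex.
  have H0 A om : dot om om = 1 -> H A om = 0.
    move=> om1; apply/eqP; apply: contrapT => /negP Ho; apply: nex.
    by exists om, A.
  (* A unit vector is needed at x = 0: for k = 0 the scaling law there reads H(0) = H(e). *)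
  pose e : 'rV[R]_m := delta_mx 0 (Ordinal (ltnW hm)).
  have e1 : dot e e = 1 by rewrite dot_delta mxE !eqxx.
  have HA A x : H A x = 0.
    have [_ hZ] := hH A; have [x0|xn] := eqVneq (enorm x) 0.
      have -> : x = 0 *: e.
        rewrite scale0r; apply/rowP => j; rewrite mxE; apply/eqP.
        by rewrite -normr_le0 -x0 normr_coord_le.
      by rewrite hZ H0// mulr0.
    rewrite -[x](scale1r) -(divff xn) -scalerA hZ H0 ?mulr0//.
    by rewrite -enorm_sqr enormZ ?invr_ge0 ?enorm_ge0// mulVf// expr1n.
  move: nrmE; rewrite (_ : (fun y => _) = fun=> 0) ?ball_int0.
    by move=> /eqP; rewrite eq_sym oner_eq0.
  apply/funext => y; rewrite big1// => A _.
  by have /(congr1 (fun h => h y)) /= -> := wE A; rewrite HA mulr0 expr0n.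
(* The factor - chi - 2k arises because L_c is minus the scalar operator up to the term -2k P from
   Euler's identity. *)
have ode x : cball 1 x -> (let t := enorm x ^+ 2 in
    4 * t * (1 - t) * derive1 (derive1 P) t
    + ((2 * m%:R + 4 * k%:R) * (1 - t) - 4 * t) * derive1 P t - 2 * k%:R * P t
    - s ^+ 2 * t * P t) * H A0 x = (- chi - 2 * k%:R) * P (enorm x ^+ 2) * H A0 x.
  move=> x1; have := LE x x1; rewrite (L_op_radial c x sP mY).
  move=> /ffunP/(_ A0); rewrite !clZE -/(H A0 x) -/s; cbv zeta.
  by move: (derive1 P _) (derive1 (derive1 P) _) (P _) (H A0 x) => p1 p2 p h E; lra.
have eig a b := transform_eigenfunction (smooth_trig (s := s) (a := a) (b := b))
  (derive1_trig2 s a b) sP (hH A0) om1 Hom ode Pn0.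
have [mu muP] := eig 1 0; have [nu nuP] := eig 0 1.
have w_cos A x : cball 1 x ->
    ball_int (fun y => trig s 1 0 (dot x y) * w y A) = mu * w x A.
  move=> x1; rewrite clZE -(muP _ _ (hH A) x1); apply: eq_ball_int => y _.
  by rewrite clZE.
have w_sin A x : cball 1 x ->
    ball_int (fun y => trig s 0 1 (dot x y) * w y A) = nu * w x A.
  move=> x1; rewrite clZE -(nuP _ _ (hH A) x1); apply: eq_ball_int => y _.
  by rewrite clZE.
exists (c ^+ m * (mu ^+ 2 + nu ^+ 2)); last first.
  move=> x x1; rewrite /Q_op ifT//; apply/ffunP => A.
  rewrite (P_op_ball hc sw psi_in psi_out w_cos w_sin A x1) clZ_complexE psi_in//.
  rewrite [cl_complex _ _]ffunE; apply/eqP; rewrite eq_complex/=.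
  by apply/andP; split; apply/eqP; ring.
rewrite mulr_gt0 ?exprn_gt0// lt_neqAle addr_ge0 ?sqr_ge0// andbT eq_sym.
rewrite paddr_eq0 ?sqr_ge0// !sqrf_eq0; apply/negP => /andP[/eqP mu0 /eqP nu0].
(* The normalisation is contradicted one component at a time: each has square integral 0. *)
move: nrmE; rewrite ball_int_sum => [|A]; last exact: smoothfunX.
rewrite big1; first by move=> /eqP; rewrite eq_sym oner_eq0.
move=> A _; rewrite (_ : (fun y => _) = fun y => (P (enorm y ^+ 2) * H A y) ^+ 2); last first.
  by apply/funext => y; rewrite clZE.
apply: (transform_null_radial_sqr s0 sP (multiplier_homogeneous_poly s0 A hom)).
rewrite -wE; split=> // a b x x1.
have xb : cball 1 x.
  by rewrite /cball/= -(ler_sqr (y := 1)) ?nnegrE ?enorm_ge0// expr1n ltW.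
transitivity (a * ball_int (fun y => trig s 1 0 (dot x y) * w y A)
  + b * ball_int (fun y => trig s 0 1 (dot x y) * w y A)).
  have st d e : smoothfun (fun y => trig s d e (dot x y)).
    by apply: (smoothfun_comp _ (smoothfun_dot x)); exact: smooth_trig.
  rewrite -ball_int_lin; [|exact: smoothfunM|exact: smoothfunM].
  by apply: eq_ball_int => y _; rewrite /trig; ring.
by rewrite w_cos// w_sin// mu0 nu0 !mul0r !mulr0 addr0.
Qed.
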